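(* Let $\Bbbk$ be a field of characteristic zero. The DG $\Bbbk$-linear category $(\mathrm{gr}^G\,\Bbbk\mathbf{FA})^\perp$ has underlying $\Bbbk\mathbf{FB}$-bimodule $$\Bbbk\mathbf{FS}\otimes_{\mathbf{FB}}\Bbbk\mathbf{FI}^\perp,$$ with cohomological grading inherited from $\Bbbk\mathbf{FI}^\perp$. The differential is the Koszul complex differential associated to the right $\Bbbk\mathbf{FI}$-module structure of $\Bbbk\mathbf{FS}$ induced by the right augmentation $\Bbbk\mathbf{FA}\to\Bbbk\mathbf{FS}$.
   Context: **Bimodules.** $\mathbf n=\{1,\dots,n\}$, $n\ge0$. $\mathbf{FB},\mathbf{FI},\mathbf{FS},\mathbf{FA}$ are the categories of finite sets with bijections, injections, surjections, all maps; $\Bbbk\mathcal C$ is the $\Bbbk$-linearization. A $\Bbbk\mathbf{FB}$-bimodule is a functor $\mathbf{FB}^{\mathrm{op}}\times\mathbf{FB}\to\Bbbk\text{-mod}$; $(M\otimes_{\mathbf{FB}}N)(\mathbf s,\mathbf t)=\bigoplus_aM(\mathbf a,\mathbf t)\otimes_{\mathfrak S_a}N(\mathbf s,\mathbf a)$. A $\Bbbk$-linear category on finite sets under $\Bbbk\mathbf{FB}$ is a unital monoid for $\otimes_{\mathbf{FB}}$ and is treated like a ring. $M^{[n]}(\mathbf a,\mathbf b)=M(\mathbf a,\mathbf b)$ if $b-a=n$, else $0$. **Right structures.** Composition gives $\Bbbk\mathbf{FI}\otimes_{\mathbf{FB}}\Bbbk\mathbf{FS}\cong\Bbbk\mathbf{FA}$.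 The right augmentation $\Bbbk\mathbf{FA}\to\Bbbk\mathbf{FS}$ sends non-surjective maps to $0$ and is the identity on surjections. The right $\Bbbk\mathbf{FI}$-module structure of $\Bbbk\mathbf{FS}$ is $[p]\cdot[i]=[p\circ i]$ if $p\circ i$ is surjective and $0$ otherwise. **Quadratic duals.** $\Bbbk\mathbf{FI}$ is quadratic over $\Bbbk\mathbf{FB}$, generated by $\Bbbk\mathbf{FI}^{[1]}$. Its right quadratic dual $\Bbbk\mathbf{FI}^\perp$ is the quotient of the tensor algebra over $\Bbbk\mathbf{FB}$ on $\mathrm{Hom}_{\Bbbk\mathbf{FB}^{\mathrm{op}}}(\Bbbk\mathbf{FI}^{[1]},\Bbbk\mathbf{FB})$ (cohomological degree 1) by the ideal generated by $\mathrm{Hom}_{\Bbbk\mathbf{FB}^{\mathrm{op}}}(\Bbbk\mathbf{FI}^{[2]},\Bbbk\mathbf{FB})$, embedded by dualizing the composition $\Bbbk\mathbf{FI}^{[1]}\otimes_{\mathbf{FB}}\Bbbk\mathbf{FI}^{[1]}\to\Bbbk\mathbf{FI}^{[2]}$. With $A=\Bbbk\mathbf{FA}$, $C=\Bbbk\mathbf{FS}$, put $G_nA=\bigoplus_{t\le n}\Bbbk\mathbf{FI}^{[t]}\otimes_{\mathbf{FB}}C$ (spanned by maps whose image has complement of size at most $n$). $\mathrm{gr}^GA$ is quadratic over $C=G_0A$, generated by $U=\mathrm{gr}^G_1A\cong\Bbbk\mathbf{FI}^{[1]}\otimes_{\mathbf{FB}}C$. $(\mathrm{gr}^GA)^\perp$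 is the quotient of the tensor algebra over $C$ on the $C$-bimodule $U^*=\mathrm{Hom}_{C^{\mathrm{op}}}(U,C)$ (cohomological degree $1$) by the ideal generated by the image of $\mathrm{Hom}_{C^{\mathrm{op}}}(\mathrm{gr}^G_2A,C)\hookrightarrow\mathrm{Hom}_{C^{\mathrm{op}}}(U\otimes_CU,C)\cong U^*\otimes_CU^*$ (with $\phi\otimes\psi\leftrightarrow(u\otimes v\mapsto\phi(\psi(u)v))$). Its differential is the degree $1$ derivation that vanishes on $\mathrm{Hom}_{\Bbbk\mathbf{FB}^{\mathrm{op}}}(\Bbbk\mathbf{FI}^{[1]},\Bbbk\mathbf{FB})\subset U^*$ and is given on $C$ by $C\to\mathrm{Hom}_{\Bbbk\mathbf{FB}^{\mathrm{op}}}(\Bbbk\mathbf{FI}^{[1]},C)\cong U^*$, $c\mapsto(i\mapsto c\cdot i)$. **Koszul complex.** For a right $\Bbbk\mathbf{FI}$-module $M$, the Koszul complex is $M\otimes_{\mathbf{FB}}\Bbbk\mathbf{FI}^\perp$ with differential given, for $m\in M(\mathbf{a+1})$ and $y\in\Bbbk\mathbf{FI}^\perp(-,\mathbf{a+1})$, by $m\otimes y\mapsto\sum_{x\in\mathbf{a+1}}m\cdot[i_x]\otimes[i_x]^*y$, where $i_x:\mathbf a\to\mathbf{a+1}$ is the order-preserving injection missing $x$ and $[i_x]^*\in\mathrm{Hom}_{\mathfrak S_a^{\mathrm{op}}}(\Bbbk\mathbf{FI}(\mathbf a,\mathbf{a+1}),\Bbbk\mathfrak S_a)$ is the dual basis to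 the $\Bbbk\mathfrak S_a^{\mathrm{op}}$-basis $\{[i_x]\}$ of $\Bbbk\mathbf{FI}(\mathbf a,\mathbf{a+1})$. *)

(* Defs.v *)
From HB Require Import structures.
From mathcomp Require Import all_boot all_order all_algebra.
From mathcomp Require Import boolp.
From mathcomp Require Import finmap monalg.

Set Implicit Arguments.
Unset Strict Implicit.
Unset Printing Implicit Defensive.

Import GRing.Theory.
Local Open Scope ring_scope.
Local Open Scope quotient_scope.

Section LinearPredicate.
Variables (k : fieldType) (V W : lmodType k) (f : V -> W).
Hypothesis fL : linear f.

Lemma linf0 : f 0 = 0.
Proof.
have := fL 1 0 0; rewrite !scale1r addr0 => h.
by apply: (addrI (f 0)); rewrite addr0 -h.
Qed.
Lemma linfD u v : f (u + v) = f u + f v.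
Proof. by have := fL 1 u v; rewrite !scale1r. Qed.
Lemma linfZ a u : f (a *: u) = a *: f u.
Proof. by have := fL a u 0; rewrite linf0 !addr0. Qed.
Lemma linfN u : f (- u) = - f u.
Proof. by rewrite -scaleN1r linfZ scaleN1r. Qed.
Lemma linfB u v : f (u - v) = f u - f v.
Proof. by rewrite linfD linfN. Qed.
Lemma linf_sum (I : Type) (r : seq I) (P : pred I) (F : I -> V) :
  f (\sum_(i <- r | P i) F i) = \sum_(i <- r | P i) f (F i).
Proof. by apply: (big_morph f linfD linf0). Qed.

End LinearPredicate.

Lemma linear_comb (k : fieldType) (V W : lmodType k) (f g : V -> W) x :
  linear f -> linear g -> linear (fun u => x *: f u + g u).
Proof.
move=> fL gL y u v; rewrite fL gL !scalerDr !scalerA [x * y]mulrC.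
by rewrite addrACA.
Qed.

Lemma linear_compose (k : fieldType) (U V W : lmodType k) (f : U -> V)
    (g : V -> W) : linear f -> linear g -> linear (fun u => g (f u)).
Proof. by move=> fL gL x u v; rewrite fL gL. Qed.

Section FreeModule.
Variables (k : fieldType) (X : choiceType) (V : lmodType k).

(* Linear extension of a map defined on the basis of a free module. *)
Definition fext (f : X -> V) (u : {malg k[X]}) : V :=
  \sum_(x <- msupp u) u@_x *: f x.


Lemma fext_linear (f : X -> V) : linear (fext f).
Proof.
have E (D : {fset X}) (u : {malg k[X]}) : (msupp u `<=` D)%fset ->
    fext f u = \sum_(x <- D) u@_x *: f x.
  move=> sD; rewrite /fext; apply/big_fset_incl => // x _ xu.
  by rewrite mcoeff_outdom // scale0r.
move=> a u v.
pose D := (msupp u `|` msupp v `|` msupp (a *: u + v))%fset.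
rewrite !(E D); do ?by apply/fsubsetP=> x xD; rewrite !in_fsetU xD ?orbT.
rewrite scaler_sumr -big_split /=; apply: eq_bigr => x _.
rewrite mcoeffD scalerA -scalerDl; congr ((_ + _) *: _).
exact: fgscaleE.
Qed.

Lemma fextE (f : X -> V) x : fext f << x >> = f x.
Proof.
by rewrite /fext msuppU oner_eq0 big_seq_fset1 mcoeffUU scale1r.
Qed.

Lemma eq_fext (f g : X -> V) : f =1 g -> fext f =1 fext g.
Proof. by move=> fg u; apply: eq_bigr => x _; rewrite fg. Qed.

Lemma free_ind (P : {malg k[X]} -> Prop) :
  P 0 -> (forall a u v, P u -> P v -> P (a *: u + v)) ->
  (forall x, P << x >>) -> forall u, P u.
Proof.
move=> P0 PL Pb u; rewrite (monalgE u); elim/big_rec: _ => // x v _ Pv.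
suff -> : << u@_x *g x >> = u@_x *: << x >> :> {malg k[X]} by exact: PL.
apply/malgP => y; rewrite [RHS]fgscaleE !mcoeffU.
by case: eqP; rewrite ?mulr1 ?mulr0.
Qed.

End FreeModule.

Section Quotient.
Variables (k : fieldType) (V : lmodType k) (S : V -> Prop).

Inductive lspan : V -> Prop :=
  | lspan0 : lspan 0
  | lspanL a u v : S u -> lspan v -> lspan (a *: u + v).

Lemma lspan_gen u : S u -> lspan u.
Proof. by move=> Su; have := lspanL 1 Su lspan0; rewrite scale1r addr0. Qed.

Lemma lspanD u v : lspan u -> lspan v -> lspan (u + v).
Proof.
elim=> [|a w u' Sw _ IH] Sv; first by rewrite add0r.
by rewrite -addrA; apply: lspanL => //; apply: IH.
Qed.

Lemma lspanZ a u : lspan u -> lspan (a *: u).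
Proof.
elim=> [|b w u' Sw _ IH]; first by rewrite scaler0; exact: lspan0.
by rewrite scalerDr scalerA; apply: lspanL.
Qed.

Lemma lspanN u : lspan u -> lspan (- u).
Proof. by rewrite -scaleN1r; apply: lspanZ. Qed.

Definition lquot_eq (u v : V) : bool := `[< lspan (u - v) >].

Lemma lquot_refl : reflexive lquot_eq.
Proof. by move=> u; apply/asboolP; rewrite subrr; exact: lspan0. Qed.
Lemma lquot_sym : symmetric lquot_eq.
Proof.
by move=> u v; apply/asboolP/asboolP => /lspanN; rewrite opprB.
Qed.
Lemma lquot_trans : transitive lquot_eq.
Proof.
move=> v u w /asboolP uv /asboolP vw; apply/asboolP.
by have := lspanD uv vw; rewrite addrA subrK.
Qed.

Canonical lquot_equiv := EquivRel lquot_eq lquot_refl lquot_sym lquot_trans.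

(* The quotient of V by the submodule spanned by S. *)
Definition lquot_type := {eq_quot lquot_equiv}.
HB.instance Definition _ := Choice.on lquot_type.
HB.instance Definition _ := EqQuotient.on lquot_type.

Local Notation Q := lquot_type.
Definition lpi (u : V) : Q := \pi_Q u.

Lemma lpi_eq u v : lspan (u - v) -> lpi u = lpi v.
Proof. by move=> uv; apply/eqmodP/asboolP. Qed.
Lemma lpi_repr (q : Q) : lpi (repr q) = q.
Proof. exact: reprK. Qed.
Lemma repr_lpi u : lspan (repr (lpi u) - u).
Proof. by have /eqmodP/asboolP := lpi_repr (lpi u). Qed.

Definition lq_add (p q : Q) := lpi (repr p + repr q).
Definition lq_opp (p : Q) := lpi (- repr p).
Definition lq_scale a (p : Q) := lpi (a *: repr p).

Lemma lq_addE u v : lq_add (lpi u) (lpi v) = lpi (u + v).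
Proof.
by apply: lpi_eq; rewrite opprD addrACA; apply: lspanD; exact: repr_lpi.
Qed.
Lemma lq_oppE u : lq_opp (lpi u) = lpi (- u).
Proof. by apply: lpi_eq; rewrite -opprD; apply: lspanN; exact: repr_lpi. Qed.
Lemma lq_scaleE a u : lq_scale a (lpi u) = lpi (a *: u).
Proof. by apply: lpi_eq; rewrite -scalerBr; apply: lspanZ; exact: repr_lpi. Qed.

Lemma lq_addA : associative lq_add.
Proof.
move=> p q r; rewrite -(lpi_repr p) -(lpi_repr q) -(lpi_repr r).
by rewrite !lq_addE addrA.
Qed.
Lemma lq_addC : commutative lq_add.
Proof. by move=> p q; rewrite /lq_add addrC. Qed.
Lemma lq_add0 : left_id (lpi 0) lq_add.
Proof. by move=> p; rewrite -(lpi_repr p) lq_addE add0r. Qed.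
Lemma lq_addN : left_inverse (lpi 0) lq_opp lq_add.
Proof. by move=> p; rewrite -(lpi_repr p) lq_oppE lq_addE addNr. Qed.

HB.instance Definition _ :=
  GRing.isZmodule.Build Q lq_addA lq_addC lq_add0 lq_addN.

Lemma lq_scaleA a b (p : Q) : lq_scale a (lq_scale b p) = lq_scale (a * b) p.
Proof. by rewrite -(lpi_repr p) !lq_scaleE scalerA. Qed.
Lemma lq_scale1 : left_id 1 lq_scale.
Proof. by move=> p; rewrite -(lpi_repr p) lq_scaleE scale1r. Qed.
Lemma lq_scaleDr : right_distributive lq_scale +%R.
Proof.
move=> a p q; rewrite -(lpi_repr p) -(lpi_repr q).
by rewrite -[X in lq_scale _ X]/(lq_add _ _) lq_addE !lq_scaleE scalerDr -lq_addE.
Qed.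
Lemma lq_scaleDl (p : Q) : {morph lq_scale^~ p : a b / a + b}.
Proof.
by move=> a b; rewrite -(lpi_repr p) !lq_scaleE scalerDl -lq_addE.
Qed.

HB.instance Definition _ := GRing.Zmodule_isLmodule.Build k Q
  lq_scaleA lq_scale1 lq_scaleDr lq_scaleDl.

Definition lquot : lmodType k := Q.

Lemma lpi_linear : linear (lpi : V -> lquot).
Proof. by move=> a u v; rewrite -lq_addE -lq_scaleE. Qed.

Lemma lpi_gen u : S u -> lpi u = 0 :> lquot.
Proof. by move=> Su; apply: lpi_eq; rewrite subr0; apply: lspan_gen. Qed.

(* The map induced on the quotient by f: meaningful when f is linear and
   kills S, see lq_liftE. *)
Definition lq_lift (W : Type) (f : V -> W) (q : lquot) : W := f (repr (q : Q)).

Lemma lq_ind (P : lquot -> Prop) : (forall u, P (lpi u)) -> forall q, P q.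
Proof. by move=> h q; rewrite -(lpi_repr q). Qed.

Section Lift.
Variables (W : lmodType k) (f : V -> W).
Hypotheses (fL : linear f) (fS : forall u, S u -> f u = 0).

Lemma lspan_ker u : lspan u -> f u = 0.
Proof.
elim=> [|a w v Sw _ IH]; first exact: (linf0 fL).
by rewrite (linfD fL) (linfZ fL) fS // IH scaler0 addr0.
Qed.

Lemma lq_liftE u : lq_lift f (lpi u) = f u.
Proof.
by apply/eqP; rewrite -subr_eq0 -(linfB fL) (lspan_ker (repr_lpi u)).
Qed.

Lemma lq_lift_linear : linear (lq_lift f).
Proof.
move=> a; elim/lq_ind=> u; elim/lq_ind=> v.
by rewrite -lpi_linear !lq_liftE fL.
Qed.
End Lift.

End Quotient.

Section LinearCategories.
Variable k : fieldType.

(* A k-linear category whose objects are the finite sets 'I_n; the hom spaces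
   C a b consist of morphisms from a to b. *)
Record lincat := LinCat {
  lhom :> nat -> nat -> lmodType k;
  lcomp : forall a b c, lhom b c -> lhom a b -> lhom a c;
  lid : forall a, lhom a a;
  lcomp_linl : forall a b c (f : lhom a b),
    linear (fun g : lhom b c => lcomp g f);
  lcomp_linr : forall a b c (g : lhom b c),
    linear (fun f : lhom a b => lcomp g f);
  lcompA : forall a b c d (h : lhom c d) (g : lhom b c) (f : lhom a b),
    lcomp h (lcomp g f) = lcomp (lcomp h g) f;
  lcomp1l : forall a b (f : lhom a b), lcomp (lid b) f = f;
  lcomp1r : forall a b (f : lhom a b), lcomp f (lid a) = f
}.

(* C-bimodules: M s t is contravariant in s (right action) and covariant in t
   (left action). *)
Record bimod (C : lincat) := Bimod {
  bsort :> nat -> nat -> lmodType k;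
  lact : forall a b c, C b c -> bsort a b -> bsort a c;
  ract : forall a b c, bsort b c -> C a b -> bsort a c;
  lact_linl : forall a b c (m : bsort a b), linear (fun g : C b c => lact g m);
  lact_linr : forall a b c (g : C b c), linear (fun m : bsort a b => lact g m);
  ract_linl : forall a b c (f : C a b), linear (fun m : bsort b c => ract m f);
  ract_linr : forall a b c (m : bsort b c), linear (fun f : C a b => ract m f);
  lactA : forall a b c d (h : C c d) (g : C b c) (m : bsort a b),
    lact h (lact g m) = lact (lcomp h g) m;
  lact1 : forall a b (m : bsort a b), lact (lid C b) m = m;
  ractA : forall a b c d (m : bsort c d) (g : C b c) (f : C a b),
    ract (ract m g) f = ract m (lcomp g f);
  ract1 : forall a b (m : bsort a b), ract m (lid C a) = m;
  lractA : forall a b c d (h : C c d) (m : bsort b c) (f : C a b),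
    ract (lact h m) f = lact h (ract m f)
}.

Definition regular (C : lincat) : bimod C :=
  Bimod (@lcomp_linl C) (@lcomp_linr C) (@lcomp_linl C) (@lcomp_linr C)
    (@lcompA C) (@lcomp1l C) (fun _ _ _ _ m g f => esym (lcompA m g f))
    (@lcomp1r C) (fun _ _ _ _ h m f => esym (lcompA h m f)).

Section QuotientBimodule.
Variables (C : lincat) (M : bimod C) (S : forall s t, M s t -> Prop).
Hypothesis Sl : forall a b c (g : C b c) (m : M a b),
  S m -> lspan (@S a c) (lact g m).
Hypothesis Sr : forall a b c (m : M b c) (f : C a b),
  S m -> lspan (@S a c) (ract m f).

Definition qb_sort s t : lmodType k := lquot (@S s t).
Definition qb_lact a b c (g : C b c) : qb_sort a b -> qb_sort a c :=
  lq_lift (fun m => lpi (@S a c) (lact g m)).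
Definition qb_ract a b c (m : qb_sort b c) (f : C a b) : qb_sort a c :=
  lq_lift (fun m => lpi (@S a c) (ract m f)) m.

Lemma qb_lpi0 s t (x : M s t) : lspan (@S s t) x -> lpi (@S s t) x = 0 :> lquot _.
Proof. by move=> h; apply: lpi_eq; rewrite subr0. Qed.

Lemma qb_lactE a b c (g : C b c) (m : M a b) :
  qb_lact g (lpi (@S a b) m) = lpi (@S a c) (lact g m).
Proof.
rewrite /qb_lact lq_liftE //.
  by move=> x u v; rewrite lact_linr lpi_linear.
by move=> u Su; apply/qb_lpi0/Sl.
Qed.

Lemma qb_ractE a b c (m : M b c) (f : C a b) :
  qb_ract (lpi (@S b c) m) f = lpi (@S a c) (ract m f).
Proof.
rewrite /qb_ract lq_liftE //.
  by move=> x u v; rewrite ract_linl lpi_linear.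
by move=> u Su; apply/qb_lpi0/Sr.
Qed.

(* The quotient of M by the sub-bimodule spanned by S. *)
Definition quot_bimod : bimod C.
Proof.
refine (@Bimod C qb_sort qb_lact qb_ract _ _ _ _ _ _ _ _ _).
- move=> a b c + x g h; elim/lq_ind=> m.
  by rewrite !qb_lactE lact_linl lpi_linear.
- move=> a b c g x; elim/lq_ind=> u; elim/lq_ind=> v.
  by rewrite -lpi_linear !qb_lactE lact_linr lpi_linear.
- move=> a b c g x; elim/lq_ind=> u; elim/lq_ind=> v.
  by rewrite -lpi_linear !qb_ractE ract_linl lpi_linear.
- move=> a b c + x g h; elim/lq_ind=> m.
  by rewrite !qb_ractE ract_linr lpi_linear.
- by move=> a b c d h g; elim/lq_ind=> m; rewrite !qb_lactE lactA.
- by move=> a b; elim/lq_ind=> m; rewrite qb_lactE lact1.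
- by move=> a b c d + g f; elim/lq_ind=> m; rewrite !qb_ractE ractA.
- by move=> a b; elim/lq_ind=> m; rewrite qb_ractE ract1.
- move=> a b c d h + f; elim/lq_ind=> m.
  by rewrite qb_lactE !qb_ractE qb_lactE lractA.
Defined.

End QuotientBimodule.

Section Tensor.
Variables (C : lincat) (M N : bimod C).

Definition tens_elt s t := {a : nat & (M a t * N s a)%type}.
Definition tens_free s t : lmodType k := {malg k[tens_elt s t]}.
Definition tens_gen s t a (m : M a t) (n : N s a) : tens_free s t :=
  << Tagged (fun a => (M a t * N s a)%type) (m, n) >>.

Inductive tens_rel s t : tens_free s t -> Prop :=
  | TensLinl a x (m m' : M a t) (n : N s a) :
      tens_rel (tens_gen (x *: m + m') n - (x *: tens_gen m n + tens_gen m' n))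
  | TensLinr a x (m : M a t) (n n' : N s a) :
      tens_rel (tens_gen m (x *: n + n') - (x *: tens_gen m n + tens_gen m n'))
  | TensBal a b (m : M b t) (c : C a b) (n : N s a) :
      tens_rel (tens_gen (ract m c) n - tens_gen m (lact c n)).

Definition tens_sort s t : lmodType k := lquot (@tens_rel s t).
Definition telt s t a (m : M a t) (n : N s a) : tens_sort s t :=
  lpi (@tens_rel s t) (tens_gen m n).

Lemma telt_linl s t a (n : N s a) : linear (fun m : M a t => telt m n).
Proof.
move=> x m m'; apply/eqP; rewrite -subr_eq0; apply/eqP.
by rewrite -lpi_linear -(linfB (@lpi_linear _ _ _)); apply/lpi_gen/TensLinl.
Qed.
Lemma telt_linr s t a (m : M a t) : linear (fun n : N s a => telt m n).
Proof.
move=> x n n'; apply/eqP; rewrite -subr_eq0; apply/eqP.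
by rewrite -lpi_linear -(linfB (@lpi_linear _ _ _)); apply/lpi_gen/TensLinr.
Qed.
Lemma telt_bal s t a b (m : M b t) (c : C a b) (n : N s a) :
  telt (ract m c) n = telt m (lact c n).
Proof.
apply/eqP; rewrite -subr_eq0; apply/eqP.
by rewrite -(linfB (@lpi_linear _ _ _)); apply/lpi_gen/TensBal.
Qed.

Lemma tens_ind s t (P : tens_sort s t -> Prop) :
  P 0 -> (forall x u v, P u -> P v -> P (x *: u + v)) ->
  (forall a (m : M a t) (n : N s a), P (telt m n)) -> forall u, P u.
Proof.
move=> P0 PL Pt; elim/lq_ind; elim/free_ind => [|x u v|[a [m n]]].
- by rewrite (linf0 (@lpi_linear _ _ _)).
- by rewrite lpi_linear; apply: PL.
- exact: Pt.
Qed.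

(* The map m (x) n |-> f m n: meaningful when f is bilinear and balanced. *)
Definition tlift s t (V : lmodType k) (f : forall a, M a t -> N s a -> V) :
    tens_sort s t -> V :=
  lq_lift (fext (fun e => f (tag e) (tagged e).1 (tagged e).2)).

Section Lift.
Variables (s t : nat) (V : lmodType k) (f : forall a, M a t -> N s a -> V).
Hypotheses (fl : forall a n, linear (fun m => @f a m n))
  (fr : forall a m, linear (fun n => @f a m n))
  (fb : forall a b m (c : C a b) n, f (ract m c) n = f m (lact c n)).

Lemma tlift_ker u : tens_rel u ->
  fext (fun e : tens_elt s t => f (tagged e).1 (tagged e).2) u = 0.
Proof.
have L := fext_linear (fun e : tens_elt s t => f (tagged e).1 (tagged e).2).
case=> [a x m m' n|a x m n n'|a b m c n];
  rewrite (linfB L) ?L /tens_gen !fextE /=.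
- by rewrite fl subrr.
- by rewrite fr subrr.
- by rewrite fb subrr.
Qed.

Lemma tliftE a (m : M a t) (n : N s a) : tlift f (telt m n) = f m n.
Proof.
rewrite /tlift /telt lq_liftE; first by rewrite /tens_gen fextE.
  exact: fext_linear.
exact: tlift_ker.
Qed.

Lemma tlift_linear : linear (tlift f).
Proof. by apply: lq_lift_linear; [exact: fext_linear|exact: tlift_ker]. Qed.
End Lift.

Definition tens_lact a b c (g : C b c) : tens_sort a b -> tens_sort a c :=
  tlift (fun e m n => telt (lact g m) n).
Definition tens_ract a b c (u : tens_sort b c) (f : C a b) : tens_sort a c :=
  tlift (fun e m n => telt m (ract n f)) u.

Lemma tens_lact_linear a b c (g : C b c) : linear (@tens_lact a b c g).
Proof.
apply: tlift_linear.
- by move=> e n x m m'; rewrite lact_linr telt_linl.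
- by move=> e m x n n'; rewrite telt_linr.
- by move=> e e' m f n; rewrite -lractA telt_bal.
Qed.
Lemma tens_lactE a b c (g : C b c) e (m : M e b) (n : N a e) :
  tens_lact g (telt m n) = telt (lact g m) n.
Proof.
apply: tliftE.
- by move=> e' n' x m' m''; rewrite lact_linr telt_linl.
- by move=> e' m' x n' n''; rewrite telt_linr.
- by move=> e1 e2 m' f n'; rewrite -lractA telt_bal.
Qed.
Lemma tens_ract_linear a b c (f : C a b) :
  linear (fun u : tens_sort b c => tens_ract u f).
Proof.
apply: tlift_linear.
- by move=> e n x m m'; rewrite telt_linl.
- by move=> e m x n n'; rewrite ract_linl telt_linr.
- by move=> e e' m g n; rewrite lractA telt_bal.
Qed.
Lemma tens_ractE a b c e (m : M e c) (n : N b e) (f : C a b) :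
  tens_ract (telt m n) f = telt m (ract n f).
Proof.
apply: tliftE.
- by move=> e' n' x m' m''; rewrite telt_linl.
- by move=> e' m' x n' n''; rewrite ract_linl telt_linr.
- by move=> e1 e2 m' g n'; rewrite lractA telt_bal.
Qed.

Lemma tens_eq s t (V : lmodType k) (f g : tens_sort s t -> V) :
  linear f -> linear g ->
  (forall a (m : M a t) (n : N s a), f (telt m n) = g (telt m n)) -> f =1 g.
Proof.
move=> fL gL fg; elim/tens_ind => [|x u v fu fv|//].
  by rewrite (linf0 fL) (linf0 gL).
by rewrite fL gL fu fv.
Qed.

(* The tensor product over C. For the k-linearization C of the category of
   bijections, C a b = 0 when a <> b and this is the direct sum over a of
   M(a, t) (x)_{S_a} N(s, a). *)
Definition tens : bimod C.
Proof.
refine (@Bimod C tens_sort tens_lact tens_ract _ _ _ _ _ _ _ _ _).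
- move=> a b c u x g h; move: u; apply: tens_eq => [||e m n].
  + exact: tens_lact_linear.
  + by apply: linear_comb; exact: tens_lact_linear.
  + by rewrite !tens_lactE lact_linl telt_linl.
- move=> a b c g; exact: tens_lact_linear.
- move=> a b c g; exact: tens_ract_linear.
- move=> a b c u x g h; move: u; apply: tens_eq => [||e m n].
  + exact: tens_ract_linear.
  + by apply: linear_comb; exact: tens_ract_linear.
  + by rewrite !tens_ractE ract_linr telt_linr.
- move=> a b c d h g; apply: tens_eq => [y u v|y u v|e m n].
  + by rewrite !tens_lact_linear.
  + by rewrite !tens_lact_linear.
  + by rewrite !tens_lactE lactA.
- move=> a b; apply: tens_eq => [||e m n].
  + exact: tens_lact_linear.
  + by [].
  + by rewrite tens_lactE lact1.
- move=> a b c d + g f; apply: tens_eq => [y u v|y u v|e m n].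
  + by rewrite !tens_ract_linear.
  + by rewrite !tens_ract_linear.
  + by rewrite !tens_ractE ractA.
- move=> a b; apply: tens_eq => [||e m n].
  + exact: tens_ract_linear.
  + by [].
  + by rewrite tens_ractE ract1.
- move=> a b c d h + f; apply: tens_eq => [y u v|y u v|e m n].
  + by rewrite tens_lact_linear tens_ract_linear.
  + by rewrite tens_ract_linear tens_lact_linear.
  + by rewrite tens_lactE !tens_ractE tens_lactE.
Defined.

End Tensor.

Section RightHom.
Variables (C : lincat) (M N : bimod C).

(* Hom_{C^op}(M(-, s), N(-, t)): morphisms of right C-modules. *)
Record rhom s t := RHom {
  rfun :> forall a, M a s -> N a t;
  rfun_linear : forall a, linear (@rfun a);
  rfun_ract : forall a b (m : M b s) (f : C a b),
    rfun (ract m f) = ract (rfun m) f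
}.

HB.instance Definition _ s t := gen_eqMixin (rhom s t).
HB.instance Definition _ s t := gen_choiceMixin (rhom s t).

Lemma rhomP s t (p q : rhom s t) : (forall a (m : M a s), p a m = q a m) -> p = q.
Proof.
case: p q => [p pL pR] [q qL qR] /= pq.
have E : p = q by apply: functional_extensionality_dep => a; apply/funext/pq.
by case: _ / E in qL qR pq *; congr RHom; exact: Prop_irrelevance.
Qed.

Section Operations.
Variables s t : nat.

Definition rhom0 : rhom s t.
Proof.
exists (fun a _ => 0) => [a x u v|a b m f]; first by rewrite scaler0 addr0.
by rewrite (linf0 (@ract_linl _ _ _ _ _ _)).
Defined.

Definition rhomD (p q : rhom s t) : rhom s t.
Proof.
exists (fun a m => p a m + q a m) => [a x u v|a b m f].
  by rewrite !rfun_linear scalerDr addrACA.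
by rewrite (linfD (@ract_linl _ _ _ _ _ _)) !rfun_ract.
Defined.

Definition rhomZ (x : k) (p : rhom s t) : rhom s t.
Proof.
exists (fun a m => x *: p a m) => [a y u v|a b m f].
  by rewrite rfun_linear scalerDr !scalerA mulrC.
by rewrite (linfZ (@ract_linl _ _ _ _ _ _)) !rfun_ract.
Defined.

Definition rhomN (p : rhom s t) : rhom s t := rhomZ (-1) p.

Lemma rhomDA : associative rhomD.
Proof. by move=> p q r; apply: rhomP => a m /=; rewrite addrA. Qed.
Lemma rhomDC : commutative rhomD.
Proof. by move=> p q; apply: rhomP => a m /=; rewrite addrC. Qed.
Lemma rhom0D : left_id rhom0 rhomD.
Proof. by move=> p; apply: rhomP => a m /=; rewrite add0r. Qed.
Lemma rhomND : left_inverse rhom0 rhomN rhomD.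
Proof. by move=> p; apply: rhomP => a m /=; rewrite scaleN1r addNr. Qed.

HB.instance Definition _ :=
  GRing.isZmodule.Build (rhom s t) rhomDA rhomDC rhom0D rhomND.

Lemma rhomZA x y (p : rhom s t) : rhomZ x (rhomZ y p) = rhomZ (x * y) p.
Proof. by apply: rhomP => a m /=; rewrite scalerA. Qed.
Lemma rhomZ1 : left_id 1 rhomZ.
Proof. by move=> p; apply: rhomP => a m /=; rewrite scale1r. Qed.
Lemma rhomZDr : right_distributive rhomZ +%R.
Proof. by move=> x p q; apply: rhomP => a m /=; rewrite scalerDr. Qed.
Lemma rhomZDl (p : rhom s t) : {morph rhomZ^~ p : x y / x + y}.
Proof. by move=> x y; apply: rhomP => a m /=; rewrite scalerDl. Qed.

HB.instance Definition _ := GRing.Zmodule_isLmodule.Build k (rhom s t)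
  rhomZA rhomZ1 rhomZDr rhomZDl.

End Operations.

Lemma rhomLE s t x (p q : rhom s t) a (m : M a s) :
  (x *: p + q) a m = x *: p a m + q a m.
Proof. by []. Qed.

Definition rhom_lact a b c (g : C b c) (p : rhom a b) : rhom a c.
Proof.
exists (fun r m => lact g (p r m)) => [r x u v|r r' m f].
  by rewrite rfun_linear lact_linr.
by rewrite rfun_ract lractA.
Defined.

Definition rhom_ract a b c (p : rhom b c) (g : C a b) : rhom a c.
Proof.
exists (fun r m => p r (lact g m)) => [r x u v|r r' m f].
  by rewrite lact_linr rfun_linear.
by rewrite -lractA rfun_ract.
Defined.

Definition rhom_sort s t : lmodType k := rhom s t.

(* The bimodule Hom_{C^op}(M, N). *)
Definition rhom_bimod : bimod C.
Proof.
refine (@Bimod C rhom_sort rhom_lact rhom_ract _ _ _ _ _ _ _ _ _).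
- by move=> a b c p x g h; apply: rhomP => r m; rewrite rhomLE /= lact_linl.
- by move=> a b c g x p q; apply: rhomP => r m; rewrite rhomLE /= lact_linr.
- by move=> a b c g x p q; apply: rhomP => r m; rewrite rhomLE.
- move=> a b c p x g h; apply: rhomP => r m.
  by rewrite rhomLE /= lact_linl rfun_linear.
- by move=> a b c d h g p; apply: rhomP => r m /=; rewrite lactA.
- by move=> a b p; apply: rhomP => r m /=; rewrite lact1.
- by move=> a b c d p g f; apply: rhomP => r m /=; rewrite lactA.
- by move=> a b p; apply: rhomP => r m /=; rewrite lact1.
- by move=> a b c d h p f; apply: rhomP => r m.
Defined.

End RightHom.

Section RightQuadraticDual.
(* The right quadratic dual of a quadratic algebra over C; the latter enters
   through its generators U, its component A2 in degree 2 and the product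
   mu : U (x)_C U -> A2. *)
Variables (C : lincat) (U A2 : bimod C).
Variable mu : forall a b c, U b c -> U a b -> A2 a c.

Definition right_dual (M : bimod C) : bimod C := rhom_bimod M (regular C).
Local Notation W := (right_dual U).

(* The n-th tensor power of W over C, bracketed as W (x) (W (x) ... (W (x) C)):
   note that the first power is W (x)_C C rather than W itself. *)
Fixpoint tpow n : bimod C := if n is m.+1 then tens W (tpow m) else regular C.

Fixpoint tmul m n a b c : tpow m b c -> tpow n a b -> tpow (m + n) a c :=
  match m return tpow m b c -> tpow n a b -> tpow (m + n) a c with
  | 0 => fun x y => lact (x : C b c) y
  | m'.+1 => fun x y =>
      tlift (fun e (w : W e c) (x' : tpow m' b e) => telt w (tmul x' y)) x
  end.

Definition tone s t (w : W s t) : tpow 1 s t :=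
  @telt C W (tpow 0) s t s w (lid C s).

(* The map W (x)_C W -> Hom_{C^op}(U (x)_C U, C), where a morphism out of
   U (x)_C U is given by its values on elementary tensors. *)
Definition dual_pairing s t (z : tens W W s t) a b (u : U b s) (v : U a b) :
    C a t :=
  tlift (fun e (p : W e t) (q : W s e) => p a (lact (q b u) v)) z.

Definition tpow2 s t (z : tens W W s t) : tpow 2 s t :=
  tlift (fun e (p : W e t) (q : W s e) => @telt C W (tpow 1) s t e p (tone q)) z.

(* The image of Hom_{C^op}(A2, C) in W (x)_C W, the latter being seen inside
   Hom_{C^op}(U (x)_C U, C) through dual_pairing, which is an isomorphism when
   each right C-module U(-, s) is finitely generated and projective. *)
Definition quadratic_relation s t (x : tpow 2 s t) : Prop :=
  exists (z : tens W W s t) (theta : right_dual A2 s t),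
    (forall a b (u : U b s) (v : U a b), dual_pairing z u v = theta a (mu u v))
    /\ x = tpow2 z.

(* The ideal is the linear span of these elements. *)
Inductive ideal_gen : forall n s t, tpow n s t -> Prop :=
  | IdealRel s t (x : tpow 2 s t) : quadratic_relation x -> ideal_gen x
  | IdealL m n a b c (x : tpow m b c) (y : tpow n a b) :
      ideal_gen y -> ideal_gen (tmul x y)
  | IdealR m n a b c (x : tpow m b c) (y : tpow n a b) :
      ideal_gen x -> ideal_gen (tmul x y).


Lemma tmul_laws m :
  [/\ forall n a b c (y : tpow n a b), linear (fun x : tpow m b c => tmul x y),
      forall n a b c (x : tpow m b c), linear (fun y : tpow n a b => tmul x y) &
      forall n a b c d (g : C c d) (x : tpow m b c) (y : tpow n a b),
        tmul (lact g x) y = lact g (tmul x y)].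
Proof.
elim: m => [|m [IHl IHr IHa]].
  split=> [n a b c y|n a b c x|n a b c d g x y] /=.
  - exact: lact_linl.
  - exact: lact_linr.
  - by rewrite lactA.
have fl n a b c (y : tpow n a b) e (x : tpow m b e) :
    linear (fun w : W e c => telt w (tmul x y)) by exact: telt_linl.
have fr n a b c (y : tpow n a b) e (w : W e c) :
    linear (fun x : tpow m b e => telt w (tmul x y)).
  by move=> t x x'; rewrite IHl telt_linr.
have fb n a b c (y : tpow n a b) e e' (w : W e' c) (f : C e e')
    (x : tpow m b e) :
    telt (ract w f) (tmul x y) = telt w (tmul (lact f x) y).
  by rewrite telt_bal IHa.
have L n a b c (y : tpow n a b) : linear (fun x : tpow m.+1 b c => tmul x y).
  exact: tlift_linear (@fl n a b c y) (@fr n a b c y) (@fb n a b c y).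
have E n a b c (y : tpow n a b) e (w : W e c) (x : tpow m b e) :
    tmul (telt w x : tpow m.+1 b c) y = telt w (tmul x y).
  exact: tliftE (@fl n a b c y) (@fr n a b c y) (@fb n a b c y) _ _ _.
split=> // [n a b c x t y y'|n a b c d g x y].
  move: x; apply: tens_eq => [||e w x].
  - exact: L.
  - by apply: linear_comb; exact: L.
  - by rewrite !E IHr telt_linr.
move: x; apply: tens_eq => [||e w x].
- exact: linear_compose (@lact_linr C (tpow m.+1) b c d g) (@L n a b d y).
- exact: linear_compose (@L n a b c y) (@lact_linr C (tpow (m.+1 + n)) a c d g).
- transitivity (telt (lact g w) (tmul x y)).
    by rewrite -E; congr (tmul _ y); exact: tens_lactE.
  by rewrite E; apply/esym; exact: tens_lactE.
Qed.

Lemma tmul_linl m n a b c (y : tpow n a b) :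
  linear (fun x : tpow m b c => tmul x y).
Proof. by have [h _ _] := tmul_laws m; apply: h. Qed.
Lemma tmul_linr m n a b c (x : tpow m b c) :
  linear (fun y : tpow n a b => tmul x y).
Proof. by have [_ h _] := tmul_laws m; apply: h. Qed.
Lemma tmul_lact m n a b c d (g : C c d) (x : tpow m b c) (y : tpow n a b) :
  tmul (lact g x) y = lact g (tmul x y).
Proof. by have [_ _ h] := tmul_laws m; apply: h. Qed.
Lemma tmul_telt m n a b c e (w : W e c) (x : tpow m b e) (y : tpow n a b) :
  tmul (telt w x : tpow m.+1 b c) y = telt w (tmul x y).
Proof.
have fl f (z : tpow m b f) : linear (fun v : W f c => telt v (tmul z y)).
  exact: telt_linl.
have fr f (v : W f c) : linear (fun z : tpow m b f => telt v (tmul z y)).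
  by move=> t z z'; rewrite tmul_linl telt_linr.
have fb f f' (v : W f' c) (g : C f f') (z : tpow m b f) :
    telt (ract v g) (tmul z y) = telt v (tmul (lact g z) y).
  by rewrite telt_bal tmul_lact.
exact: tliftE fl fr fb _ _ _.
Qed.

Lemma tmul_tpow0 m a b c (x : tpow m b c) (f : C a b) :
  tmul x (f : tpow 0 a b) =
  ecast i (tpow i a c) (esym (addn0 m)) (ract x f).
Proof.
have c0 (e : 0 = 0) (y : tpow 0 a c) : ecast i (tpow i a c) e y = y.
  by rewrite eq_axiomK.
elim: m c x c0 => [|m IH] c x c0; first by rewrite [RHS]c0.
have {}IH e (y : tpow m b e) : tmul y (f : tpow 0 a b) =
    ecast i (tpow i a e) (esym (addn0 m)) (ract y f).
  by apply: IH => e0 z; rewrite eq_axiomK.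
have castL i j (e : i = j) (e' : i.+1 = j.+1) r (w : W r c) (y : tpow i a r) :
    ecast i (tpow i a c) e' (telt w y : tpow i.+1 a c)
    = telt w (ecast i (tpow i a r) e y) :> tpow j.+1 a c.
  by case: _ / e in e' *; rewrite eq_axiomK.
have castlin i j (e : i = j) : linear (fun y : tpow i a c => ecast i (tpow i a c) e y).
  by case: _ / e.
move: x; apply: tens_eq => [||r w x].
- exact: (@tmul_linl m.+1 0 a b c f).
- exact: linear_compose (@ract_linl C (tpow m.+1) a b c f) (castlin _ _ _).
- rewrite tmul_telt IH -(castL _ _ (esym (addn0 m)) (esym (addn0 m.+1))).
  apply: (congr1 (fun y : tpow m.+1 a c =>
    ecast i (tpow i a c) (esym (addn0 m.+1)) y)).
  by apply/esym; exact: tens_ractE.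
Qed.

Lemma ideal_lact n a b c (g : C b c) (x : tpow n a b) :
  ideal_gen x -> ideal_gen (lact g x).
Proof. exact: (@IdealL 0). Qed.

Lemma ideal_ract n a b c (x : tpow n b c) (f : C a b) :
  ideal_gen x -> ideal_gen (ract x f).
Proof.
move=> /(@IdealR n 0 a b c x f); rewrite tmul_tpow0.
by case: _ / (esym (addn0 n)).
Qed.

(* The cohomological degree n part of the dual: the n-th tensor power of W over
   C modulo the degree n part of the ideal generated by the relations. *)
Definition rqd n : bimod C :=
  @quot_bimod C (tpow n) (@ideal_gen n)
    (fun _ _ _ g x Ix => lspan_gen (ideal_lact g Ix))
    (fun _ _ _ x f Ix => lspan_gen (ideal_ract f Ix)).

Definition rqd_pi n s t (x : tpow n s t) : rqd n s t := lpi (@ideal_gen n s t) x.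

Definition rqd_mul m n a b c (x : rqd m b c) (y : rqd n a b) : rqd (m + n) a c :=
  lq_lift (fun x' => lq_lift (fun y' => rqd_pi (tmul x' y')) y) x.

Definition rqd_deg0 s t (g : C s t) : rqd 0 s t := rqd_pi (g : tpow 0 s t).
Definition rqd_deg1 s t (w : W s t) : rqd 1 s t := rqd_pi (tone w).

Lemma rqd_mulE m n a b c (x : tpow m b c) (y : tpow n a b) :
  rqd_mul (rqd_pi x) (rqd_pi y) = rqd_pi (tmul x y).
Proof.
have pL p u v : linear (@rqd_pi p u v) by exact: lpi_linear.
have E (x' : tpow m b c) (y' : tpow n a b) :
    lq_lift (fun y' => rqd_pi (tmul x' y')) (rqd_pi y') = rqd_pi (tmul x' y').
  apply: lq_liftE => [t u v|u Iu]; first by rewrite tmul_linr pL.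
  exact/lpi_gen/IdealL.
rewrite /rqd_mul [LHS]lq_liftE; first exact: E.
  by move=> t u v; rewrite !E tmul_linl pL.
by move=> u Iu; rewrite E; apply/lpi_gen/IdealR.
Qed.

End RightQuadraticDual.
End LinearCategories.

Section Maps.

Definition fcomp a b c (g : {ffun 'I_b -> 'I_c}) (f : {ffun 'I_a -> 'I_b}) :
  {ffun 'I_a -> 'I_c} := [ffun x => g (f x)].
Definition fid a : {ffun 'I_a -> 'I_a} := [ffun x => x].

Lemma fcompA a b c d (h : {ffun 'I_c -> 'I_d}) (g : {ffun 'I_b -> 'I_c})
  (f : {ffun 'I_a -> 'I_b}) : fcomp h (fcomp g f) = fcomp (fcomp h g) f.
Proof. by apply/ffunP => x; rewrite !ffunE. Qed.
Lemma fcomp1l a b (f : {ffun 'I_a -> 'I_b}) : fcomp (fid b) f = f.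
Proof. by apply/ffunP => x; rewrite !ffunE. Qed.
Lemma fcomp1r a b (f : {ffun 'I_a -> 'I_b}) : fcomp f (fid a) = f.
Proof. by apply/ffunP => x; rewrite !ffunE. Qed.

(* The number of points of the codomain outside the image. *)
Definition corank a b (f : {ffun 'I_a -> 'I_b}) : nat :=
  #|~: [set f x | x : 'I_a]|.

Definition mclass := forall a b : nat, {ffun 'I_a -> 'I_b} -> bool.

Definition anym : mclass := fun a b f => true.
Definition injm : mclass := fun a b f => injectiveb f.
Definition surjm : mclass := fun a b f => [forall y, exists x, f x == y].
Definition bijm : mclass := fun a b f => injm f && surjm f.
Definition injm_deg (n : nat) : mclass := fun a b f => injm f && (b == n + a)%N.
Definition corank_le (n : nat) : mclass := fun a b f => (corank f <= n)%N.

Definition mclosed (P Q R : mclass) : Prop :=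
  forall a b c (g : {ffun 'I_b -> 'I_c}) (f : {ffun 'I_a -> 'I_b}),
    P b c g -> Q a b f -> R a c (fcomp g f).

Lemma corank_comp a b c (g : {ffun 'I_b -> 'I_c}) (f : {ffun 'I_a -> 'I_b}) :
  (corank (fcomp g f) <= corank g + corank f)%N.
Proof.
rewrite /corank.
have sub : ~: [set fcomp g f x | x : 'I_a] \subset
    (~: [set g x | x : 'I_b]) :|: (g @: ~: [set f x | x : 'I_a]).
  apply/subsetP => z; rewrite !inE => zN.
  case: (boolP (z \in [set g x | x : 'I_b])) => //= /imsetP[y _ zE].
  rewrite zE; apply: imset_f; rewrite inE; apply: contra zN => /imsetP[x _ yE].
  by apply/imsetP; exists x => //; rewrite ffunE -yE.
apply: leq_trans (subset_leq_card sub) _; apply: leq_trans (leq_card_setU _ _) _.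
by rewrite leq_add2l leq_imset_card.
Qed.

Lemma surjmP a b (f : {ffun 'I_a -> 'I_b}) :
  reflect (forall y, exists x, f x = y) (surjm f).
Proof.
apply: (iffP forallP) => h y.
  by have /existsP[x /eqP <-] := h y; exists x.
by apply/existsP; have [x <-] := h y; exists x.
Qed.

Lemma surjm_corank a b (f : {ffun 'I_a -> 'I_b}) : surjm f = (corank f == 0%N).
Proof.
apply/surjmP/idP => [h|].
  rewrite cards_eq0; apply/eqP/setP => y; rewrite !inE; apply/negbTE.
  by rewrite negbK; have [x <-] := h y; exact: imset_f.
rewrite cards_eq0 => /eqP/setP h y; have := h y; rewrite !inE.
by move/negbFE/imsetP => [x _ ->]; exists x.
Qed.

Lemma corank_le_closed m n : mclosed (corank_le m) (corank_le n) (corank_le (m + n)).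
Proof.
by move=> a b c g f gm fn; apply: leq_trans (corank_comp g f) (leq_add gm fn).
Qed.
Lemma surjm_le a b (f : {ffun 'I_a -> 'I_b}) : surjm f = corank_le 0 f.
Proof. by rewrite surjm_corank /corank_le leqn0. Qed.

Lemma surjm_id a : surjm (fid a).
Proof. by apply/surjmP => y; exists y; rewrite ffunE. Qed.
Lemma surjm_closed : mclosed surjm surjm surjm.
Proof. by move=> a b c g f; rewrite !surjm_le; exact: corank_le_closed. Qed.
Lemma surj_corank_le n : mclosed surjm (corank_le n) (corank_le n).
Proof. by move=> a b c g f; rewrite surjm_le; exact: (@corank_le_closed 0). Qed.
Lemma corank_le_surj n : mclosed (corank_le n) surjm (corank_le n).
Proof.
by move=> a b c g f ? fs; rewrite -[n]addn0; apply: corank_le_closed; rewrite -?surjm_le.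
Qed.

Lemma injm_id a : injm (fid a).
Proof. by apply/injectiveP => x y; rewrite !ffunE. Qed.
Lemma injm_closed : mclosed injm injm injm.
Proof.
move=> a b c g f /injectiveP gi /injectiveP fi; apply/injectiveP => x y.
by rewrite !ffunE => /gi/fi.
Qed.
Lemma bijm_id a : bijm (fid a).
Proof. by rewrite /bijm injm_id surjm_id. Qed.
Lemma bijm_closed : mclosed bijm bijm bijm.
Proof.
move=> a b c g f /andP[gi gs] /andP[fi fs].
by rewrite /bijm injm_closed // surjm_closed.
Qed.
Lemma bij_surj_closed : mclosed bijm surjm surjm.
Proof. by move=> a b c g f /andP[_ gs]; apply: surjm_closed. Qed.
Lemma surj_bij_closed : mclosed surjm bijm surjm.
Proof. by move=> a b c g f gs /andP[_]; apply: surjm_closed. Qed.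

Lemma bijm_eq a b (f : {ffun 'I_a -> 'I_b}) : bijm f -> a = b.
Proof.
move=> /andP[/injectiveP fi /surjmP fs]; have [g fg] := choice fs.
apply/eqP; rewrite eqn_leq; have := leq_card f fi; rewrite !card_ord => -> /=.
by have := leq_card g (can_inj fg); rewrite !card_ord.
Qed.

Lemma bijm_inv a b (f : {ffun 'I_a -> 'I_b}) : bijm f ->
  exists2 g : {ffun 'I_b -> 'I_a},
    bijm g & fcomp f g = fid b /\ fcomp g f = fid a.
Proof.
move=> /andP[/injectiveP fi /surjmP fs]; have [g fg] := choice fs.
have gf : cancel f g by move=> x; apply: fi; rewrite fg.
exists (finfun g); last first.
  by split; apply/ffunP => x; rewrite !ffunE ?fg ?gf.
apply/andP; split; last by apply/surjmP => x; exists (f x); rewrite ffunE gf.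
by apply/injectiveP => x y; rewrite !ffunE => /(can_inj fg).
Qed.

Lemma injm_deg_closed m n :
  mclosed (injm_deg m) (injm_deg n) (injm_deg (m + n)).
Proof.
move=> a b c g f /andP[gi /eqP cE] /andP[fi /eqP bE].
by rewrite /injm_deg injm_closed //= cE bE addnA.
Qed.
Lemma bij_injm_deg n : mclosed bijm (injm_deg n) (injm_deg n).
Proof.
move=> a b c g f bg /andP[fi /eqP bE]; have /andP[gi _] := bg.
by rewrite /injm_deg injm_closed //= -(bijm_eq bg) bE.
Qed.
Lemma injm_deg_bij n : mclosed (injm_deg n) bijm (injm_deg n).
Proof.
move=> a b c g f /andP[gi /eqP cE] bf; have /andP[fi _] := bf.
by rewrite /injm_deg injm_closed //= (bijm_eq bf) cE.
Qed.

End Maps.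

Section MapModules.
Variable k : fieldType.

(* The free module on the maps in the class P. *)
Definition kmap (P : mclass) (a b : nat) : lmodType k :=
  {malg k[{f : {ffun 'I_a -> 'I_b} | P a b f}]}.

(* The basis element [f] if f belongs to P, and 0 otherwise. *)
Definition kbasis (P : mclass) a b (f : {ffun 'I_a -> 'I_b}) : kmap P a b :=
  if insub f is Some f' then << f' >> else 0.

Lemma kbasis_val (P : mclass) a b (f : {f : {ffun 'I_a -> 'I_b} | P a b f}) :
  kbasis P (val f) = << f >>.
Proof. by rewrite /kbasis valK. Qed.

Lemma kbasis_in (P : mclass) a b (f : {ffun 'I_a -> 'I_b}) (Pf : P a b f) :
  kbasis P f = << exist (fun f => P a b f) f Pf >>.
Proof. by rewrite -kbasis_val. Qed.

Lemma kbasis_out (P : mclass) a b (f : {ffun 'I_a -> 'I_b}) :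
  ~~ P a b f -> kbasis P f = 0.
Proof. by move=> nPf; rewrite /kbasis insubN. Qed.

Lemma kmap_ind (P : mclass) a b (Z : kmap P a b -> Prop) :
  Z 0 -> (forall x u v, Z u -> Z v -> Z (x *: u + v)) ->
  (forall f, P a b f -> Z (kbasis P f)) -> forall u, Z u.
Proof.
move=> Z0 ZL Zb; elim/free_ind => // [f]; rewrite -kbasis_val; exact/Zb/valP.
Qed.

Lemma kmap_eq (P : mclass) a b (V : lmodType k) (p q : kmap P a b -> V) :
  linear p -> linear q ->
  (forall f, P a b f -> p (kbasis P f) = q (kbasis P f)) -> p =1 q.
Proof.
move=> pL qL pq; elim/kmap_ind => [|x u v pu pv|//].
  by rewrite (linf0 pL) (linf0 qL).
by rewrite pL qL pu pv.
Qed.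

(* The linear map sending [f] to [f] if f belongs to Q, and to 0 otherwise. *)
Definition kchange (P Q : mclass) a b (u : kmap P a b) : kmap Q a b :=
  fext (fun f => kbasis Q (val f)) u.

Lemma kchange_linear (P Q : mclass) a b : linear (@kchange P Q a b).
Proof. exact: fext_linear. Qed.
Lemma kchangeE (P Q : mclass) a b (f : {ffun 'I_a -> 'I_b}) : P a b f ->
  kchange Q (kbasis P f) = kbasis Q f.
Proof. by move=> Pf; rewrite kbasis_in [LHS]fextE. Qed.

(* The bilinear map sending ([g], [f]) to [g o f] if the latter belongs to R,
   and to 0 otherwise. *)
Definition kcomp (P Q R : mclass) a b c (v : kmap P b c) (u : kmap Q a b) :
    kmap R a c :=
  fext (fun g => fext (fun f => kbasis R (fcomp (val g) (val f))) u) v.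

Section Kcomp.
Variables (P Q R : mclass) (a b c : nat).

Lemma kcomp_linl (u : kmap Q a b) :
  linear (fun v : kmap P b c => kcomp R v u).
Proof. exact: fext_linear. Qed.

Lemma kcomp_linr (v : kmap P b c) :
  linear (fun u : kmap Q a b => kcomp R v u).
Proof.
move: v; elim/kmap_ind => [x u u'|x v w IHv IHw y u u'|f Pf x u u'].
- by rewrite !(linf0 (kcomp_linl _)) scaler0 addr0.
- have E (z : kmap Q a b) : kcomp R (x *: v + w) z = x *: kcomp R v z + kcomp R w z.
    exact: kcomp_linl.
  by rewrite !E; exact: (linear_comb x IHv IHw y u u').
- have E (z : kmap Q a b) : kcomp R (kbasis P f) z =
      fext (fun g => kbasis R (fcomp f (val g))) z.
    by rewrite kbasis_in /kcomp [LHS]fextE.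
  by rewrite !E; exact: fext_linear.
Qed.

Lemma kcompE (g : {ffun 'I_b -> 'I_c}) (f : {ffun 'I_a -> 'I_b}) :
  P g -> Q f -> kcomp R (kbasis P g) (kbasis Q f) = kbasis R (fcomp g f).
Proof.
move=> Pg Qf; rewrite (kbasis_in Pg) (kbasis_in Qf).
by apply: (etrans (fextE _ _)); exact: fextE.
Qed.
End Kcomp.

Lemma kcompA (P Q R PQ QR S : mclass) : mclosed P Q PQ -> mclosed Q R QR ->
  forall a b c d (w : kmap P c d) (v : kmap Q b c) (u : kmap R a b),
  kcomp S w (kcomp QR v u) = kcomp S (kcomp PQ w v) u.
Proof.
move=> PQ_ QR_ a b c d w v u; move: w; apply: kmap_eq => [||h Ph].
- exact: kcomp_linl.
- exact: linear_compose (kcomp_linl _ _) (kcomp_linl _ _).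
move: v; apply: kmap_eq => [||g Qg].
- exact: linear_compose (kcomp_linl _ _) (kcomp_linr _ _).
- exact: linear_compose (kcomp_linr _ _) (kcomp_linl _ _).
move: u; apply: kmap_eq => [||f Rf].
- exact: linear_compose (kcomp_linr _ _) (kcomp_linr _ _).
- exact: kcomp_linr.
by rewrite !kcompE ?fcompA //; [exact: PQ_|exact: QR_].
Qed.

Lemma kcomp1l (P Q R : mclass) a b (u : kmap Q a b) : P b b (fid b) ->
  kcomp R (kbasis P (fid b)) u = kchange R u.
Proof.
move=> Pid; move: u; apply: kmap_eq => [||f Qf].
- exact: kcomp_linr.
- exact: kchange_linear.
by rewrite kcompE // kchangeE // fcomp1l.
Qed.

Lemma kcomp1r (P Q R : mclass) a b (v : kmap P a b) : Q a a (fid a) ->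
  kcomp R v (kbasis Q (fid a)) = kchange R v.
Proof.
move=> Qid; move: v; apply: kmap_eq => [||f Pf].
- exact: kcomp_linl.
- exact: kchange_linear.
by rewrite kcompE // kchangeE // fcomp1r.
Qed.

Lemma kchange_id (P : mclass) a b (u : kmap P a b) : kchange P u = u.
Proof.
by move: u; apply: kmap_eq => [||f Pf]; [exact: kchange_linear| |exact: kchangeE].
Qed.

Section Category.
Variable P : mclass.
Hypotheses (Pid : forall a, P (fid a)) (PP : mclosed P P P).

(* The k-linearization of the category of maps in P. *)
Definition map_lincat : lincat k.
Proof.
refine (@LinCat k (kmap P) (@kcomp P P P) (fun a => kbasis P (fid a)) _ _ _ _ _).
- by move=> a b c f; exact: kcomp_linl.
- by move=> a b c g; exact: kcomp_linr.
- by move=> a b c d h g f; exact: kcompA.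
- by move=> a b f; rewrite kcomp1l // kchange_id.
- by move=> a b f; rewrite kcomp1r // kchange_id.
Defined.

Variable Q : mclass.
Hypotheses (PQ : mclosed P Q Q) (QP : mclosed Q P Q).

Definition map_bimod : bimod map_lincat.
Proof.
refine (@Bimod k map_lincat (kmap Q) (@kcomp P Q Q) (@kcomp Q P Q)
  _ _ _ _ _ _ _ _ _).
- by move=> a b c f; exact: kcomp_linl.
- by move=> a b c g; exact: kcomp_linr.
- by move=> a b c f; exact: kcomp_linl.
- by move=> a b c g; exact: kcomp_linr.
- by move=> a b c d h g m; exact: kcompA.
- by move=> a b m; rewrite [LHS]kcomp1l // kchange_id.
- by move=> a b c d m g f; apply/esym; exact: kcompA.
- by move=> a b m; rewrite [LHS]kcomp1r // kchange_id.
- by move=> a b c d h m f; apply/esym; exact: kcompA.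
Defined.
End Category.

Definition kFB : lincat k := map_lincat bijm_id bijm_closed.
Definition kFI : lincat k := map_lincat injm_id injm_closed.
Definition kFS : lincat k := map_lincat surjm_id surjm_closed.
Definition kFA : lincat k :=
  @map_lincat anym (fun _ => isT) (fun _ _ _ _ _ _ _ => isT).

Definition kFS_FB : bimod kFB :=
  map_bimod bijm_id bijm_closed bij_surj_closed surj_bij_closed.

Definition kFI_deg n : bimod kFB :=
  map_bimod bijm_id bijm_closed (@bij_injm_deg n) (@injm_deg_bij n).

Definition kFI_mul m n a b c :
    kFI_deg m b c -> kFI_deg n a b -> kFI_deg (m + n) a c :=
  @kcomp (injm_deg m) (injm_deg n) (injm_deg (m + n)) a b c.

(* The right quadratic dual of kFI over kFB, in cohomological degree n. *)
Definition kFI_dual n : bimod kFB := rqd (@kFI_mul 1 1) n.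

(* The filtration G_n of kFA. *)
Definition kFA_fil n : bimod kFS :=
  map_bimod surjm_id surjm_closed (@surj_corank_le n) (@corank_le_surj n).

(* Generators of G_(n-1) inside G_n. *)
Definition fil_lower n a b (u : kFA_fil n a b) : Prop :=
  exists2 f : {ffun 'I_a -> 'I_b},
    (corank f < n)%N & u = kbasis (corank_le n) f.

Lemma fil_lower_mul m n a b c (v : kmap (corank_le m) b c)
    (u : kmap (corank_le n) a b) :
  @fil_lower m b c v \/ @fil_lower n a b u ->
  lspan (@fil_lower (m + n) a c) (kcomp (corank_le (m + n)) v u).
Proof.
case=> [[g gm ->]|[f fn ->]].
  move: u; apply: kmap_ind => [|x u u' IH IH'|f fn].
  - by rewrite (linf0 (kcomp_linr _ _)); exact: lspan0.
  - by rewrite kcomp_linr; apply: lspanD IH'; exact: lspanZ.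
  rewrite kcompE //; last exact: ltnW.
  apply: lspan_gen; exists (fcomp g f) => //.
  by apply: leq_ltn_trans (corank_comp g f) _; rewrite -addSn; exact: leq_add.
move: v; apply: kmap_ind => [|x v v' IH IH'|g gm].
- by rewrite (linf0 (kcomp_linl _ _)); exact: lspan0.
- by rewrite kcomp_linl; apply: lspanD IH'; exact: lspanZ.
rewrite kcompE //; last exact: ltnW.
apply: lspan_gen; exists (fcomp g f) => //.
by apply: leq_ltn_trans (corank_comp g f) _; rewrite -addnS; exact: leq_add.
Qed.

Lemma fil_lower_lact n a b c (g : kFS b c) (u : kFA_fil n a b) :
  fil_lower u -> lspan (@fil_lower n a c) (lact g u).
Proof.
move=> [f fn ->]; move: g; apply: kmap_ind => [|x v v' IH IH'|g gs].
- by rewrite (linf0 (lact_linl _)); exact: lspan0.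
- by rewrite lact_linl; apply: lspanD IH'; exact: lspanZ.
have -> : lact (kbasis surjm g : kFS b c) (kbasis (corank_le n) f : kFA_fil n a b)
    = kbasis (corank_le n) (fcomp g f) := kcompE _ gs (ltnW fn).
apply: lspan_gen; exists (fcomp g f) => //; apply: leq_ltn_trans fn.
by rewrite (leq_trans (corank_comp g f)) //; move: gs; rewrite surjm_corank => /eqP ->.
Qed.

Lemma fil_lower_ract n a b c (u : kFA_fil n b c) (g : kFS a b) :
  fil_lower u -> lspan (@fil_lower n a c) (ract u g).
Proof.
move=> [f fn ->]; move: g; apply: kmap_ind => [|x v v' IH IH'|g gs].
- by rewrite (linf0 (ract_linr _)); exact: lspan0.
- by rewrite ract_linr; apply: lspanD IH'; exact: lspanZ.
have -> : ract (kbasis (corank_le n) f : kFA_fil n b c) (kbasis surjm g : kFS a b)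
    = kbasis (corank_le n) (fcomp f g) := kcompE _ (ltnW fn) gs.
apply: lspan_gen; exists (fcomp f g) => //; apply: leq_ltn_trans fn.
rewrite (leq_trans (corank_comp f g)) //; move: gs.
by rewrite surjm_corank => /eqP ->; rewrite addn0.
Qed.

(* The degree n part G_n / G_(n-1) of the associated graded of kFA. *)
Definition gr_kFA n : bimod kFS :=
  quot_bimod (@fil_lower_lact n) (@fil_lower_ract n).

Definition gr_pi n a b (u : kFA_fil n a b) : gr_kFA n a b :=
  lpi (@fil_lower n a b) u.

Definition gr_mul m n a b c (v : gr_kFA m b c) (u : gr_kFA n a b) :
    gr_kFA (m + n) a c :=
  lq_lift (fun v' => lq_lift (fun u' =>
    gr_pi (kcomp (corank_le (m + n)) v' u' : kFA_fil (m + n) a c)) u) v.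

Lemma gr_mulE m n a b c (v : kFA_fil m b c) (u : kFA_fil n a b) :
  gr_mul (gr_pi v) (gr_pi u) =
  gr_pi (kcomp (corank_le (m + n)) v u : kFA_fil (m + n) a c).
Proof.
have pL p r s : linear (@gr_pi p r s) by exact: lpi_linear.
have p0 p r s (z : kFA_fil p r s) : lspan (@fil_lower p r s) z -> gr_pi z = 0.
  by move=> ?; apply: lpi_eq; rewrite subr0.
have ML (v' : kFA_fil m b c) : linear (fun u' : kFA_fil n a b =>
    gr_pi (kcomp (corank_le (m + n)) v' u' : kFA_fil (m + n) a c)).
  exact: linear_compose (kcomp_linr _ _) (pL _ _ _).
have MR : linear (fun v' : kFA_fil m b c =>
    gr_pi (kcomp (corank_le (m + n)) v' u : kFA_fil (m + n) a c)).
  exact: linear_compose (kcomp_linl _ _) (pL _ _ _).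
pose F (v' : kFA_fil m b c) : gr_kFA (m + n) a c := lq_lift (fun u' =>
  gr_pi (kcomp (corank_le (m + n)) v' u' : kFA_fil (m + n) a c)) (gr_pi u).
have FE v' : F v' = gr_pi (kcomp (corank_le (m + n)) v' u : kFA_fil (m + n) a c).
  by apply: (lq_liftE (ML v')) => z lz; apply/p0/fil_lower_mul; right.
have F_fun : F = fun v' =>
    gr_pi (kcomp (corank_le (m + n)) v' u : kFA_fil (m + n) a c) by apply/funext.
have FL : linear F by rewrite F_fun.
rewrite -FE; apply: (lq_liftE FL) => z lz.
by rewrite FE; apply/p0/fil_lower_mul; left.
Qed.

(* (gr^G kFA)^perp over kFS, in cohomological degree n. *)
Definition gr_kFA_dual n : bimod kFS := rqd (@gr_mul 1 1) n.

Definition kFB_kFS a b : kFB a b -> kFS a b := @kchange bijm surjm a b.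
Definition kFB_kFI a b : kFB a b -> kFI a b := @kchange bijm injm a b.
Definition kFS_kFA a b : kFS a b -> kFA a b := @kchange surjm anym a b.
Definition kFI_kFA a b : kFI a b -> kFA a b := @kchange injm anym a b.
Definition kFI_deg_kFI n a b : kFI_deg n a b -> kFI a b :=
  @kchange (injm_deg n) injm a b.

(* The right augmentation. *)
Definition augmentation a b : kFA a b -> kFS a b := @kchange anym surjm a b.

Section RightFIModule.

(* A right kFI-module structure extending the right kFB-module structure of a
   kFB-bimodule and commuting with the left one. *)
Record right_FI_module (M : bimod kFB) := RightFIModule {
  fi_act :> forall a b t, M b t -> kFI a b -> M a t;
  fi_act_linl : forall a b t (i : kFI a b),
    linear (fun m : M b t => fi_act m i);
  fi_act_linr : forall a b t (m : M b t), linear (fun i : kFI a b => fi_act m i);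
  fi_actA : forall a b c t (m : M c t) (i : kFI b c) (j : kFI a b),
    fi_act (fi_act m i) j = fi_act m (lcomp i j);
  fi_act_kFB : forall a b t (m : M b t) (s : kFB a b),
    fi_act m (kFB_kFI s) = ract m s;
  fi_act_lact : forall a b t t' (g : kFB t t') (m : M b t) (i : kFI a b),
    fi_act (lact g m) i = lact g (fi_act m i)
}.

Definition kFS_fi_act a b t (p : kFS b t) (i : kFI a b) : kFS a t :=
  augmentation (lcomp (kFS_kFA p) (kFI_kFA i)).

Lemma kFS_fi_actE a b t (p : kFS b t) (i : kFI a b) :
  kFS_fi_act p i = kcomp surjm p i.
Proof.
have L P Q r s : linear (@kchange P Q r s) by exact: kchange_linear.
rewrite /kFS_fi_act /augmentation /kFS_kFA /kFI_kFA.
move: p; apply: kmap_eq => [||p Pp].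
- exact: linear_compose (linear_compose (L _ _ _ _) (kcomp_linl _ _)) (L _ _ _ _).
- exact: kcomp_linl.
move: i; apply: kmap_eq => [||i Pi].
- exact: linear_compose (linear_compose (L _ _ _ _) (kcomp_linr _ _)) (L _ _ _ _).
- exact: kcomp_linr.
by rewrite !kchangeE // [lcomp _ _]kcompE // kchangeE // kcompE.
Qed.

Lemma kFS_fi_act_linl a b t (i : kFI a b) :
  linear (fun p : kFS b t => kFS_fi_act p i).
Proof. by move=> x p q; rewrite !kFS_fi_actE; exact: kcomp_linl. Qed.
Lemma kFS_fi_act_linr a b t (p : kFS b t) :
  linear (fun i : kFI a b => kFS_fi_act p i).
Proof. by move=> x i j; rewrite !kFS_fi_actE; exact: kcomp_linr. Qed.

Lemma surjm_fcompl a b c (g : {ffun 'I_b -> 'I_c}) (f : {ffun 'I_a -> 'I_b}) :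
  surjm (fcomp g f) -> surjm g.
Proof.
move=> /surjmP h; apply/surjmP => y; have [x <-] := h y.
by exists (f x); rewrite ffunE.
Qed.

Lemma kFS_fi_actA a b c t (p : kFS c t) (i : kFI b c) (j : kFI a b) :
  kFS_fi_act (kFS_fi_act p i) j = kFS_fi_act p (lcomp i j).
Proof.
rewrite !kFS_fi_actE.
move: p; apply: kmap_eq => [||p Pp].
- exact: linear_compose (kcomp_linl _ _) (kcomp_linl _ _).
- exact: kcomp_linl.
move: i; apply: kmap_eq => [||i Pi].
- exact: linear_compose (kcomp_linr _ _) (kcomp_linl _ _).
- exact: linear_compose (@lcomp_linl _ kFI _ _ _ j) (kcomp_linr _ _).
move: j; apply: kmap_eq => [||j Pj].
- exact: kcomp_linr.
- exact: linear_compose (@lcomp_linr _ kFI _ _ _ _) (kcomp_linr _ _).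
have -> : lcomp (kbasis injm i : kFI b c) (kbasis injm j : kFI a b)
  = kbasis injm (fcomp i j) := kcompE _ Pi Pj.
rewrite (kcompE surjm Pp Pi) (kcompE surjm Pp (injm_closed Pi Pj)).
have [spi|nspi] := boolP (surjm (fcomp p i)); first by rewrite kcompE // fcompA.
rewrite (kbasis_out nspi) (linf0 (kcomp_linl _ _)) kbasis_out // fcompA.
by apply: contra nspi; exact: surjm_fcompl.
Qed.

Lemma kFS_fi_act_kFB a b t (p : kFS b t) (s : kFB a b) :
  kFS_fi_act p (kFB_kFI s) = ract (p : kFS_FB b t) s.
Proof.
rewrite kFS_fi_actE /kFB_kFI; move: s; apply: kmap_eq => [||s Ps].
- exact: linear_compose (@kchange_linear bijm injm a b)
    (@kcomp_linr surjm injm surjm a b t p).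
- exact: (@ract_linr _ kFB kFS_FB a b t p).
move: p; apply: kmap_eq => [||p Pp]; [exact: kcomp_linl|exact: kcomp_linl|].
have /andP[Is _] := Ps; rewrite (kchangeE injm Ps) (kcompE surjm Pp Is).
exact/esym/(kcompE surjm Pp Ps).
Qed.

Lemma kFS_fi_act_lact a b t t' (g : kFB t t') (p : kFS b t) (i : kFI a b) :
  kFS_fi_act (lact g (p : kFS_FB b t) : kFS_FB b t') i =
  lact g (kFS_fi_act p i : kFS_FB a t).
Proof.
rewrite !kFS_fi_actE; move: g; apply: kmap_eq => [||g Pg].
- exact: linear_compose (@lact_linl _ _ kFS_FB _ _ _ p) (kcomp_linl surjm i).
- exact: (@lact_linl _ _ kFS_FB _ _ _ (kcomp surjm p i)).
pose G : kFB t t' := kbasis bijm g; rewrite -/G.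
move: p; apply: kmap_eq => [||p Pp].
- exact: linear_compose (@lact_linr _ _ kFS_FB _ _ _ G) (kcomp_linl surjm i).
- exact: linear_compose (kcomp_linl surjm i) (@lact_linr _ _ kFS_FB _ _ _ G).
pose p' : kFS_FB b t := kbasis surjm p; rewrite -/p'.
move: i; apply: kmap_eq => [||i Pi].
- exact: kcomp_linr.
- exact: linear_compose (kcomp_linr surjm p') (@lact_linr _ _ kFS_FB _ _ _ G).
have gp : surjm (fcomp g p) by apply: bij_surj_closed.
have -> : lact G p' = kbasis surjm (fcomp g p) := kcompE _ Pg Pp.
rewrite (kcompE surjm gp Pi) (kcompE surjm Pp Pi) -fcompA.
have [spi|nspi] := boolP (surjm (fcomp p i)).
  exact/esym/(kcompE surjm Pg spi).
rewrite (kbasis_out nspi) (linf0 (@lact_linr _ _ kFS_FB _ _ _ G)) kbasis_out //.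
apply: contra nspi; have [h /andP[_ hs] [_ hg]] := bijm_inv Pg => sgpi.
by rewrite -[fcomp p i]fcomp1l -hg -fcompA; apply: surjm_closed.
Qed.

Definition kFS_right_FI : right_FI_module kFS_FB :=
  @RightFIModule kFS_FB kFS_fi_act kFS_fi_act_linl kFS_fi_act_linr
    kFS_fi_actA kFS_fi_act_kFB kFS_fi_act_lact.

End RightFIModule.

Section Koszul.

(* The order-preserving injection i_x missing x. *)
Definition coface a (x : 'I_a.+1) : {ffun 'I_a -> 'I_a.+1} :=
  [ffun j => lift x j].

(* [i_x]^*: it sends [i_x o s] to [s] and [i_y o s] to 0 for y <> x. *)
Definition coface_dual_fun a (x : 'I_a.+1) r (u : kFI_deg 1 r a.+1) : kFB r a :=
  fext (fun f => \sum_(s | fcomp (coface x) s == val f) kbasis bijm s) u.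

Lemma coface_dual_linear a (x : 'I_a.+1) r :
  linear (@coface_dual_fun a x r).
Proof. exact: fext_linear. Qed.

Lemma coface_dualE a (x : 'I_a.+1) r (f : {ffun 'I_r -> 'I_a.+1}) :
  injm_deg 1 f -> coface_dual_fun x (kbasis (injm_deg 1) f) =
  \sum_(s | fcomp (coface x) s == f) kbasis bijm s.
Proof. by move=> Pf; rewrite (kbasis_in Pf) [LHS]fextE. Qed.

Lemma coface_dual_ract a (x : 'I_a.+1) r r' (u : kFI_deg 1 r' a.+1)
    (g : kFB r r') :
  coface_dual_fun x (ract u g) =
  ract (coface_dual_fun x u : regular kFB r' a) g.
Proof.
move: u; apply: kmap_eq => [||f Pf].
- exact: linear_compose (@ract_linl _ _ (kFI_deg 1) _ _ _ g)
    (@coface_dual_linear a x r).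
- exact: linear_compose (@coface_dual_linear a x r')
    (@ract_linl _ _ (regular kFB) _ _ _ g).
pose F : kFI_deg 1 r' a.+1 := kbasis (injm_deg 1) f; rewrite -/F.
move: g; apply: kmap_eq => [||g Pg].
- exact: linear_compose (@ract_linr _ _ (kFI_deg 1) _ _ _ F)
    (@coface_dual_linear a x r).
- exact: (@ract_linr _ _ (regular kFB) _ _ _ (coface_dual_fun x F)).
pose G : kFB r r' := kbasis bijm g; rewrite -/G.
have -> : ract F G = kbasis (injm_deg 1) (fcomp f g) := kcompE _ Pf Pg.
have Pfg : injm_deg 1 (fcomp f g) by exact: injm_deg_bij.
rewrite (coface_dualE x Pfg) (coface_dualE x Pf).
rewrite (linf_sum (@ract_linl _ _ (regular kFB) r r' a G)).
have [h Ph [gh hg]] := bijm_inv Pg.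
rewrite (reindex (fun s => fcomp s g)) /=; last first.
  exists (fun s => fcomp s h) => s _;
  by rewrite -fcompA ?gh ?hg fcomp1r.
apply: eq_big => [s|s _].
  apply/eqP/eqP => [|<-]; last by rewrite fcompA.
  move=> /(congr1 (fun s => fcomp s h)).
  by rewrite fcompA -!fcompA gh !fcomp1r.
have [Ps|nPs] := boolP (bijm s); first exact/esym/(kcompE bijm Ps Pg).
rewrite (kbasis_out nPs).
apply: (etrans _ (esym (linf0 (@ract_linl _ _ (regular kFB) r r' a G)))).
apply: kbasis_out; apply: contra nPs => Psg.
by rewrite -[s]fcomp1r -gh fcompA; apply: bijm_closed.
Qed.

Definition coface_dual a (x : 'I_a.+1) : right_dual (kFI_deg 1) a.+1 a :=
  @RHom _ kFB (kFI_deg 1) (regular kFB) a.+1 a (@coface_dual_fun a x)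
    (@coface_dual_linear a x) (@coface_dual_ract a x).

(* The Koszul complex of M: y ranges over kFI_dual, so that the product below
   lies in degree 1 + n; on elements m (x) y with m in M(0) the sum is empty. *)
Definition is_koszul_differential (M : bimod kFB) (act : right_FI_module M)
    (d : forall n s t,
       {linear tens M (kFI_dual n) s t -> tens M (kFI_dual n.+1) s t}) :=
  (forall n s t (m : M 0 t) (y : kFI_dual n s 0), d n s t (telt m y) = 0) /\
  (forall n s t a (m : M a.+1 t) (y : kFI_dual n s a.+1),
    d n s t (telt m y) =
    \sum_(x < a.+1)
      telt (act a a.+1 t m (kbasis injm (coface x)))
        (rqd_mul (rqd_deg1 (@kFI_mul 1 1) (coface_dual x)) y
          : kFI_dual n.+1 s a)).

End Koszul.

Section DualDifferential.

(* The inclusion of kFI^[1] into the generators gr_1 kFA. *)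
Definition kFI_gr a b (i : kFI_deg 1 a b) : gr_kFA 1 a b :=
  gr_pi (kchange (corank_le 1) i : kFA_fil 1 a b).

(* phi in Hom_{kFS^op}(gr_1 kFA, kFS) corresponds to g under the isomorphism
   with Hom_{kFB^op}(kFI^[1], kFS), i.e. phi restricts to g. *)
Definition restricts_to s t (phi : right_dual (gr_kFA 1) s t)
    (g : forall a, kFI_deg 1 a s -> kFS a t) :=
  forall a (i : kFI_deg 1 a s), phi a (kFI_gr i) = g a i.

Local Notation D := gr_kFA_dual.
Local Notation gen0 := (@rqd_deg0 _ _ _ _ (@gr_mul 1 1) _ _).
Local Notation gen1 := (@rqd_deg1 _ _ _ _ (@gr_mul 1 1) _ _).

Definition dual_mul m n a b c (x : D m b c) (y : D n a b) : D (m + n) a c :=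
  rqd_mul x y.

(* The degree 1 derivation that vanishes on Hom_{kFB^op}(kFI^[1], kFB) and sends
   c in kFS to the element i |-> c . i of Hom_{kFB^op}(kFI^[1], kFS). *)
Definition is_dual_differential
    (d : forall n s t, {linear D n s t -> D n.+1 s t}) :=
  [/\ forall m n a b c (x : D m b c) (y : D n a b),
        d (m + n)%N a c (dual_mul x y) =
        (dual_mul (d m b c x) y : D (m + n).+1 a c) +
        (-1) ^+ m *: ecast i (D i a c) (addnS m n) (dual_mul x (d n a b y)),
      forall s t (xi : right_dual (kFI_deg 1) s t),
        exists2 phi, restricts_to phi (fun a i => kFB_kFS (xi a i)) &
          d 1 s t (gen1 phi) = 0 &
      forall s t (c : kFS s t),
        exists2 phi,
          restricts_to phi (fun a i => kFS_right_FI a s t c (kFI_deg_kFI i)) &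
          d 0 s t (gen0 c) = gen1 phi].

(* The morphism from kFI^perp to (gr^G kFA)^perp over kFB -> kFS that is induced
   by Hom_{kFB^op}(kFI^[1], kFB) -> Hom_{kFB^op}(kFI^[1], kFS). *)
Definition is_dual_inclusion
    (J : forall n s t, {linear kFI_dual n s t -> D n s t}) :=
  [/\ forall m n a b c (x : kFI_dual m b c) (y : kFI_dual n a b),
        J (m + n)%N a c (rqd_mul x y) = dual_mul (J m b c x) (J n a b y),
      forall s t (g : kFB s t),
        J 0 s t (rqd_deg0 (@kFI_mul 1 1) g) = gen0 (kFB_kFS g) &
      forall s t (xi : right_dual (kFI_deg 1) s t),
        exists2 phi, restricts_to phi (fun a i => kFB_kFS (xi a i)) &
          J 1 s t (rqd_deg1 (@kFI_mul 1 1) xi) = gen1 phi].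

End DualDifferential.

End MapModules.

(* Main.v *)
Require Import Defs.
From HB Require Import structures.
From mathcomp Require Import all_boot all_order all_algebra.
From mathcomp Require Import boolp zify.

(* Let i_x : s-1 -> s be the order-preserving injection missing x. The classes
   [i_x] form a basis of gr_1 kFA(-, s) as a right kFS-module, just as they form
   a basis of kFI^[1](-, s) over kFB. So every w in U^* equals sum_x w(i_x) xi_x
   for the dual basis xi_x, and the quadratic relations on either side say that
   xi_y xi_x = - xi_y' xi_x' whenever i_x i_y = i_x' i_y' with x <> x'. Hence
   xi_x |-> xi_x extends to J : kFI^perp -> (gr kFA)^perp, and the inverse of
   c (x) y |-> c J(y) comes from letting U^* act on kFS (x) kFI^perp by
   w . (c (x) y) = sum_x w(c i_x) (x) xi_x y.

   The Koszul differential d, transported to the dual, satisfies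
   d(g v) = d(g) v + g d(v) for g in kFS. That d is a derivation then reduces to
   d(xi_z v) = - xi_z d(v), and, like d^2 = 0, this holds because a sum of terms
   f(x, y) xi_y xi_x vanishes when f(x, y) depends only on i_x i_y. *)

Set Implicit Arguments.
Unset Strict Implicit.
Unset Printing Implicit Defensive.

Import GRing.Theory.
Local Open Scope ring_scope.

(** * Maps out of a right quadratic dual *)

(** Maps out of a dual are built as orbit maps into modules, not as algebra morphisms, because
    [kFS ⊗ kFI^perp] carries no product until the isomorphism is known. A module is given by an
    action of the generators that respects the quadratic relations; this one construction yields
    both J, from the dual restricted to [kFI^perp], and the inverse of [c ⊗ y |-> c J(y)].

    Two facts about relations carry every verification: the [xi_x] anticommute under the exchange of
    the two removed points, and the functional theta attached to a relation takes the same value on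
    the two ways of writing a two-point coface. Antisymmetric products then meet symmetric
    coefficients, so a sum equals its own negative, and characteristic zero allows division by 2.

    The differential is not an orbit map: [c |-> (i |-> c . i)] is a derivation on [kFS], not a
    linear map over it, so d is not given by a module structure on the tensor powers. It is
    transported from the Koszul complex, where it is visibly well defined, and the price is that the
    Leibniz rule has to be recovered afterwards. *)

Lemma linear_fadd (k : fieldType) (V W : lmodType k) (f g : V -> W) :
  linear f -> linear g -> linear (fun u => f u + g u).
Proof. by move=> fL gL x u v; rewrite fL gL scalerDr addrACA. Qed.

Lemma rhom_eval_linear (k : fieldType) (C : lincat k) (M N : bimod C) s t a (u : M a s) :
  linear (fun h : rhom_bimod M N s t => h a u).
Proof. by []. Qed.

Section RightQuadraticDual.
Variables (k : fieldType) (C : lincat k) (U A2 : bimod C).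
Variable mu : forall a b c, U b c -> U a b -> A2 a c.
Local Notation W := (right_dual U).
Local Notation Q := (rqd mu).

Lemma rqd_pi_linear n s t : linear (@rqd_pi _ _ _ _ mu n s t).
Proof. exact: lpi_linear. Qed.

Lemma rqd_pi_ind n s t (P : Q n s t -> Prop) :
  (forall x, P (rqd_pi mu x)) -> forall v, P v.
Proof. by move=> h; apply: lq_ind. Qed.

Lemma rqd_lactE n a b c (g : C b c) (x : tpow U n a b) :
  lact g (rqd_pi mu x : Q n a b) = rqd_pi mu (lact g x).
Proof.
by apply: (@qb_lactE k C (tpow U n) (@ideal_gen _ _ _ _ mu n)) => *;
  exact/lspan_gen/ideal_lact.
Qed.

Lemma rqd_ractE n a b c (x : tpow U n b c) (f : C a b) :
  ract (rqd_pi mu x : Q n b c) f = rqd_pi mu (ract x f).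
Proof.
by apply: (@qb_ractE k C (tpow U n) (@ideal_gen _ _ _ _ mu n)) => *;
  exact/lspan_gen/ideal_ract.
Qed.

Lemma rqd_mul_linl m n a b c (y : Q n a b) :
  linear (fun x : Q m b c => rqd_mul x y).
Proof.
move=> t; elim/rqd_pi_ind=> x; elim/rqd_pi_ind=> x'.
move: y; elim/rqd_pi_ind=> y.
by rewrite -rqd_pi_linear !rqd_mulE tmul_linl rqd_pi_linear.
Qed.

Lemma rqd_mul_linr m n a b c (x : Q m b c) :
  linear (fun y : Q n a b => rqd_mul x y).
Proof.
move=> t; elim/rqd_pi_ind=> y; elim/rqd_pi_ind=> y'.
move: x; elim/rqd_pi_ind=> x.
by rewrite -rqd_pi_linear !rqd_mulE tmul_linr rqd_pi_linear.
Qed.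

(** Since [1 + n] computes to [n.+1], products with a generator on the left need no cast. [rqd_ind0]
    and [rqd_indS] reduce every element to such products and to degree 0. *)
Definition wmul n s e t (w : W e t) (v : Q n s e) : Q n.+1 s t :=
  rqd_mul (rqd_deg1 mu w : Q 1 e t) v.

Lemma wmul_pi n s e t (w : W e t) (x : tpow U n s e) :
  wmul w (rqd_pi mu x) = rqd_pi mu (telt w x : tpow U n.+1 s t).
Proof.
rewrite /wmul /rqd_deg1 rqd_mulE; congr (rqd_pi mu _).
by rewrite /tone tmul_telt /= lact1.
Qed.

Lemma wmul_linl n s e t (v : Q n s e) : linear (fun w : W e t => wmul w v).
Proof.
move=> x w w'; move: v; elim/rqd_pi_ind=> v.
by rewrite !wmul_pi telt_linl rqd_pi_linear.
Qed.

Lemma wmul_linr n s e t (w : W e t) : linear (@wmul n s e t w).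
Proof. exact: (@rqd_mul_linr 1 n s e t (rqd_deg1 mu w)). Qed.

Lemma wmul_bal n s e e' t (w : W e t) (c : C e' e) (v : Q n s e') :
  wmul (ract w c) v = wmul w (lact c v).
Proof.
by move: v; elim/rqd_pi_ind=> v; rewrite rqd_lactE !wmul_pi telt_bal.
Qed.

Lemma wmul_lact n s e t t' (c : C t t') (w : W e t) (v : Q n s e) :
  wmul (lact c w) v = lact c (wmul w v).
Proof.
move: v; elim/rqd_pi_ind=> v; rewrite !wmul_pi rqd_lactE.
by congr (rqd_pi mu _); apply/esym; exact: tens_lactE.
Qed.

Lemma wmul_ract n s s' e t (w : W e t) (v : Q n s e) (c : C s' s) :
  ract (wmul w v) c = wmul w (ract v c).
Proof.
move: v; elim/rqd_pi_ind=> v; rewrite rqd_ractE !wmul_pi rqd_ractE.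
by congr (rqd_pi mu _); exact: tens_ractE.
Qed.

Lemma lact_deg0 a b c (g : C b c) (f : C a b) :
  lact g (rqd_deg0 mu f : Q 0 a b) = rqd_deg0 mu (lcomp g f).
Proof. exact: rqd_lactE. Qed.

Lemma ract_deg0 a b c (g : C b c) (f : C a b) :
  ract (rqd_deg0 mu g : Q 0 b c) f = rqd_deg0 mu (lcomp g f).
Proof. exact: rqd_ractE. Qed.

Lemma rqd_deg1E s t (w : W s t) :
  rqd_deg1 mu w = wmul w (rqd_deg0 mu (lid C s) : Q 0 s s).
Proof. by rewrite [RHS]wmul_pi. Qed.

Lemma rqd_ind0 s t (P : Q 0 s t -> Prop) :
  (forall c, P (rqd_deg0 mu c)) -> forall v, P v.
Proof. by move=> h; elim/rqd_pi_ind. Qed.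

Lemma rqd_indS n s t (P : Q n.+1 s t -> Prop) :
  P 0 -> (forall x u v, P u -> P v -> P (x *: u + v)) ->
  (forall e (w : W e t) (v : Q n s e), P (wmul w v)) -> forall v, P v.
Proof.
move=> P0 PL Pw; elim/rqd_pi_ind; elim/tens_ind => [|x u v Pu Pv|e w v].
- by rewrite (linf0 (@rqd_pi_linear _ _ _)).
- by rewrite rqd_pi_linear; exact: PL.
- by rewrite -wmul_pi.
Qed.

Lemma rqd_eqS n s t (V : lmodType k) (f g : Q n.+1 s t -> V) :
  linear f -> linear g ->
  (forall e (w : W e t) (v : Q n s e), f (wmul w v) = g (wmul w v)) -> f =1 g.
Proof.
move=> fL gL fg; elim/rqd_indS => [|x u v fu fv|//].
  by rewrite (linf0 fL) (linf0 gL).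
by rewrite fL gL fu fv.
Qed.

Lemma rqd_mul_deg0 n a b c (g : C b c) (y : Q n a b) :
  rqd_mul (rqd_deg0 mu g : Q 0 b c) y = lact g y.
Proof.
by move: y; elim/rqd_pi_ind=> y; rewrite /rqd_deg0 rqd_mulE rqd_lactE.
Qed.

Lemma rqd_mul_wmul m n a b e c (w : W e c) (x : Q m b e) (y : Q n a b) :
  rqd_mul (wmul w x) y = wmul w (rqd_mul x y) :> Q (m + n).+1 a c.
Proof.
move: x; elim/rqd_pi_ind=> x; move: y; elim/rqd_pi_ind=> y.
by rewrite wmul_pi !rqd_mulE tmul_telt wmul_pi.
Qed.

Lemma rqd_mul_lact m n a b c c' (g : C c c') (x : Q m b c) (y : Q n a b) :
  rqd_mul (lact g x) y = lact g (rqd_mul x y).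
Proof.
move: x; elim/rqd_pi_ind=> x; move: y; elim/rqd_pi_ind=> y.
by rewrite rqd_lactE !rqd_mulE tmul_lact rqd_lactE.
Qed.

(** With a literal degree on the left, both bracketings have convertible degrees, so associativity
    needs no cast. The degree 2 version [rqd_mulA2] serves the Leibniz rule, where the left factor
    is the differential of a generator. *)
Lemma rqd_mulA1 m n a b c e (z : Q 1 c e) (x : Q m b c) (y : Q n a b) :
  rqd_mul (rqd_mul z x : Q m.+1 b e) y = rqd_mul z (rqd_mul x y) :> Q (m + n).+1 a e.
Proof.
move: z; apply: rqd_eqS => [||r w z].
- exact: linear_compose (@rqd_mul_linl 1 m b c e x) (@rqd_mul_linl m.+1 n a b e y).
- exact: (@rqd_mul_linl 1 (m + n) a c e).
move: z; elim/rqd_ind0 => g.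
by rewrite !(rqd_mul_wmul, rqd_mul_deg0) rqd_mul_lact.
Qed.

Lemma rqd_mulA2 m n a b c e (z : Q 2 c e) (x : Q m b c) (y : Q n a b) :
  rqd_mul (rqd_mul z x : Q m.+2 b e) y = rqd_mul z (rqd_mul x y) :> Q (m + n).+2 a e.
Proof.
move: z; apply: rqd_eqS => [||r w z].
- exact: linear_compose (@rqd_mul_linl 2 m b c e x) (@rqd_mul_linl m.+2 n a b e y).
- exact: (@rqd_mul_linl 2 (m + n) a c e).
by rewrite !rqd_mul_wmul rqd_mulA1.
Qed.

Definition wmul2 n s e t (z : tens W W e t) (v : Q n s e) : Q n.+2 s t :=
  tlift (fun r (p : W r t) (q : W e r) => wmul p (wmul q v)) z.

Lemma wmul2_linear n s e t (v : Q n s e) :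
  linear (fun z : tens W W e t => wmul2 z v).
Proof.
apply: tlift_linear.
- by move=> r q; exact: wmul_linl.
- by move=> r p; exact: linear_compose (wmul_linl v) (@wmul_linr _ _ _ _ p).
- by move=> r r' p c q; rewrite wmul_bal wmul_lact.
Qed.

Lemma wmul2E n s e r t (p : W r t) (q : W e r) (v : Q n s e) :
  wmul2 (telt p q) v = wmul p (wmul q v).
Proof.
apply: tliftE => [r' q'|r' p'|r' r'' p' c q'].
- exact: wmul_linl.
- exact: linear_compose (wmul_linl v) (@wmul_linr _ _ _ _ p').
- by rewrite wmul_bal wmul_lact.
Qed.

Lemma tpow2_linear s t : linear (@tpow2 _ _ U s t).
Proof.
apply: tlift_linear => [r q|r p x q q'|r r' p c q].
- exact: telt_linl.
- by rewrite /tone telt_linl telt_linr.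
- rewrite telt_bal; congr telt; exact: tens_lactE.
Qed.

Lemma tpow2E s r t (p : W r t) (q : W s r) :
  tpow2 (telt p q) = telt p (tone q) :> tpow U 2 s t.
Proof.
apply: tliftE => [r' q'|r' p' x q' q''|r' r'' p' c q'].
- exact: telt_linl.
- by rewrite /tone telt_linl telt_linr.
- rewrite telt_bal; congr telt; exact: tens_lactE.
Qed.

(** Relations are given in [tens W W], while the ideal lives in [tpow U 2], which carries an
    additional last factor [C]. This passes from one to the other. *)
Lemma wmul2_pi n s e t (z : tens W W e t) (v : Q n s e) :
  wmul2 z v = rqd_mul (rqd_pi mu (tpow2 z) : Q 2 e t) v.
Proof.
move: z; apply: tens_eq => [||r p q]; first exact: wmul2_linear.
  exact: linear_compose (linear_compose (@tpow2_linear e t) (@rqd_pi_linear 2 e t))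
    (@rqd_mul_linl 2 n s e t v).
by rewrite wmul2E tpow2E -wmul_pi rqd_mul_wmul.
Qed.

Lemma wmul2_relation n s e t (z : tens W W e t) (theta : right_dual A2 e t)
    (v : Q n s e) :
  (forall a b (u : U b e) (u' : U a b), dual_pairing z u u' = theta a (mu u u')) ->
  wmul2 z v = 0.
Proof.
move=> h; rewrite wmul2_pi.
have -> : rqd_pi mu (tpow2 z) = 0.
  by apply/lpi_gen/IdealRel; exists z, theta.
exact: (linf0 (@rqd_mul_linl 2 n s e t v)).
Qed.

Lemma dual_pairing_linear s t a b (u : U b s) (v : U a b) :
  linear (fun z : tens W W s t => dual_pairing z u v).
Proof.
apply: tlift_linear => [r q x p p'|r p x q q'|r r' p c q] //=.
by rewrite lact_linl rfun_linear.
by rewrite lactA.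
Qed.

Lemma dual_pairingE s r t (p : W r t) (q : W s r) a b (u : U b s) (v : U a b) :
  dual_pairing (telt p q) u v = p a (lact (q b u) v).
Proof.
apply: tliftE => [r' q' x p' p''|r' p' x q' q''|r' r'' p' c q'] //=.
by rewrite lact_linl rfun_linear.
by rewrite lactA.
Qed.

Lemma rhom_pairing_linl s r t (p : W r t) (q : W s r) a b (v : U a b) :
  linear (fun u : U b s => p a (lact (q b u) v)).
Proof. by move=> x u u'; rewrite !rfun_linear lact_linl rfun_linear. Qed.

Lemma rhom_pairing_linr s r t (p : W r t) (q : W s r) a b (u : U b s) :
  linear (fun v : U a b => p a (lact (q b u) v)).
Proof. by move=> x v v'; rewrite lact_linr rfun_linear. Qed.

Lemma right_dual_addE a b (p q : W a b) r (u : U r a) :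
  rfun (p + q) u = p r u + q r u.
Proof. by []. Qed.

Lemma right_dual_ractE a b c (p : W b c) (g : C a b) r (u : U r a) :
  rfun (ract p g : W a c) u = p r (lact g u).
Proof. by []. Qed.

Lemma right_dual_lactE a b c (g : C b c) (p : W a b) r (u : U r a) :
  rfun (lact g p : W a c) u = lcomp g (p r u).
Proof. by []. Qed.

(** The form in which anticommutation is proved: two elementary tensors, through possibly different
    middle objects, whose total pairing factors through [mu]. *)
Lemma wmul_relation n s e r r' t (p : W r t) (q : W e r) (p' : W r' t) (q' : W e r')
    (theta : right_dual A2 e t) (v : Q n s e) :
  (forall a b (u : U b e) (u' : U a b),
    p a (lact (q b u) u') + p' a (lact (q' b u) u') = theta a (mu u u')) ->
  wmul p (wmul q v) + wmul p' (wmul q' v) = 0.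
Proof.
move=> h; rewrite -!wmul2E -(linfD (wmul2_linear v)).
apply: (wmul2_relation (theta := theta)) => a b u u'.
apply: etrans (linfD (dual_pairing_linear u u') _ _) _.
exact: etrans (congr2 +%R (dual_pairingE p q u u') (dual_pairingE p' q' u u'))
  (h _ _ u u').
Qed.

End RightQuadraticDual.

(** * Graded modules over the dual and their orbit maps *)

Section UniversalProperty.
Variables (k : fieldType) (C : lincat k) (U A2 : bimod C).
Variable mu : forall a b c, U b c -> U a b -> A2 a c.
Local Notation W := (right_dual U).
Local Notation Q := (rqd mu).
Local Notation T := (tpow U).

(* A graded left module over rqd mu, given by the actions ca and wa of the
   generators C and W. *)
Record rqd_module := RqdModule {
  msort :> nat -> nat -> lmodType k;
  ca : forall n a b, C a b -> msort n a -> msort n b;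
  wa : forall n a b, W a b -> msort n a -> msort n.+1 b;
  ca_linr : forall n a b (c : C a b), linear (fun v : msort n a => ca c v);
  caA : forall n a b c (g : C b c) (f : C a b) (v : msort n a),
    ca g (ca f v) = ca (lcomp g f) v;
  ca_linl : forall n a b (v : msort n a), linear (fun c : C a b => ca c v);
  wa_linl : forall n a b (v : msort n a), linear (fun w : W a b => wa w v);
  wa_linr : forall n a b (w : W a b), linear (fun v : msort n a => wa w v);
  wa_bal : forall n a b c (w : W b c) (f : C a b) (v : msort n a),
    wa (ract w f) v = wa w (ca f v);
  wa_lact : forall n a b c (g : C b c) (w : W a b) (v : msort n a),
    wa (lact g w) v = ca g (wa w v);
  wa_rel : forall s t (z : tens W W s t) (theta : right_dual A2 s t),
    (forall a b (u : U b s) (u' : U a b),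
      dual_pairing z u u' = theta a (mu u u')) ->
    forall n (v : msort n s),
    tlift (fun r (p : W r t) (q : W s r) => wa p (wa q v)) z = 0
}.

Variable N : rqd_module.

Fixpoint tact m n a b : T m a b -> N n a -> N (m + n) b :=
  match m return T m a b -> N n a -> N (m + n) b with
  | 0 => fun c v => ca (c : C a b) v
  | m'.+1 => fun x v => tlift (fun r (w : W r b) (y : T m' a r) => wa w (tact y v)) x
  end.

(** The laws are proved in one induction because [tlift] in degree [m.+1] computes only for a
    balanced map, and balancedness uses linearity and [C]-equivariance in degree [m]. The last
    clause is a [match] because elementary tensors exist in positive degree only. *)
Lemma tact_laws m :
  [/\ forall n a b (v : N n a), linear (fun x : T m a b => tact x v),
      forall n a b c (g : C b c) (x : T m a b) (v : N n a),
        tact (lact g x) v = ca g (tact x v) &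
      match m with 0 => True | m'.+1 =>
        forall n a r b (w : W r b) (x : T m' a r) (v : N n a),
        tact (telt w x : T m'.+1 a b) v = wa w (tact x v) end].
Proof.
elim: m => [|m [IHl IHa _]]; first by split=> // *; [exact: ca_linl|rewrite /= caA].
have fl n a b (v : N n a) r (y : T m a r) :
  linear (fun w : W r b => wa w (tact y v)) by exact: wa_linl.
have fr n a b (v : N n a) r (w : W r b) :
    linear (fun y : T m a r => wa w (tact y v)).
  exact: linear_compose (IHl _ _ _ v) (wa_linr w).
have fb n a b (v : N n a) r r' (w : W r' b) (f : C r r') (y : T m a r) :
    wa (ract w f) (tact y v) = wa w (tact (lact f y) v).
  by rewrite wa_bal IHa.
have L n a b (v : N n a) : linear (fun x : T m.+1 a b => tact x v).
  exact: tlift_linear (@fl n a b v) (@fr n a b v) (@fb n a b v).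
have E n a r b (w : W r b) (x : T m a r) (v : N n a) :
    tact (telt w x : T m.+1 a b) v = wa w (tact x v).
  exact: tliftE (@fl n a b v) (@fr n a b v) (@fb n a b v) _ _ _.
split=> // n a b c g + v; apply: tens_eq => [||r w x].
- exact: linear_compose (@lact_linr _ C (T m.+1) a b c g) (@L n a c v).
- exact: linear_compose (@L n a b v) (@ca_linr N _ _ _ _).
- rewrite E -wa_lact -E; congr tact; exact: tens_lactE.
Qed.

Lemma tact_linl m n a b (v : N n a) : linear (fun x : T m a b => tact x v).
Proof. by have [h _ _] := tact_laws m; apply: h. Qed.
Lemma tact_lact m n a b c (g : C b c) (x : T m a b) (v : N n a) :
  tact (lact g x) v = ca g (tact x v).
Proof. by have [_ h _] := tact_laws m; apply: h. Qed.
Lemma tact_telt m n a r b (w : W r b) (x : T m a r) (v : N n a) :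
  tact (telt w x : T m.+1 a b) v = wa w (tact x v).
Proof. by have [_ _ h] := tact_laws m.+1; apply: h. Qed.

Lemma tact_linr m n a b (x : T m a b) : linear (fun v : N n a => tact x v).
Proof.
elim: m b x => [|m IH] b x; first exact: ca_linr.
move: x; apply: tens_ind => [y u v|y u v Lu Lv z p q|r w x y u v].
- by rewrite !(linf0 (tact_linl _)) scaler0 addr0.
- have E (p' : N n a) : tact (y *: u + v : T m.+1 a b) p' =
      y *: tact (u : T m.+1 a b) p' + tact (v : T m.+1 a b) p'.
    exact: (@tact_linl m.+1).
  by rewrite !E; exact: linear_comb Lu Lv z p q.
- by rewrite !tact_telt IH wa_linr.
Qed.

Lemma cast_linear i j (e : i = j) r : linear (fun u : N i r => ecast i (N i r) e u).
Proof. by case: _ / e. Qed.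

Lemma wa_cast i j (e : i = j) r b (w : W r b) (v : N i r) (e' : i.+1 = j.+1) :
  wa w (ecast i (N i r) e v) = ecast i (N i b) e' (wa w v).
Proof. by case: _ / e in e' *; rewrite eq_axiomK. Qed.

Lemma ca_cast i j (e : i = j) a b (c : C a b) (v : N i a) :
  ca c (ecast i (N i a) e v) = ecast i (N i b) e (ca c v).
Proof. by case: _ / e. Qed.

Lemma tact_tmul m n p a b c (x : T m b c) (y : T n a b) (v : N p a) :
  tact (tmul x y) v =
  ecast i (N i c) (addnA m n p) (tact x (tact y v)).
Proof.
elim: m c x => [|m IH] c x; first by rewrite eq_axiomK /= tact_lact.
move: x; apply: tens_eq => [||r w x].
- exact: linear_compose (@tmul_linl _ _ U m.+1 n a b c y) (@tact_linl (m.+1 + n) p a c v).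
- exact: linear_compose (@tact_linl m.+1 (n + p) b c (tact y v))
    (@cast_linear _ _ (addnA m.+1 n p) c).
by rewrite tmul_telt !tact_telt IH (wa_cast _ _ _ (addnA m.+1 n p)).
Qed.

Lemma tact_ideal m a b (x : T m a b) : ideal_gen mu x ->
  forall n (v : N n a), tact x v = 0.
Proof.
elim=> {m a b x} [s t x [z [theta [h ->]]] n v|m n a b c x y _ IH p v|m n a b c x y _ IH p v].
- rewrite -[RHS](wa_rel h v); move: {h} z; apply: tens_eq => [||r w w'].
  + exact: linear_compose (@tpow2_linear _ _ U s t) (@tact_linl 2 n s t v).
  + apply: tlift_linear => [r q|r w|r r' w c q]; first exact: wa_linl.
      exact: linear_compose (wa_linl v) (wa_linr w).
    by rewrite wa_bal wa_lact.
  + rewrite tpow2E !tact_telt [LHS]/=.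
    have -> : tlift (fun r0 (p : W r0 t) (q : W s r0) => wa p (wa q v)) (telt w w')
        = wa w (wa w' v).
      apply: tliftE => [r1 q|r1 p|r1 r' p c q]; first exact: wa_linl.
        exact: linear_compose (wa_linl v) (wa_linr p).
      by rewrite wa_bal wa_lact.
    (* [tone w'] leaves an identity of [C] acting on [v]. [rqd_module] contains no unit law, so the
       identity is absorbed into [w'] by balancing. *)
    by rewrite -wa_bal [ract _ _](@ract1 _ _ (right_dual U)).
- by rewrite tact_tmul IH (linf0 (tact_linr _)) (linf0 (@cast_linear _ _ _ _)).
- by rewrite tact_tmul IH (linf0 (@cast_linear _ _ _ _)).
Qed.

Variables (s : nat) (e0 : N 0 s).

(** The orbit map [q |-> q . e0]. It is linear, and the three lemmas after [rqd_lift_linear] say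
    that it intertwines multiplication by generators with [ca] and [wa]. *)
Definition rqd_lift n t (q : Q n s t) : N n t :=
  lq_lift (fun x => ecast i (N i t) (addn0 n) (tact x e0)) q.

Lemma rqd_liftE n t (x : T n s t) :
  rqd_lift (rqd_pi mu x) = ecast i (N i t) (addn0 n) (tact x e0).
Proof.
apply: lq_liftE => [|u Iu]; last by rewrite (tact_ideal Iu) (linf0 (@cast_linear _ _ _ _)).
exact: linear_compose (@tact_linl n 0 s t e0) (@cast_linear _ _ _ _).
Qed.

Lemma rqd_lift_linear n t : linear (@rqd_lift n t).
Proof.
move=> x; elim/rqd_pi_ind=> u; elim/rqd_pi_ind=> v.
rewrite -rqd_pi_linear !rqd_liftE.
exact: (linear_compose (@tact_linl n 0 s t e0) (@cast_linear _ _ _ _)).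
Qed.

Lemma rqd_lift_deg0 t (c : C s t) : rqd_lift (rqd_deg0 mu c) = ca c e0.
Proof. by rewrite rqd_liftE eq_axiomK. Qed.

Lemma rqd_lift_wmul n r t (w : W r t) (v : Q n s r) :
  rqd_lift (wmul w v) = wa w (rqd_lift v).
Proof.
move: v; elim/rqd_pi_ind=> v; rewrite wmul_pi !rqd_liftE tact_telt.
by rewrite (wa_cast _ _ _ (addn0 n.+1)).
Qed.

Lemma rqd_lift_lact n r t (c : C r t) (v : Q n s r) :
  rqd_lift (lact c v) = ca c (rqd_lift v).
Proof.
move: v; elim/rqd_pi_ind=> v; rewrite rqd_lactE !rqd_liftE tact_lact.
by rewrite ca_cast.
Qed.

End UniversalProperty.

(** * Cofaces and dual bases *)

Section Cofaces.

(* This is coface x, for x in 'I_s with s not displayed as a successor. *)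
Definition cof s (x : 'I_s) : {ffun 'I_s.-1 -> 'I_s} := [ffun j => lift x j].

(* The involution (x, y) |-> (lift x y, swap_snd x y) relates the two ways of
   removing the points x and lift x y one after the other. *)
Definition swap_snd s (x : 'I_s) (y : 'I_s.-1) : 'I_s.-1 :=
  odflt y (unlift (lift x y) x).

(** As [lift x y] differs from [x], the default in [swap_snd] is never taken: [swap_snd x y] is the
    position of [x] once [lift x y] has been removed. *)
Lemma lift_swap s (x : 'I_s) (y : 'I_s.-1) : lift (lift x y) (swap_snd x y) = x.
Proof.
rewrite /swap_snd; have : lift x y != x by rewrite eq_sym neq_lift.
by move=> /unlift_some[j xE ->].
Qed.

Lemma swap_sndK s (x : 'I_s) (y : 'I_s.-1) :
  swap_snd (lift x y) (swap_snd x y) = y.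
Proof. by apply: (@lift_inj _ x); rewrite -{1}(lift_swap x y) lift_swap. Qed.

Lemma cof_swap s (x : 'I_s) (y : 'I_s.-1) :
  fcomp (cof x) (cof y) = fcomp (cof (lift x y)) (cof (swap_snd x y)).
Proof.
apply/ffunP => j; rewrite !ffunE; apply/val_inj => /=.
(* [swap_snd] enters only through this equation, which determines its value; the rest is arithmetic
   on the comparisons hidden in [bump]. *)
have := congr1 val (lift_swap x y) => /=; rewrite /bump.
by case: leqP; case: leqP; case: leqP; case: leqP; case: leqP; case: leqP;
  case: leqP; lia.
Qed.

Lemma cof_inj s (x : 'I_s) : injective (cof x).
Proof. by move=> i j; rewrite !ffunE => /lift_inj. Qed.

Lemma fcomp_inj a b c (i : {ffun 'I_b -> 'I_c}) (p q : {ffun 'I_a -> 'I_b}) :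
  injective i -> fcomp i p = fcomp i q -> p = q.
Proof. by move=> ii /ffunP h; apply/ffunP => x; apply: ii; have := h x; rewrite !ffunE. Qed.

Lemma corank_card a b (f : {ffun 'I_a -> 'I_b}) :
  corank f = (b - #|[set f x | x : 'I_a]|)%N.
Proof. by rewrite /corank cardsCs setCK card_ord. Qed.

(** Composing with [i] keeps the size of the image while the codomain grows by [d]. Hence a cofactor
    through [i] is surjective as soon as the corank is at most [d]. *)
Lemma corank_inj_comp a r d s (i : {ffun 'I_r -> 'I_s}) (p : {ffun 'I_a -> 'I_r}) :
  injective i -> s = (d + r)%N -> corank (fcomp i p) = (d + corank p)%N.
Proof.
move=> ii sE; rewrite !corank_card.
have -> : [set fcomp i p x | x : 'I_a] = i @: [set p x | x : 'I_a].
  by rewrite -imset_comp; apply: eq_imset => x; rewrite ffunE.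
rewrite card_imset //.
have := max_card [set p x | x : 'I_a]; rewrite card_ord; lia.
Qed.

Lemma injm_deg_corank d a s (f : {ffun 'I_a -> 'I_s}) :
  injm_deg d f -> corank f = d.
Proof.
move=> /andP[/injectiveP fi /eqP sE].
by rewrite corank_card card_imset // card_ord sE addnK.
Qed.

Lemma surj_factor a r d s (i : {ffun 'I_r -> 'I_s}) (p : {ffun 'I_a -> 'I_r})
    (f : {ffun 'I_a -> 'I_s}) :
  injective i -> s = (d + r)%N -> corank_le d f -> fcomp i p = f -> surjm p.
Proof.
by move=> ii sE + fE; rewrite /corank_le -fE (corank_inj_comp _ ii sE) surjm_corank; lia.
Qed.

Lemma bij_factor a r d s (i : {ffun 'I_r -> 'I_s}) (p : {ffun 'I_a -> 'I_r})
    (f : {ffun 'I_a -> 'I_s}) :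
  injective i -> s = (d + r)%N -> injm_deg d f -> fcomp i p = f -> bijm p.
Proof.
move=> ii sE fd fE; rewrite /bijm (surj_factor ii sE _ fE) ?andbT; last first.
  by rewrite /corank_le (injm_deg_corank fd).
have /andP[/injectiveP fi _] := fd; apply/injectiveP => x y pxy; apply: fi.
by rewrite -fE !ffunE pxy.
Qed.

(** The point [x] is the only one missed by [f], and a map through [cof x'] misses [x']. Uniqueness
    of [x] is what leaves a single term in the dual basis expansions. *)
Lemma corank1_factor a s (f : {ffun 'I_a -> 'I_s}) : corank f = 1%N ->
  exists (x : 'I_s) (p : {ffun 'I_a -> 'I_s.-1}), f = fcomp (cof x) p /\
    forall x' (p' : {ffun 'I_a -> 'I_s.-1}), fcomp (cof x') p' = f -> x' = x.
Proof.
move=> /eqP/cards1P[x xE]; exists x.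
have fx j : exists q, lift x q = f j.
  have : x != f j.
    apply/negP => /eqP xf; have := set11 x; rewrite -xE inE xf imset_f //.
  by move=> /unlift_some[q -> _]; exists q.
have [p pE] := choice fx; exists (finfun p); split.
  by apply/ffunP => j; rewrite !ffunE pE.
move=> x' p' fE; apply/set1P; rewrite -xE inE -fE; apply/negP.
move=> /imsetP[j _]; rewrite !ffunE => /eqP; apply/negP; exact: neq_lift.
Qed.

Lemma pred_cof1 s (x : 'I_s) : s = (1 + s.-1)%N.
Proof. by case: s x => [[]|]. Qed.

Lemma pred_cof2 s (y : 'I_s.-1) : s = (2 + s.-1.-1)%N.
Proof. by case: s y => [|[|s]] // [[]]. Qed.

Lemma big_factor (V : zmodType) a r s (i : {ffun 'I_r -> 'I_s})
    (p : {ffun 'I_a -> 'I_r}) (F : {ffun 'I_a -> 'I_r} -> V) :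
  injective i -> \sum_(q | fcomp i q == fcomp i p) F q = F p.
Proof.
move=> ii; apply: big_pred1 => q /=; apply/eqP/eqP => [|-> //].
exact: fcomp_inj.
Qed.

Lemma sum_supp1 (V : zmodType) (I : finType) (x : I) (F : I -> V) :
  (forall z, z != x -> F z = 0) -> \sum_z F z = F x.
Proof. by move=> F0; rewrite (bigD1 x) //= big1 ?addr0. Qed.

Lemma big_nofactor (V : zmodType) a r s (i : {ffun 'I_r -> 'I_s})
    (f : {ffun 'I_a -> 'I_s}) (F : {ffun 'I_a -> 'I_r} -> V) :
  (forall q, fcomp i q <> f) -> \sum_(q | fcomp i q == f) F q = 0.
Proof. by move=> nf; apply: big1 => q /eqP /nf. Qed.

(* A map f of corank 1 misses at most one of the two points x and lift x y
   missed by the composite of the cofaces, and exactly one of them when f g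
   factors through that composite. *)
Lemma swap_factor_sum (V : zmodType) a b s (x : 'I_s) (y : 'I_s.-1)
    (f : {ffun 'I_b -> 'I_s}) (g : {ffun 'I_a -> 'I_b})
    (F : {ffun 'I_a -> 'I_s.-1.-1} -> V) :
  corank f = 1%N -> (corank g <= 1)%N ->
  \sum_(p | fcomp (cof x) p == f) \sum_(q | fcomp (cof y) q == fcomp p g) F q +
  \sum_(p | fcomp (cof (lift x y)) p == f)
    \sum_(q | fcomp (cof (swap_snd x y)) q == fcomp p g) F q =
  \sum_(q | fcomp (fcomp (cof x) (cof y)) q == fcomp f g) F q.
Proof.
move=> f1 g1; have [w [p [fE wP]]] := corank1_factor f1.
have W v q : fcomp (cof v) q = f -> v = w by exact: wP.
have key v (z : 'I_s.-1) : w = v ->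
    \sum_(p | fcomp (cof v) p == f) \sum_(q | fcomp (cof z) q == fcomp p g) F q =
    \sum_(q | fcomp (fcomp (cof v) (cof z)) q == fcomp f g) F q.
  move=> wv; rewrite fE wv big_factor; last exact: cof_inj.
  apply: eq_bigl => q; rewrite -!fcompA; apply/eqP/eqP => [-> //|].
  exact/fcomp_inj/cof_inj.
have out v (z : 'I_s.-1) : w != v ->
    \sum_(p | fcomp (cof v) p == f) \sum_(q | fcomp (cof z) q == fcomp p g) F q = 0.
  by move=> nwv; apply: big_nofactor => q /W /eqP; rewrite eq_sym (negbTE nwv).
have [wx|nwx] := eqVneq w x.
  by rewrite (key _ _ wx) out ?addr0 // wx neq_lift.
rewrite (out _ _ nwx) add0r.
have [wx'|nwx'] := eqVneq w (lift x y); first by rewrite (key _ _ wx') -cof_swap.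
rewrite (out _ _ nwx') big_nofactor // => q qE.
(* If [f g] factored through the two-point coface, it would miss [x], [lift x y] and also the point
   [w] missed by [f]: three distinct points, against corank at most 2. *)
have : (corank (fcomp f g) <= 2)%N.
  by apply: leq_trans (corank_comp f g) _; rewrite f1; lia.
apply/negP; rewrite -ltnNge.
have <- : #|[set x; lift x y; w]| = 3%N.
  rewrite setUC cardsU1 !inE (negbTE nwx) (negbTE nwx') cards2 neq_lift //.
apply/subset_leq_card/subsetP => v; rewrite !inE => vE; apply/imsetP => -[j _ vj].
case/orP: vE => [/orP[]|] /eqP vE.
- move: vj; rewrite vE -qE !ffunE => /eqP; apply/negP; exact: neq_lift.
- move: vj; rewrite vE -qE cof_swap !ffunE => /eqP; apply/negP; exact: neq_lift.
- move: vj; rewrite vE fE !ffunE => /eqP; apply/negP; exact: neq_lift.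
Qed.

(** Reindexing along the involution of [cof_swap] gives [S = - S]; [char0] at the prime 2 then lets
    2 be divided out. *)
Lemma sum_antisym (k : fieldType) (V : lmodType k) s
    (F : 'I_s -> 'I_s.-1 -> V) : [pchar k] =i pred0 ->
  (forall x y, F x y + F (lift x y) (swap_snd x y) = 0) ->
  \sum_x \sum_y F x y = 0.
Proof.
move=> char0 Fsw; rewrite pair_bigA /=; set S := \sum_p _.
have SE : S + S = 0.
  pose sw (p : 'I_s * 'I_s.-1) := (lift p.1 p.2, swap_snd p.1 p.2).
  have swK : involutive sw by case=> x y; rewrite /sw /= lift_swap swap_sndK.
  rewrite {2}/S (reindex_inj (inv_inj swK)) -big_split big1 //=.
have : (2%:R : k) *: S = 0 by rewrite scaler_nat mulr2n.
move=> /eqP; rewrite scaler_eq0 => /orP[|/eqP //].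
by move: (char0 2%N); rewrite !inE /= => ->.
Qed.

End Cofaces.

Lemma linear_bigsum (k : fieldType) (V W : lmodType k) (I : Type) (r : seq I)
    (P : pred I) (F : I -> V -> W) :
  (forall i, linear (F i)) -> linear (fun u => \sum_(i <- r | P i) F i u).
Proof.
move=> FL x u v; rewrite scaler_sumr -big_split.
by apply: eq_bigr => i _; rewrite FL.
Qed.

(** * Finite dual bases and antisymmetric sums *)

Section DualBasis.
Variables (k : fieldType) (C : lincat k) (U A2 : bimod C).
Variable mu : forall a b c, U b c -> U a b -> A2 a c.
Local Notation W := (right_dual U).
Local Notation Q := (rqd mu).
Variables (e : forall s (x : 'I_s), U s.-1 s)
  (xi : forall s (x : 'I_s), W s s.-1).
Hypothesis eK : forall a s (u : U a s), u = \sum_(x < s) ract (e x) (xi x a u).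

Lemma rfun_expand s t (w : W s t) a (u : U a s) :
  w a u = \sum_(x < s) lcomp (w s.-1 (e x)) (xi x a u).
Proof.
rewrite {1}(eK u) (linf_sum (rfun_linear w (a := a))).
by apply: eq_bigr => x _; rewrite rfun_ract.
Qed.

Lemma rhom_sumE s t (I : Type) (r : seq I) (P : pred I) (F : I -> W s t) a (u : U a s) :
  (\sum_(i <- r | P i) F i) a u = \sum_(i <- r | P i) F i a u.
Proof. by elim/big_rec2: _ => // i y z _ <-. Qed.

Lemma rhom_expand s t (w : W s t) :
  w = \sum_(x < s) lact (w s.-1 (e x) : C s.-1 t) (xi x).
Proof. by apply: rhomP => a u; rewrite rhom_sumE; exact: rfun_expand. Qed.

Lemma rhom_basisP s t (w w' : W s t) :
  (forall x : 'I_s, w _ (e x) = w' _ (e x)) -> w = w'.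
Proof.
move=> h; rewrite (rhom_expand w) (rhom_expand w').
by apply: eq_bigr => x _; rewrite h.
Qed.

Lemma wmul_expand n r s t (w : W s t) (v : Q n r s) :
  wmul w v = \sum_(x < s) lact (w s.-1 (e x) : C s.-1 t) (wmul (xi x) v).
Proof.
rewrite {1}(rhom_expand w) (linf_sum (wmul_linl v)).
by apply: eq_bigr => x _; rewrite wmul_lact.
Qed.

Hypotheses (char0 : [pchar k] =i pred0)
  (rel : forall n r s (x : 'I_s) (y : 'I_s.-1) (v : Q n r s),
    wmul (xi y) (wmul (xi x) v) +
    wmul (xi (swap_snd x y)) (wmul (xi (lift x y)) v) = 0).

Lemma sum_swap_lact n r s t (f : 'I_s -> 'I_s.-1 -> C s.-1.-1 t) (v : Q n r s) :
  (forall x y, f x y = f (lift x y) (swap_snd x y)) ->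
  \sum_x \sum_y lact (f x y) (wmul (xi y) (wmul (xi x) v)) = 0.
Proof.
move=> fsw; apply: sum_antisym => // x y; rewrite -fsw.
by rewrite -(linfD (lact_linr (f x y))) rel (linf0 (lact_linr _)).
Qed.

Lemma sum_swap_telt n r s t (M : bimod C) (f : 'I_s -> 'I_s.-1 -> M s.-1.-1 t)
    (v : Q n r s) :
  (forall x y, f x y = f (lift x y) (swap_snd x y)) ->
  \sum_x \sum_y (telt (f x y) (wmul (xi y) (wmul (xi x) v)) : tens M (Q n.+2) r t) = 0.
Proof.
move=> fsw; apply: sum_antisym => // x y; rewrite -fsw.
by rewrite -(linfD (telt_linr (f x y))) rel (linf0 (telt_linr _)).
Qed.

End DualBasis.

(** * Division of maps by an injection *)

Section Pull.
Variable k : fieldType.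

(** For injective [i] the sum has at most one term: it divides [f] by [i] when this is possible and
    gives 0 otherwise. The elements [xi_x] and the functionals witnessing their relations are all of
    this kind. *)
Definition pull (P R : mclass) a r s (i : {ffun 'I_r -> 'I_s})
    (u : kmap k P a s) : kmap k R a r :=
  fext (fun f => \sum_(p | fcomp i p == val f) kbasis k R p) u.

Lemma pull_linear (P R : mclass) a r s (i : {ffun 'I_r -> 'I_s}) :
  linear (@pull P R a r s i).
Proof. exact: fext_linear. Qed.

Lemma pullE (P R : mclass) a r s (i : {ffun 'I_r -> 'I_s})
    (f : {ffun 'I_a -> 'I_s}) : P _ _ f ->
  pull R i (kbasis k P f) = \sum_(p | fcomp i p == f) kbasis k R p.
Proof. by move=> Pf; rewrite (kbasis_in _ Pf) [LHS]fextE. Qed.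

(** If [f = i p], then [f g = i (p g)]. Conversely, if [f g = i q], a section [h] of the surjection
    [g] gives [f = i (q h)]; so [f] and [f g] are divisible by [i] simultaneously. [PR] ensures that
    the cofactor is not killed by [kbasis]. *)
Lemma pull_kcomp (P Q R : mclass) a b r s (i : {ffun 'I_r -> 'I_s})
    (u : kmap k P b s) (g : kmap k Q a b) :
  injective i -> mclosed P Q P -> mclosed R Q R ->
  (forall a b (g : {ffun 'I_a -> 'I_b}), Q _ _ g -> surjm g) ->
  (forall a (p : {ffun 'I_a -> 'I_r}), P _ _ (fcomp i p) -> R _ _ p) ->
  pull R i (kcomp P u g) = kcomp R (pull R i u) g.
Proof.
move=> ii PQ RQ Qs PR; move: u; apply: kmap_eq => [||f Pf].
- exact: linear_compose (kcomp_linl _ _) (pull_linear _ _).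
- exact: linear_compose (pull_linear _ _) (kcomp_linl _ _).
move: g; apply: kmap_eq => [||g Qg].
- exact: linear_compose (kcomp_linr _ _) (pull_linear _ _).
- exact: kcomp_linr.
rewrite kcompE // pullE ?pullE //; last exact: PQ.
rewrite (linf_sum (kcomp_linl _ _)).
have [[p pE]|np] := pselect (exists p, fcomp i p = f).
  rewrite -pE -fcompA !big_factor // kcompE //.
  by apply: PR; rewrite pE.
rewrite [RHS]big_nofactor => [|q qE]; last by case: np; exists q.
rewrite big_nofactor // => q qE; case: np.
have /surjmP gs := Qs _ _ _ Qg; have [h hE] := choice gs.
exists (fcomp q (finfun h)); apply/ffunP => j; rewrite !ffunE.
by have /ffunP/(_ (h j)) := qE; rewrite !ffunE hE.
Qed.

End Pull.

(** * The generators of kFI and of gr kFA *)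

Section InjectiveMaps.
Variable k : fieldType.
Local Notation U := (kFI_deg k 1).
Local Notation Q := (kFI_dual k).

Definition eFI s (x : 'I_s) : U s.-1 s := kbasis k (injm_deg 1) (cof x).

(** Indexed by ['I_s] for arbitrary [s], like [cof], whereas [coface_dual] exists over a successor;
    the value at 0 is harmless because ['I_0] is empty. *)
Definition xiFI s : 'I_s -> right_dual U s s.-1 :=
  match s with 0 => fun _ => 0 | a.+1 => fun x => coface_dual k x end.

Lemma xiFI_E s (x : 'I_s) a (u : U a s) : xiFI x a u = pull bijm (cof x) u.
Proof. by case: s x u => [[]|]. Qed.

Lemma injm_deg_cof s (x : 'I_s) : injm_deg 1 (cof x).
Proof.
apply/andP; split; first exact/injectiveP/cof_inj.
by apply/eqP; exact: pred_cof1.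
Qed.

Lemma bij_cof_factor a s (x : 'I_s) (p : {ffun 'I_a -> 'I_s.-1}) :
  injm_deg 1 (fcomp (cof x) p) -> bijm p.
Proof. by move=> h; apply: (bij_factor (@cof_inj _ x) (pred_cof1 x) h). Qed.

Lemma eFI_K a s (u : U a s) : u = \sum_(x < s) ract (eFI x) (xiFI x a u).
Proof.
move: u; apply: kmap_eq => [//||f Pf].
  apply: linear_bigsum => x.
  exact: linear_compose (rfun_linear (xiFI x) (a := a)) (ract_linr _).
have [x [p [fE xP]]] := corank1_factor (injm_deg_corank Pf).
rewrite (sum_supp1 (x := x)) => [|z nzx]; last first.
  rewrite xiFI_E pullE // big_nofactor => [|q /xP zx]; last by rewrite zx eqxx in nzx.
  exact: linf0 (ract_linr _).
rewrite xiFI_E pullE // fE big_factor; last exact: cof_inj.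
apply/esym/kcompE; first exact: injm_deg_cof.
by apply: (@bij_cof_factor _ _ x); rewrite -fE.
Qed.

(** Division by a two-point coface. It becomes the functional theta on [kFI^[2]] that witnesses the
    relation [kFI_rel]. *)
Definition cof2_dual_fun s (x : 'I_s) (y : 'I_s.-1) a (u : kFI_deg k 2 a s) :
  kFB k a s.-1.-1 := pull bijm (fcomp (cof x) (cof y)) u.

Lemma cof2_inj s (x : 'I_s) (y : 'I_s.-1) : injective (fcomp (cof x) (cof y)).
Proof. by move=> i j; rewrite !ffunE => /lift_inj/lift_inj. Qed.

Lemma cof2_dual_ract s (x : 'I_s) (y : 'I_s.-1) a b (u : kFI_deg k 2 b s)
    (g : kFB k a b) :
  cof2_dual_fun x y (ract u g) = lcomp (cof2_dual_fun x y u) g.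
Proof.
apply: pull_kcomp.
- exact: cof2_inj.
- exact: injm_deg_bij.
- exact: bijm_closed.
- by move=> ? ? ? /andP[].
- by move=> c p h; apply: (bij_factor (@cof2_inj _ x y) (pred_cof2 y) h).
Qed.

Definition cof2_dual s (x : 'I_s) (y : 'I_s.-1) :
    right_dual (kFI_deg k 2) s s.-1.-1 :=
  @RHom _ (kFB k) (kFI_deg k 2) (regular (kFB k)) s s.-1.-1 (@cof2_dual_fun s x y)
    (fun a => @pull_linear k _ _ a _ _ _) (@cof2_dual_ract s x y).

Lemma xiFI_lact s (x : 'I_s) (y : 'I_s.-1) a b (f : {ffun 'I_b -> 'I_s})
    (g : {ffun 'I_a -> 'I_b}) : injm_deg 1 f -> injm_deg 1 g ->
  xiFI y a (lact (xiFI x b (kbasis k (injm_deg 1) f) : kFB k b s.-1)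
    (kbasis k (injm_deg 1) g : U a b)) =
  \sum_(p | fcomp (cof x) p == f) \sum_(q | fcomp (cof y) q == fcomp p g)
    kbasis k bijm q :> kFB k a s.-1.-1.
Proof.
move=> Pf Pg; rewrite (xiFI_E x) pullE // (linf_sum (lact_linl _)).
rewrite (linf_sum (rfun_linear (xiFI y) (a := a))); apply: eq_bigr => p /eqP pE.
have bp : bijm p by apply: (@bij_cof_factor _ _ x); rewrite pE.
have -> : lact (kbasis k bijm p : kFB k b s.-1) (kbasis k (injm_deg 1) g : U a b) =
  kbasis k (injm_deg 1) (fcomp p g) by exact: kcompE.
by rewrite xiFI_E pullE //; exact: bij_injm_deg.
Qed.

(** On a pair [f], [g], each term divides first by one coface and then by the other. Only the order
    starting with the point missed by [f] can contribute, and its result is the quotient of [f g] by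
    the two-point coface. *)
Lemma kFI_rel n r s (x : 'I_s) (y : 'I_s.-1) (v : Q n r s) :
  wmul (xiFI y) (wmul (xiFI x) v) +
  wmul (xiFI (swap_snd x y)) (wmul (xiFI (lift x y)) v) = 0.
Proof.
apply: (wmul_relation (theta := cof2_dual x y)) => a b u u'.
move: u; apply: kmap_eq => [||f Pf].
- exact: linear_fadd (@rhom_pairing_linl k _ U s _ _ _ _ a b u')
    (@rhom_pairing_linl k _ U s _ _ _ _ a b u').
- exact: linear_compose (kcomp_linl _ _) (rfun_linear (cof2_dual x y) (a := a)).
move: u'; apply: kmap_eq => [||g Pg].
- exact: linear_fadd (@rhom_pairing_linr k _ U s _ _ _ _ a b _)
    (@rhom_pairing_linr k _ U s _ _ _ _ a b _).
- exact: linear_compose (kcomp_linr _ _) (rfun_linear (cof2_dual x y) (a := a)).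
rewrite !xiFI_lact // swap_factor_sum; first last.
- by rewrite (injm_deg_corank Pg).
- exact: injm_deg_corank Pf.
have -> : kFI_mul (kbasis k (injm_deg 1) f) (kbasis k (injm_deg 1) g) =
  kbasis k (injm_deg 2) (fcomp f g) by exact: kcompE.
by apply/esym/pullE; exact: (@injm_deg_closed 1 1).
Qed.

Lemma kFI_mul_swap s (x : 'I_s) (y : 'I_s.-1) :
  kFI_mul (eFI x) (eFI y) = kFI_mul (eFI (lift x y)) (eFI (swap_snd x y)).
Proof.
rewrite /kFI_mul !kcompE; try exact: injm_deg_cof.
by rewrite cof_swap.
Qed.

End InjectiveMaps.

(** * The associated graded of [kFA] *)

Section AssociatedGraded.
Variable k : fieldType.
Local Notation C := (kFS k).
Local Notation U := (gr_kFA k 1).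
Local Notation D := (gr_kFA_dual k).

Lemma gr_pi_linear n a b : linear (@gr_pi k n a b).
Proof. exact: lpi_linear. Qed.

Lemma gr_pi_lower n a b (f : {ffun 'I_a -> 'I_b}) : (corank f < n)%N ->
  gr_pi (kbasis k (corank_le n) f : kFA_fil k n a b) = 0.
Proof. by move=> fn; apply: lpi_gen; exists f. Qed.

(** Maps of corank below [n] vanish in [G_n / G_(n-1)], so testing corank exactly [n] suffices. *)
Lemma gr_eq n a b (V : lmodType k) (p q : gr_kFA k n a b -> V) :
  linear p -> linear q ->
  (forall f, corank f = n -> p (gr_pi (kbasis k (corank_le n) f)) =
                             q (gr_pi (kbasis k (corank_le n) f))) -> p =1 q.
Proof.
move=> pL qL pq; elim/lq_ind; apply: kmap_eq => [||f].
- exact: linear_compose (@gr_pi_linear n a b) pL.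
- exact: linear_compose (@gr_pi_linear n a b) qL.
rewrite /corank_le leq_eqVlt => /orP[/eqP|] fn; first exact: pq.
by rewrite -/(gr_pi _) gr_pi_lower // (linf0 pL) (linf0 qL).
Qed.

Lemma gr_lactE n a b c (g : {ffun 'I_b -> 'I_c}) (f : {ffun 'I_a -> 'I_b}) :
  surjm g -> corank_le n f ->
  lact (kbasis k surjm g : C b c)
    (gr_pi (kbasis k (corank_le n) f) : gr_kFA k n a b) =
  gr_pi (kbasis k (corank_le n) (fcomp g f) : kFA_fil k n a c).
Proof.
move=> gs fn; apply: etrans (qb_lactE (@fil_lower_lact k n) _ _) _.
by congr (gr_pi _); exact: kcompE.
Qed.

Lemma gr_ractE n a b c (g : {ffun 'I_b -> 'I_c}) (f : {ffun 'I_a -> 'I_b}) :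
  corank_le n g -> surjm f ->
  ract (gr_pi (kbasis k (corank_le n) g) : gr_kFA k n b c) (kbasis k surjm f : C a b) =
  gr_pi (kbasis k (corank_le n) (fcomp g f) : kFA_fil k n a c).
Proof.
move=> gn fs; apply: etrans (qb_ractE (@fil_lower_ract k n) _ _) _.
by congr (gr_pi _); exact: kcompE.
Qed.

Section GrDual.
Variables (d r s : nat) (i : {ffun 'I_r -> 'I_s}).
Hypotheses (ii : injective i) (sE : s = (d + r)%N).

Definition gr_dual_fun a (u : gr_kFA k d a s) : C a r :=
  lq_lift (fun v : kFA_fil k d a s => pull surjm i v : C a r) u.

(** Everything that factors through [i] has corank at least [d], so division by [i] kills lower
    filtration and descends to the graded piece. *)
Lemma pull_lower a (v : kFA_fil k d a s) :
  fil_lower v -> (pull surjm i v : C a r) = 0.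
Proof.
case=> f fd ->; rewrite pullE; last exact: ltnW.
apply: big_nofactor => q qE; move: fd.
by rewrite -qE (corank_inj_comp _ ii sE); lia.
Qed.

Lemma gr_dual_funE a (v : kFA_fil k d a s) :
  gr_dual_fun (gr_pi v) = pull surjm i v.
Proof. by apply: lq_liftE => [|u]; [exact: pull_linear|exact: pull_lower]. Qed.

Lemma gr_dual_linear a : linear (@gr_dual_fun a).
Proof.
move=> x; elim/lq_ind=> u; elim/lq_ind=> v.
rewrite -!/(gr_pi _) -gr_pi_linear !gr_dual_funE; exact: pull_linear.
Qed.

Lemma gr_dual_ract a b (u : gr_kFA k d b s) (g : C a b) :
  gr_dual_fun (ract u g) = lcomp (gr_dual_fun u) g.
Proof.
move: u; elim/lq_ind => u.
apply: etrans (congr1 _ (qb_ractE (@fil_lower_ract k d) _ _)) _.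
rewrite -!/(gr_pi _) !gr_dual_funE; apply: pull_kcomp => //.
- exact: corank_le_surj.
- exact: surjm_closed.
- by move=> c p h; exact: (surj_factor ii sE h).
Qed.

Definition gr_dual : right_dual (gr_kFA k d) s r :=
  @RHom _ C (gr_kFA k d) (regular C) s r gr_dual_fun gr_dual_linear gr_dual_ract.

Lemma gr_dualE a (f : {ffun 'I_a -> 'I_s}) : corank_le d f ->
  gr_dual a (gr_pi (kbasis k (corank_le d) f)) =
  \sum_(p | fcomp i p == f) kbasis k surjm p.
Proof. by move=> fd; rewrite [LHS]gr_dual_funE pullE. Qed.
End GrDual.

Definition eGr s (x : 'I_s) : U s.-1 s := gr_pi (kbasis k (corank_le 1) (cof x)).

Definition xiGr s (x : 'I_s) : right_dual U s s.-1 :=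
  gr_dual (@cof_inj s x) (pred_cof1 x).

Lemma corank_cof s (x : 'I_s) : corank (cof x) = 1%N.
Proof. exact/injm_deg_corank/injm_deg_cof. Qed.

Lemma surj_cof_factor a s (x : 'I_s) (p : {ffun 'I_a -> 'I_s.-1}) :
  corank_le 1 (fcomp (cof x) p) -> surjm p.
Proof. by move=> h; apply: (surj_factor (@cof_inj _ x) (pred_cof1 x) h). Qed.

Lemma eGr_K a s (u : U a s) : u = \sum_(x < s) ract (eGr x) (xiGr x a u).
Proof.
move: u; apply: gr_eq => [//||f f1].
  apply: linear_bigsum => x.
  exact: linear_compose (rfun_linear (xiGr x) (a := a)) (ract_linr _).
have Pf : corank_le 1 f by rewrite /corank_le f1.
have [x [p [fE xP]]] := corank1_factor f1.
rewrite (sum_supp1 (x := x)) => [|z nzx]; last first.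
  rewrite gr_dualE // big_nofactor => [|q /xP zx]; last by rewrite zx eqxx in nzx.
  exact: linf0 (ract_linr _).
rewrite gr_dualE // fE big_factor; last exact: cof_inj.
apply/esym/gr_ractE; first by rewrite /corank_le corank_cof.
by apply: (@surj_cof_factor _ _ x); rewrite -fE.
Qed.

Lemma xiGr_lact s (x : 'I_s) (y : 'I_s.-1) a b (f : {ffun 'I_b -> 'I_s})
    (g : {ffun 'I_a -> 'I_b}) : corank_le 1 f -> corank_le 1 g ->
  xiGr y a (lact (xiGr x b (gr_pi (kbasis k (corank_le 1) f)) : C b s.-1)
    (gr_pi (kbasis k (corank_le 1) g) : U a b)) =
  \sum_(p | fcomp (cof x) p == f) \sum_(q | fcomp (cof y) q == fcomp p g)
    kbasis k surjm q :> C a s.-1.-1.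
Proof.
move=> Pf Pg; rewrite (gr_dualE _ _ Pf) (linf_sum (lact_linl _)).
rewrite (linf_sum (rfun_linear (xiGr y) (a := a))); apply: eq_bigr => p /eqP pE.
have sp : surjm p by apply: (@surj_cof_factor _ _ x); rewrite pE.
by rewrite gr_lactE // gr_dualE //; exact: surj_corank_le.
Qed.

(** The combinatorics of [kFI_rel] applies, but [f] and [g] need not be injective. Their composite
    may have corank 1 and die in degree 2; this is consistent, as it is then not divisible by the
    two-point coface. *)
Lemma gr_rel n r s (x : 'I_s) (y : 'I_s.-1) (v : D n r s) :
  wmul (xiGr y) (wmul (xiGr x) v) +
  wmul (xiGr (swap_snd x y)) (wmul (xiGr (lift x y)) v) = 0.
Proof.
pose theta := gr_dual (@cof2_inj _ x y) (pred_cof2 y).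
apply: (wmul_relation (theta := theta)) => a b u u'.
have pL p q t : linear (@gr_pi k p q t) by exact: gr_pi_linear.
have ml (v' : U a b) : linear (fun u' : U b s => gr_mul u' v').
  move=> c; elim/lq_ind => w; elim/lq_ind => w'; move: v'; elim/lq_ind => v'.
  by rewrite -!/(gr_pi _) -pL !gr_mulE kcomp_linl pL.
have mr (v' : U b s) : linear (fun u' : U a b => gr_mul v' u').
  move=> c; elim/lq_ind => w; elim/lq_ind => w'; move: v'; elim/lq_ind => v'.
  by rewrite -!/(gr_pi _) -pL !gr_mulE kcomp_linr pL.
move: u; apply: gr_eq => [||f f1].
- exact: linear_fadd (@rhom_pairing_linl k _ U s _ _ _ _ a b u')
    (@rhom_pairing_linl k _ U s _ _ _ _ a b u').
- exact: linear_compose (ml _) (rfun_linear theta (a := a)).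
move: u'; apply: gr_eq => [||g g1].
- exact: linear_fadd (@rhom_pairing_linr k _ U s _ _ _ _ a b _)
    (@rhom_pairing_linr k _ U s _ _ _ _ a b _).
- exact: linear_compose (mr _) (rfun_linear theta (a := a)).
have Pf : corank_le 1 f by rewrite /corank_le f1.
have Pg : corank_le 1 g by rewrite /corank_le g1.
rewrite !xiGr_lact // swap_factor_sum //.
rewrite gr_mulE kcompE // gr_dualE //; exact: (@corank_le_closed 1 1).
Qed.

Lemma gr_mul_swap s (x : 'I_s) (y : 'I_s.-1) :
  gr_mul (eGr x) (eGr y) = gr_mul (eGr (lift x y)) (eGr (swap_snd x y)).
Proof.
have E (u : 'I_s) (v : 'I_s.-1) : gr_mul (eGr u) (eGr v) =
    gr_pi (kbasis k (corank_le 2) (fcomp (cof u) (cof v))).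
  apply: etrans (gr_mulE _ _) _; congr (gr_pi _).
  by apply: kcompE; rewrite /corank_le corank_cof.
by rewrite (E x y) (E (lift x y)) cof_swap.
Qed.

Lemma kFI_gr_linear a b : linear (@kFI_gr k a b).
Proof. exact: linear_compose (@kchange_linear _ _ _ _ _) (@gr_pi_linear 1 a b). Qed.

Lemma kFI_grE a b (f : {ffun 'I_a -> 'I_b}) : injm_deg 1 f ->
  kFI_gr (kbasis k (injm_deg 1) f) = gr_pi (kbasis k (corank_le 1) f).
Proof. by move=> Pf; rewrite /kFI_gr kchangeE. Qed.

Lemma kFI_gr_eFI s (x : 'I_s) : kFI_gr (eFI k x) = eGr x.
Proof. exact/kFI_grE/injm_deg_cof. Qed.

Lemma injm_deg_corank_le d a b (f : {ffun 'I_a -> 'I_b}) :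
  injm_deg d f -> corank_le d f.
Proof. by move=> Pf; rewrite /corank_le (injm_deg_corank Pf). Qed.

Lemma kFB_kFS_linear a b : linear (@kFB_kFS k a b).
Proof. exact: kchange_linear. Qed.

Lemma kFB_kFSE a b (f : {ffun 'I_a -> 'I_b}) : bijm f ->
  kFB_kFS (kbasis k bijm f) = kbasis k surjm f.
Proof. exact: kchangeE. Qed.

Lemma bijm_surjm a b (f : {ffun 'I_a -> 'I_b}) : bijm f -> surjm f.
Proof. by case/andP. Qed.

Lemma xiGr_kFI_gr s (x : 'I_s) a (u : kFI_deg k 1 a s) :
  xiGr x a (kFI_gr u) = kFB_kFS (xiFI k x a u).
Proof.
move: u; apply: kmap_eq => [||f Pf].
- exact: linear_compose (@kFI_gr_linear a s) (rfun_linear (xiGr x) (a := a)).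
- exact: linear_compose (rfun_linear (xiFI k x) (a := a)) (@kFB_kFS_linear a s.-1).
rewrite kFI_grE // gr_dualE; last exact: injm_deg_corank_le.
rewrite xiFI_E pullE // (linf_sum (@kFB_kFS_linear a s.-1)).
apply: eq_bigr => p /eqP pE; rewrite kFB_kFSE //.
by apply: (@bij_cof_factor _ _ x); rewrite pE.
Qed.

Lemma kFB_kFS_comp a b c (g : kFB k b c) (f : kFB k a b) :
  kFB_kFS (lcomp g f) = lcomp (kFB_kFS g) (kFB_kFS f).
Proof.
move: g; apply: kmap_eq => [||g Pg].
- exact: linear_compose (lcomp_linl _) (@kFB_kFS_linear a c).
- exact: linear_compose (@kFB_kFS_linear b c) (lcomp_linl _).
move: f; apply: kmap_eq => [||f Pf].
- exact: linear_compose (lcomp_linr _) (@kFB_kFS_linear a c).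
- exact: linear_compose (@kFB_kFS_linear a b) (lcomp_linr _).
rewrite !kFB_kFSE // [lcomp _ _]kcompE // kFB_kFSE; last exact: bijm_closed.
by apply/esym/kcompE; exact: bijm_surjm.
Qed.

Lemma kFB_kFS_id a : kFB_kFS (lid (kFB k) a) = lid C a.
Proof. by rewrite [LHS]kFB_kFSE //; exact: bijm_id. Qed.

Lemma kFI_gr_lact a b c (g : kFB k b c) (u : kFI_deg k 1 a b) :
  kFI_gr (lact g u) = lact (kFB_kFS g) (kFI_gr u).
Proof.
move: g; apply: kmap_eq => [||g Pg].
- exact: linear_compose (lact_linl _) (@kFI_gr_linear a c).
- exact: linear_compose (@kFB_kFS_linear b c) (lact_linl _).
move: u; apply: kmap_eq => [||f Pf].
- exact: linear_compose (lact_linr _) (@kFI_gr_linear a c).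
- exact: linear_compose (@kFI_gr_linear a b) (lact_linr _).
rewrite kFI_grE // kFB_kFSE // gr_lactE; first last.
- exact: injm_deg_corank_le.
- exact: bijm_surjm.
by rewrite [lact _ _]kcompE // kFI_grE //; exact: bij_injm_deg.
Qed.

Lemma kFI_gr_ract a b c (u : kFI_deg k 1 b c) (g : kFB k a b) :
  kFI_gr (ract u g) = ract (kFI_gr u) (kFB_kFS g).
Proof.
move: g; apply: kmap_eq => [||g Pg].
- exact: linear_compose (ract_linr _) (@kFI_gr_linear a c).
- exact: linear_compose (@kFB_kFS_linear a b) (ract_linr _).
move: u; apply: kmap_eq => [||f Pf].
- exact: linear_compose (ract_linl _) (@kFI_gr_linear a c).
- exact: linear_compose (@kFI_gr_linear b c) (ract_linl _).
rewrite kFI_grE // kFB_kFSE // gr_ractE; first last.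
- exact: bijm_surjm.
- exact: injm_deg_corank_le.
by rewrite [ract _ _]kcompE // kFI_grE //; exact: injm_deg_bij.
Qed.

(** Turns the [kFB]-action on [kFS] into composition in [kFS], which can then be moved onto elements
    of the dual by [lactA]. *)
Lemma kFS_FB_lact a b c (g : kFB k b c) (p : kFS_FB k a b) :
  lact g p = lcomp (kFB_kFS g) (p : C a b) :> C a c.
Proof.
move: g; apply: kmap_eq => [||g Pg].
- exact: kcomp_linl.
- exact: linear_compose (@kFB_kFS_linear b c) (lcomp_linl _).
move: p; apply: kmap_eq => [||p Pp].
- exact: kcomp_linr.
- exact: (@lcomp_linr _ C).
rewrite kFB_kFSE // [LHS]kcompE //; apply/esym/kcompE => //; exact: bijm_surjm.
Qed.

Lemma kFS_FB_ract a b c (p : kFS_FB k b c) (g : kFB k a b) :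
  ract p g = lcomp (p : C b c) (kFB_kFS g) :> C a c.
Proof.
move: g; apply: kmap_eq => [||g Pg].
- exact: kcomp_linr.
- exact: linear_compose (@kFB_kFS_linear a b) (lcomp_linr _).
move: p; apply: kmap_eq => [||p Pp].
- exact: kcomp_linl.
- exact: (@lcomp_linl _ C).
rewrite (kFB_kFSE Pg); apply: etrans (kcompE k surjm Pp Pg) _.
exact: esym (kcompE k surjm Pp (bijm_surjm Pg)).
Qed.

End AssociatedGraded.

(** * The morphism J from [kFI^perp] to the dual *)

Section DualInclusion.
Variables (k : fieldType) (char0 : [pchar k] =i pred0).
Local Notation FB := (kFB k).
Local Notation FS := (kFS k).
Local Notation UI := (kFI_deg k 1).
Local Notation UG := (gr_kFA k 1).
Local Notation WI := (right_dual UI).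
Local Notation WG := (right_dual UG).
Local Notation I := (kFI_dual k).
Local Notation D := (gr_kFA_dual k).


(** The map [Hom(kFI^[1], kFB) -> Hom(kFI^[1], kFS) = U^*] in coordinates for the basis [xi_x].
    [dual_ext_kFI_gr] and [gr_rhomP] characterize it without coordinates. *)
Definition dual_ext s t (p : WI s t) : WG s t :=
  \sum_(x < s) lact (kFB_kFS (p s.-1 (eFI k x)) : FS s.-1 t) (xiGr k x).

Lemma dual_ext_kFI_gr s t (p : WI s t) a (u : UI a s) :
  dual_ext p a (kFI_gr u) = kFB_kFS (p a u).
Proof.
rewrite rhom_sumE (rfun_expand (@eFI_K k) p) (linf_sum (@kFB_kFS_linear k a t)).
by apply: eq_bigr => x _; rewrite kFB_kFS_comp -xiGr_kFI_gr.
Qed.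

(** The basis [eGr] comes from [kFI^[1]], so an element of [U^*] is known from its restriction
    there. Most identities between elements of [U^*] are checked through this. *)
Lemma gr_rhomP s t (p q : WG s t) :
  (forall a (u : UI a s), p a (kFI_gr u) = q a (kFI_gr u)) -> p = q.
Proof.
by move=> pq; apply: (rhom_basisP (@eGr_K k)) => x; rewrite -kFI_gr_eFI pq.
Qed.

Lemma dual_ext_linear s t : linear (@dual_ext s t).
Proof.
move=> c p q; apply: gr_rhomP => a u.
rewrite (dual_ext_kFI_gr (c *: p + q)).
apply: etrans (@kFB_kFS_linear k _ _ c (p a u) (q a u)) _.
by rewrite -(dual_ext_kFI_gr p) -(dual_ext_kFI_gr q).
Qed.

Lemma dual_ext_lact s t t' (g : FB t t') (p : WI s t) :
  dual_ext (lact g p) = lact (kFB_kFS g) (dual_ext p).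
Proof.
apply: gr_rhomP => a u; rewrite (right_dual_lactE _ (dual_ext p)).
rewrite (dual_ext_kFI_gr p) (dual_ext_kFI_gr (lact g p)).
exact: kFB_kFS_comp.
Qed.

Lemma dual_ext_ract s s' t (p : WI s t) (g : FB s' s) :
  dual_ext (ract p g) = ract (dual_ext p) (kFB_kFS g).
Proof.
apply: gr_rhomP => a u; rewrite (right_dual_ractE (dual_ext p)) -kFI_gr_lact.
by rewrite (dual_ext_kFI_gr p) (dual_ext_kFI_gr (ract p g)).
Qed.

Lemma dual_ext_xiFI s (x : 'I_s) : dual_ext (xiFI k x) = xiGr k x.
Proof. by apply: gr_rhomP => a u; rewrite dual_ext_kFI_gr xiGr_kFI_gr. Qed.

Lemma dual_extE s t (p : WI s t) : dual_ext p =
  \sum_(x < s) lact (kFB_kFS (p s.-1 (eFI k x)) : FS s.-1 t) (xiGr k x).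
Proof. by []. Qed.

Opaque dual_ext xiGr kFI_gr kFB_kFS.

Section Inclusion.
Variable s : nat.

(** Expanded in the dual basis, the action of [z] has coefficient [z(e_x, e_y)] at [xi_y xi_x]. For
    a relation this is [theta(e_x e_y)], which is symmetric under the exchange. *)
Lemma inclusion_rel e t (z : tens WI WI e t) (theta : right_dual (kFI_deg k 2) e t) :
  (forall a b (u : UI b e) (u' : UI a b),
    dual_pairing z u u' = theta a (kFI_mul u u')) ->
  forall n (v : D n s e),
  tlift (fun r (p : WI r t) (q : WI e r) =>
    wmul (dual_ext p) (wmul (dual_ext q) v)) z = 0.
Proof.
move=> h n v.
have fl r (q : WI e r) :
    linear (fun p : WI r t => wmul (dual_ext p) (wmul (dual_ext q) v)).
  exact: linear_compose (@dual_ext_linear r t) (wmul_linl _).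
have fr r (p : WI r t) :
    linear (fun q : WI e r => wmul (dual_ext p) (wmul (dual_ext q) v)).
  exact: linear_compose (@dual_ext_linear e r)
    (linear_compose (wmul_linl v) (wmul_linr (dual_ext p))).
have fb r r' (p : WI r' t) (c : FB r r') (q : WI e r) :
    wmul (dual_ext (ract p c)) (wmul (dual_ext q) v) =
    wmul (dual_ext p) (wmul (dual_ext (lact c q)) v).
  by rewrite dual_ext_ract dual_ext_lact wmul_lact wmul_bal.
pose f (x : 'I_e) (y : 'I_e.-1) : FS e.-1.-1 t :=
  kFB_kFS (theta _ (kFI_mul (eFI k x) (eFI k y))).
transitivity (\sum_x \sum_y lact (f x y) (wmul (xiGr k y) (wmul (xiGr k x) v))); last first.
  apply: (sum_swap_lact char0 (@gr_rel k)) => x y.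
  by rewrite /f kFI_mul_swap.
transitivity (\sum_x \sum_y lact (kFB_kFS (dual_pairing z (eFI k x) (eFI k y)) : FS e.-1.-1 t)
    (wmul (xiGr k y) (wmul (xiGr k x) v))); last first.
  by apply: eq_bigr => x _; apply: eq_bigr => y _; rewrite h.
move: {h} z; apply: tens_eq => [||r p q].
- exact: tlift_linear.
- apply: linear_bigsum => x; apply: linear_bigsum => y.
  exact: linear_compose (dual_pairing_linear (eFI k x) (eFI k y))
    (linear_compose (@kFB_kFS_linear k _ _) (lact_linl _)).
(* Expand [q] over [x], move its coefficient [q(e_x)] to the left into [p], and only then expand
   over [y]: this produces [p(q(e_x) e_y)], the pairing. *)
rewrite tliftE // (dual_extE q) (linf_sum (wmul_linl v)) (linf_sum (wmul_linr _)).
apply: eq_bigr => x _; rewrite wmul_lact -wmul_bal -dual_ext_ract.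
rewrite (dual_extE (ract p _)) (linf_sum (wmul_linl _)); apply: eq_bigr => y _.
by rewrite wmul_lact dual_pairingE.
Qed.

(** Restriction of scalars of the dual along [kFB_kFS] and [dual_ext]; J is the orbit map of an
    identity. *)
Definition inclusion_module : rqd_module (@kFI_mul k 1 1).
Proof.
refine (@RqdModule k FB UI (kFI_deg k 2) (@kFI_mul k 1 1) (fun n t => D n s t)
  (fun n a b (g : FB a b) v => lact (kFB_kFS g) v)
  (fun n a b (p : WI a b) v => wmul (dual_ext p) v) _ _ _ _ _ _ _ _).
- by move=> n a b c; exact: lact_linr.
- by move=> n a b c g f v; rewrite kFB_kFS_comp lactA.
- move=> n a b v; exact: linear_compose (@kFB_kFS_linear k a b) (lact_linl v).
- move=> n a b v; exact: linear_compose (@dual_ext_linear a b) (wmul_linl v).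
- by move=> n a b w; exact: wmul_linr.
- by move=> n a b c w f v; rewrite dual_ext_ract wmul_bal.
- by move=> n a b c g w v; rewrite dual_ext_lact wmul_lact.
- by move=> e t z theta h n v; exact: inclusion_rel h n v.
Defined.

Definition inclusion n t (y : I n s t) : D n s t :=
  @rqd_lift _ _ _ _ _ inclusion_module s (rqd_deg0 (@gr_mul k 1 1) (lid FS s)) n t y.

Lemma inclusion_linear n t : linear (@inclusion n t).
Proof. exact: (@rqd_lift_linear _ _ _ _ _ inclusion_module). Qed.

Lemma inclusion_deg0 t (g : FB s t) :
  inclusion (rqd_deg0 (@kFI_mul k 1 1) g) = rqd_deg0 (@gr_mul k 1 1) (kFB_kFS g).
Proof.
apply: etrans (@rqd_lift_deg0 _ _ _ _ _ inclusion_module _ _ _ _) _.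
by apply: etrans (lact_deg0 _ _ _) _; rewrite lcomp1r.
Qed.

Lemma inclusion_wmul n r t (p : WI r t) (y : I n s r) :
  inclusion (wmul p y) = wmul (dual_ext p) (inclusion y).
Proof. exact: (@rqd_lift_wmul _ _ _ _ _ inclusion_module). Qed.

Lemma inclusion_lact n r t (g : FB r t) (y : I n s r) :
  inclusion (lact g y) = lact (kFB_kFS g) (inclusion y).
Proof. exact: (@rqd_lift_lact _ _ _ _ _ inclusion_module). Qed.

End Inclusion.

End DualInclusion.

(** * The action of the dual on the Koszul complex *)

Section KoszulMap.
Variables (k : fieldType) (M : bimod (kFB k)).
Local Notation UI := (kFI_deg k 1).
Local Notation I := (kFI_dual k).

(* For h = m . (-) this is the Koszul differential of m (x) y; for
   h = w (c o (-)) it is the action of w in U^* on c (x) y. *)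
Definition koszul_map r t n s (h : rhom_bimod UI M r t) (y : I n s r) :
    tens M (I n.+1) s t :=
  \sum_(x < r) telt (h r.-1 (eFI k x)) (wmul (xiFI k x) y).

Lemma koszul_map_linl r t n s (y : I n s r) :
  linear (fun h : rhom_bimod UI M r t => koszul_map h y).
Proof. by apply: linear_bigsum => x c h h'; rewrite -telt_linl. Qed.

Lemma koszul_map_linr r t n s (h : rhom_bimod UI M r t) :
  linear (fun y : I n s r => koszul_map h y).
Proof.
apply: linear_bigsum => x; exact: linear_compose (wmul_linr _) (telt_linr _).
Qed.

Lemma rhom_ractE r r' t (h : rhom_bimod UI M r t) (g : kFB k r' r) a (u : UI a r') :
  rfun (ract h g : rhom_bimod UI M r' t) u = h a (lact g u).
Proof. by []. Qed.

(** The canonical element [sum_x e_x ⊗ xi_x] commutes with [kFB]: expand [g e_x] in the basis [e_q],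
    exchange the sums, and the coefficients [xi_q(g e_x)] reassemble to [xi_q g]. *)
Lemma koszul_map_bal r r' t n s (h : rhom_bimod UI M r t) (g : kFB k r' r)
    (y : I n s r') : koszul_map (ract h g) y = koszul_map h (lact g y).
Proof.
pose w (x : 'I_r) := ract (xiFI k x) g : right_dual UI r' r.-1.
transitivity (\sum_(x < r') \sum_(q < r) telt (h r.-1 (eFI k q))
    (lact (w q r'.-1 (eFI k x) : kFB k r'.-1 r.-1) (wmul (xiFI k x) y))
  : tens M (I n.+1) s t).
  apply: eq_bigr => x _; rewrite (rhom_ractE h) {1}(eFI_K (lact g (eFI k x))).
  rewrite (linf_sum (rfun_linear h (a := r'.-1))) (linf_sum (telt_linl _)).
  by apply: eq_bigr => q _; rewrite rfun_ract telt_bal.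
rewrite exchange_big; apply: eq_bigr => q _; rewrite -wmul_bal.
by rewrite -(linf_sum (telt_linr _)) -(wmul_expand (@eFI_K k) (w q)).
Qed.

End KoszulMap.

(** * The action of the dual on [kFS ⊗ kFI^perp] *)

Section Koszul.
Variables (k : fieldType) (char0 : [pchar k] =i pred0).
Local Notation FB := (kFB k).
Local Notation FS := (kFS k).
Local Notation UI := (kFI_deg k 1).
Local Notation UG := (gr_kFA k 1).
Local Notation WG := (right_dual UG).
Local Notation I := (kFI_dual k).
Local Notation M := (kFS_FB k).
Local Notation E n := (tens M (I n)).

Definition gr_hom_fun r t t' (w : WG t t') (c : M r t) a (u : UI a r) : M a t' :=
  w a (lact (c : FS r t) (kFI_gr u)).

Lemma gr_hom_fun_linear r t t' (w : WG t t') (c : M r t) a :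
  linear (@gr_hom_fun r t t' w c a).
Proof.
exact: linear_compose (linear_compose (@kFI_gr_linear k a r) (lact_linr _))
  (rfun_linear w (a := a)).
Qed.

Lemma gr_hom_fun_ract r t t' (w : WG t t') (c : M r t) a b (u : UI b r)
    (g : FB a b) :
  gr_hom_fun w c (ract u g) = ract (gr_hom_fun w c u) g.
Proof.
rewrite /gr_hom_fun kFI_gr_ract -lractA rfun_ract.
exact: (esym (kFS_FB_ract _ g)).
Qed.

Definition gr_hom r t t' (w : WG t t') (c : M r t) : rhom_bimod UI M r t' :=
  @RHom _ FB UI M r t' (@gr_hom_fun r t t' w c) (@gr_hom_fun_linear r t t' w c)
    (@gr_hom_fun_ract r t t' w c).

Lemma gr_homE r t t' (w : WG t t') (c : M r t) a (u : UI a r) :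
  gr_hom w c a u = w a (lact (c : FS r t) (kFI_gr u)).
Proof. by []. Qed.

Lemma gr_hom_linl r t t' (c : M r t) : linear (fun w : WG t t' => gr_hom w c).
Proof. by move=> x w w'; apply: rhomP => a u. Qed.

Lemma gr_hom_linr r t t' (w : WG t t') : linear (fun c : M r t => gr_hom w c).
Proof.
move=> x c c'; apply: rhomP => a u; apply: etrans (gr_homE w _ u) _.
by rewrite [lact _ _](@lact_linl _ FS UG) rfun_linear.
Qed.

Lemma gr_hom_ract r r' t t' (w : WG t t') (c : M r t) (g : FB r' r) :
  gr_hom w (ract c g) = ract (gr_hom w c) g.
Proof.
apply: rhomP => a u; rewrite (rhom_ractE (gr_hom w c)) !gr_homE.
by rewrite kFS_FB_ract kFI_gr_lact lactA.
Qed.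

Lemma gr_hom_bal r t t' t'' (w : WG t' t'') (g : FS t t') (c : M r t) :
  gr_hom (ract w g) c = gr_hom w (lcomp g (c : FS r t)).
Proof.
by apply: rhomP => a u; rewrite !gr_homE (right_dual_ractE w) lactA.
Qed.

Definition koszul_lact n s t t' (g : FS t t') (v : E n s t) : E n s t' :=
  tlift (fun r (c : M r t) (y : I n s r) =>
    telt (lcomp g (c : FS r t) : M r t') y) v.

Lemma FS_lact_linr r t t' (g : FS t t') :
  linear (fun c : M r t => (lcomp g (c : FS r t) : M r t')).
Proof. exact: (@lcomp_linr _ FS r t t' g). Qed.

Lemma FS_lact_linl r t t' (c : M r t) :
  linear (fun g : FS t t' => (lcomp g (c : FS r t) : M r t')).
Proof. exact: (@lcomp_linl _ FS r t t' c). Qed.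

Lemma FS_lact_ract r r' t t' (g : FS t t') (c : M r' t) (f : FB r r') :
  lcomp g (ract c f : FS r t) = ract (lcomp g (c : FS r' t) : M r' t') f :> M r t'.
Proof.
rewrite (kFS_FB_ract c f) lcompA.
exact: esym (kFS_FB_ract (lcomp g (c : FS r' t) : M r' t') f).
Qed.

Lemma koszul_lact_hyps n s t t' (g : FS t t') :
  [/\ forall r (y : I n s r), linear (fun c : M r t =>
        telt (lcomp g (c : FS r t) : M r t') y),
      forall r (c : M r t), linear (fun y : I n s r =>
        telt (lcomp g (c : FS r t) : M r t') y) &
      forall r r' (c : M r' t) (f : FB r r') (y : I n s r),
        telt (lcomp g (ract c f : FS r t) : M r t') y =
        telt (lcomp g (c : FS r' t) : M r' t') (lact f y)].
Proof.
split=> [r y|r c|r r' c f y].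
- exact: linear_compose (@FS_lact_linr r t t' g) (telt_linl y).
- exact: telt_linr.
- by rewrite FS_lact_ract telt_bal.
Qed.

Lemma koszul_lactE n s t t' (g : FS t t') r (c : M r t) (y : I n s r) :
  koszul_lact g (telt c y : E n s t) = telt (lcomp g (c : FS r t) : M r t') y.
Proof. by have [fl fr fb] := @koszul_lact_hyps n s t t' g; exact: (tliftE fl fr fb). Qed.

Lemma koszul_lact_linr n s t t' (g : FS t t') : linear (@koszul_lact n s t t' g).
Proof. by have [fl fr fb] := @koszul_lact_hyps n s t t' g; exact: (tlift_linear fl fr fb). Qed.

Lemma koszul_lact_linl n s t t' (v : E n s t) : linear (fun g : FS t t' => koszul_lact g v).
Proof.
move=> x g g'; move: v; apply: tens_eq => [||r c y]; first exact: koszul_lact_linr.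
  by apply: linear_comb; exact: koszul_lact_linr.
by rewrite !koszul_lactE -telt_linl -FS_lact_linl.
Qed.

Lemma koszul_lactA n s a b c (g : FS b c) (f : FS a b) (v : E n s a) :
  koszul_lact g (koszul_lact f v) = koszul_lact (lcomp g f) v.
Proof.
move: v; apply: tens_eq => [||r m y]; last by rewrite !koszul_lactE lcompA.
  exact: linear_compose (@koszul_lact_linr n s a b f) (@koszul_lact_linr n s b c g).
exact: koszul_lact_linr.
Qed.

Definition koszul_wact n s t t' (w : WG t t') (v : E n s t) : E n.+1 s t' :=
  tlift (fun r (c : M r t) (y : I n s r) => koszul_map (gr_hom w c) y) v.

Lemma koszul_wact_hyps n s t t' (w : WG t t') :
  [/\ forall r (y : I n s r), linear (fun c : M r t => koszul_map (gr_hom w c) y),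
      forall r (c : M r t), linear (fun y : I n s r => koszul_map (gr_hom w c) y) &
      forall r r' (c : M r' t) (f : FB r r') (y : I n s r),
        koszul_map (gr_hom w (ract c f)) y = koszul_map (gr_hom w c) (lact f y)].
Proof.
split=> [r y|r c|r r' c f y]; last by rewrite gr_hom_ract koszul_map_bal.
- exact: linear_compose (@gr_hom_linr r t t' w) (koszul_map_linl y).
- exact: koszul_map_linr.
Qed.

Lemma koszul_wactE n s t t' (w : WG t t') r (c : M r t) (y : I n s r) :
  koszul_wact w (telt c y : E n s t) = koszul_map (gr_hom w c) y.
Proof. by have [fl fr fb] := @koszul_wact_hyps n s t t' w; exact: (tliftE fl fr fb). Qed.

Lemma koszul_wact_linr n s t t' (w : WG t t') : linear (@koszul_wact n s t t' w).
Proof. by have [fl fr fb] := @koszul_wact_hyps n s t t' w; exact: (tlift_linear fl fr fb). Qed.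

Lemma koszul_wact_linl n s t t' (v : E n s t) : linear (fun w : WG t t' => koszul_wact w v).
Proof.
move=> x w w'; move: v; apply: tens_eq => [||r c y]; first exact: koszul_wact_linr.
  by apply: linear_comb; exact: koszul_wact_linr.
by rewrite !koszul_wactE -koszul_map_linl gr_hom_linl.
Qed.

Lemma koszul_wact_bal n s a b c (w : WG b c) (g : FS a b) (v : E n s a) :
  koszul_wact (ract w g) v = koszul_wact w (koszul_lact g v).
Proof.
move: v; apply: tens_eq => [||r m y]; first exact: koszul_wact_linr.
  exact: linear_compose (@koszul_lact_linr n s a b g) (@koszul_wact_linr n s b c w).
by rewrite koszul_lactE !koszul_wactE gr_hom_bal.
Qed.

Lemma koszul_wact_lact n s a b c (g : FS b c) (w : WG a b) (v : E n s a) :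
  koszul_wact (lact g w) v = koszul_lact g (koszul_wact w v).
Proof.
move: v; apply: tens_eq => [||r m y]; first exact: koszul_wact_linr.
  exact: linear_compose (@koszul_wact_linr n s a b w) (@koszul_lact_linr n.+1 s b c g).
rewrite !koszul_wactE (linf_sum (@koszul_lact_linr n.+1 s b c g)); apply: eq_bigr => x _.
by rewrite koszul_lactE !gr_homE (right_dual_lactE g w).
Qed.

Lemma gr_mul_lact m n a b c d (g : FS c d) (u : gr_kFA k m b c) (v : gr_kFA k n a b) :
  gr_mul (lact g u) v = lact g (gr_mul u v).
Proof.
move: u; elim/lq_ind => u; move: v; elim/lq_ind => v; rewrite -!/(gr_pi _).
have lE p r s t (h : FS s t) (z : kFA_fil k p r s) :
    lact h (gr_pi z : gr_kFA k p r s) = gr_pi (lact h z : kFA_fil k p r t).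
  exact: (qb_lactE (@fil_lower_lact k p)).
rewrite lE !gr_mulE lE; congr (gr_pi _); apply/esym.
by apply: (kcompA (P := surjm)); [exact: surj_corank_le|exact: corank_le_closed].
Qed.

(** On [c ⊗ y] the coefficient at [xi_q xi_x y] is [z(c e_x, e_q)]. For a relation it is
    [theta(c e_x e_q)], again symmetric, and now the anticommutation used is that of [kFI^perp]. *)
Lemma koszul_wact_rel s e t (z : tens WG WG e t) (theta : right_dual (gr_kFA k 2) e t) :
  (forall a b (u : UG b e) (u' : UG a b),
    dual_pairing z u u' = theta a (gr_mul u u')) ->
  forall n (v : E n s e),
  tlift (fun r (p : WG r t) (q : WG e r) => koszul_wact p (koszul_wact q v)) z = 0.
Proof.
move=> h n.
have fl (v : E n s e) r (q : WG e r) : linear (fun p : WG r t => koszul_wact p (koszul_wact q v)).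
  exact: koszul_wact_linl.
have fr (v : E n s e) r (p : WG r t) : linear (fun q : WG e r => koszul_wact p (koszul_wact q v)).
  exact: linear_compose (@koszul_wact_linl n s e r v) (@koszul_wact_linr n.+1 s r t p).
have fb (v : E n s e) r r' (p : WG r' t) (c : FS r r') (q : WG e r) :
    koszul_wact (ract p c) (koszul_wact q v) = koszul_wact p (koszul_wact (lact c q) v).
  by rewrite koszul_wact_bal koszul_wact_lact.
pose F v (z : tens WG WG e t) : E n.+2 s t :=
  tlift (fun r (p : WG r t) (q : WG e r) => koszul_wact p (koszul_wact q v)) z.
have FL v : linear (F v) by exact: (tlift_linear (fl v) (fr v) (fb v)).
have FE v r (p : WG r t) (q : WG e r) : F v (telt p q) = koszul_wact p (koszul_wact q v).
  exact: (tliftE (fl v) (fr v) (fb v)).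
(* Linearity in [v] permits the reduction to [v = c ⊗ y]; it is itself checked on elementary tensors
   in [z]. *)
have FLv (z' : tens WG WG e t) : linear (F^~ z').
  move=> x u u'; move: z'; apply: tens_eq => [||r p q]; first exact: FL.
    by apply: linear_comb; exact: FL.
  rewrite (FE u) (FE u') (FE (x *: u + u')).
  exact: (linear_compose (@koszul_wact_linr n s e r q) (@koszul_wact_linr n.+1 s r t p) x u u').
apply: tens_eq => [||r c y]; first exact: (FLv z).
  by move=> x u u'; rewrite scaler0 addr0.
rewrite -/(F (telt c y) z).
pose f (x : 'I_r) (y : 'I_r.-1) : M r.-1.-1 t :=
  theta _ (lact (c : FS r e) (gr_mul (eGr k x) (eGr k y))).
transitivity (\sum_x \sum_q telt (f x q) (wmul (xiFI k q) (wmul (xiFI k x) y))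
  : E n.+2 s t); last first.
  apply: (sum_swap_telt char0 (@kFI_rel k)) => x q.
  by rewrite /f gr_mul_swap.
transitivity (\sum_x \sum_q telt
  (dual_pairing z (lact (c : FS r e) (eGr k x)) (eGr k q) : M r.-1.-1 t)
  (wmul (xiFI k q) (wmul (xiFI k x) y)) : E n.+2 s t); last first.
  by apply: eq_bigr => x _; apply: eq_bigr => q _; rewrite h gr_mul_lact.
move: {h} z; apply: tens_eq => [||m p q]; first exact: FL.
  apply: linear_bigsum => x; apply: linear_bigsum => q.
  exact: (@linear_compose k (tens WG WG e t) (M r.-1.-1 t) _ _
    (fun m => telt m (wmul (xiFI k q) (wmul (xiFI k x) y)) : E n.+2 s t)
    (dual_pairing_linear (lact (c : FS r e) (eGr k x)) (eGr k q)) (telt_linl _)).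
rewrite FE koszul_wactE (linf_sum (@koszul_wact_linr n.+1 s m t p)); apply: eq_bigr => x _.
rewrite koszul_wactE; apply: eq_bigr => x' _.
by rewrite !gr_homE !kFI_gr_eFI (dual_pairingE p q).
Qed.

End Koszul.

(** * The isomorphism with [kFS ⊗ kFI^perp] *)

Section Iso.
Variables (k : fieldType) (char0 : [pchar k] =i pred0).
Local Notation FB := (kFB k).
Local Notation FS := (kFS k).
Local Notation UI := (kFI_deg k 1).
Local Notation UG := (gr_kFA k 1).
Local Notation WG := (right_dual UG).
Local Notation I := (kFI_dual k).
Local Notation D := (gr_kFA_dual k).
Local Notation M := (kFS_FB k).
Local Notation E n := (tens M (I n)).
Local Notation J := (inclusion char0).
Local Notation one_I s := (rqd_deg0 (@kFI_mul k 1 1) (lid FB s)).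
Local Notation one_D s := (rqd_deg0 (@gr_mul k 1 1) (lid FS s)).

Definition koszul_module s : rqd_module (@gr_mul k 1 1) :=
  @RqdModule k FS UG (gr_kFA k 2) (@gr_mul k 1 1) (fun n t => E n s t)
    (fun n a b g v => koszul_lact g v) (fun n a b w v => koszul_wact w v)
    (fun n a b g => koszul_lact_linr g) (fun n a b c g f v => koszul_lactA g f v)
    (fun n a b v => koszul_lact_linl v) (fun n a b v => koszul_wact_linl v)
    (fun n a b w => koszul_wact_linr w) (fun n a b c w f v => koszul_wact_bal w f v)
    (fun n a b c g w v => koszul_wact_lact g w v)
    (fun e t z theta h n v => koszul_wact_rel char0 h v).

(** An equivariant inverse of [koszul_to_dual] must send the identity to [id ⊗ 1], hence be this
    orbit map. *)
Definition dual_to_koszul n s t (v : D n s t) : E n s t :=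
  @rqd_lift _ _ _ _ _ (koszul_module s) s
    (telt (lid FS s : M s s) (one_I s)) n t v.

Lemma dual_to_koszul_linear n s t : linear (@dual_to_koszul n s t).
Proof. exact: (@rqd_lift_linear _ _ _ _ _ (koszul_module s)). Qed.

Lemma dual_to_koszul_deg0 s t (c : FS s t) :
  dual_to_koszul (rqd_deg0 (@gr_mul k 1 1) c) = telt (c : M s t) (one_I s).
Proof.
apply: etrans (@rqd_lift_deg0 _ _ _ _ _ (koszul_module s) _ _ _ _) _.
by apply: etrans (koszul_lactE _ _ _) _; rewrite lcomp1r.
Qed.

Lemma dual_to_koszul_wmul n s r t (w : WG r t) (v : D n s r) :
  dual_to_koszul (wmul w v) = koszul_wact w (dual_to_koszul v).
Proof. exact: (@rqd_lift_wmul _ _ _ _ _ (koszul_module s)). Qed.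

Lemma dual_to_koszul_lact n s r t (c : FS r t) (v : D n s r) :
  dual_to_koszul (lact c v) = koszul_lact c (dual_to_koszul v).
Proof. exact: (@rqd_lift_lact _ _ _ _ _ (koszul_module s)). Qed.

Definition koszul_to_dual n s t (v : E n s t) : D n s t :=
  tlift (fun r (c : M r t) (y : I n s r) => lact (c : FS r t) (J y)) v.

Lemma koszul_to_dual_hyps n s t :
  [/\ forall r (y : I n s r),
        linear (fun c : M r t => lact (c : FS r t) (J y) : D n s t),
      forall r (c : M r t),
        linear (fun y : I n s r => lact (c : FS r t) (J y) : D n s t) &
      forall r r' (c : M r' t) (f : FB r r') (y : I n s r),
        lact (ract c f : FS r t) (J y) = lact (c : FS r' t) (J (lact f y))].
Proof.
split=> [r y|r c|r r' c f y].
- exact: (@lact_linl _ FS (D n) s r t (J y)).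
- exact: linear_compose (@inclusion_linear _ char0 s n r) (lact_linr _).
- by rewrite (kFS_FB_ract c f) inclusion_lact lactA.
Qed.

Lemma koszul_to_dualE n s t r (c : M r t) (y : I n s r) :
  koszul_to_dual (telt c y : E n s t) = lact (c : FS r t) (J y).
Proof. by have [fl fr fb] := @koszul_to_dual_hyps n s t; exact: (tliftE fl fr fb). Qed.

Lemma koszul_to_dual_linear n s t : linear (@koszul_to_dual n s t).
Proof. by have [fl fr fb] := @koszul_to_dual_hyps n s t; exact: (tlift_linear fl fr fb). Qed.

Lemma koszul_to_dual_koszul_map r t n s (h : rhom_bimod UI M r t) (y : I n s r) :
  koszul_to_dual (koszul_map h y) =
  \sum_(x < r) lact (h r.-1 (eFI k x) : FS r.-1 t) (wmul (xiGr k x) (J y)).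
Proof.
rewrite (linf_sum (@koszul_to_dual_linear n.+1 s t)); apply: eq_bigr => x _.
by rewrite koszul_to_dualE inclusion_wmul dual_ext_xiFI.
Qed.

(** In the dual, [w c = sum_x w(c e_x) xi_x] by the basis expansion of [w c], and the action on the
    Koszul side was modelled on this formula. *)
Lemma koszul_to_dual_wact n s r t (w : WG r t) (v : E n s r) :
  koszul_to_dual (koszul_wact w v) = wmul w (koszul_to_dual v).
Proof.
move: v; apply: tens_eq => [||a c y].
- exact: linear_compose (@koszul_wact_linr k n s r t w) (@koszul_to_dual_linear n.+1 s t).
- exact: linear_compose (@koszul_to_dual_linear n s r) (wmul_linr w).
rewrite koszul_wactE koszul_to_dual_koszul_map koszul_to_dualE -wmul_bal (wmul_expand (@eGr_K k)).
apply: eq_bigr => x _.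
by rewrite (right_dual_ractE w (c : FS a r)) (gr_homE w c (eFI k x)) kFI_gr_eFI.
Qed.

Lemma inclusion_one s : J (one_I s) = one_D s.
Proof. by rewrite inclusion_deg0 kFB_kFS_id. Qed.

Lemma lact_one_D s t (c : FS s t) :
  lact c (one_D s) = rqd_deg0 (@gr_mul k 1 1) c.
Proof. by rewrite lact_deg0 lcomp1r. Qed.

Lemma dual_to_koszulK n s t : cancel (@dual_to_koszul n s t) (@koszul_to_dual n s t).
Proof.
elim: n t => [|n IH] t v.
  move: v; elim/rqd_ind0 => c.
  by rewrite dual_to_koszul_deg0 koszul_to_dualE inclusion_one lact_one_D.
move: v; apply: rqd_eqS => [|//|r w v].
  exact: linear_compose (@dual_to_koszul_linear n.+1 s t) (@koszul_to_dual_linear n.+1 s t).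
by rewrite dual_to_koszul_wmul koszul_to_dual_wact IH.
Qed.

Lemma lid_kFB_kFS s r (g : FB s r) :
  (kFB_kFS g : M s r) = ract (lid FS r : M r r) g.
Proof. by rewrite (kFS_FB_ract (lid FS r : M r r) g) lcomp1l. Qed.

(** In the inductive step [p] sends [id ⊗ y] to [sum_x p(e_x) ⊗ xi_x y]. The coefficients come from
    [kFB], so they cross the tensor sign and reassemble to [id ⊗ p y]. *)
Lemma dual_to_koszul_inclusion n s r (y : I n s r) :
  dual_to_koszul (J y) = telt (lid FS r : M r r) y.
Proof.
elim: n r y => [|n IH] r y.
  move: y; elim/rqd_ind0 => g.
  rewrite inclusion_deg0 dual_to_koszul_deg0 lid_kFB_kFS telt_bal.
  by congr (telt _ _); rewrite lact_deg0 lcomp1r.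
move: y; apply: rqd_eqS => [||a p y].
- exact: linear_compose (@inclusion_linear _ char0 s n.+1 r) (@dual_to_koszul_linear n.+1 s r).
- exact: telt_linr.
rewrite inclusion_wmul dual_to_koszul_wmul IH koszul_wactE (wmul_expand (@eFI_K k) p).
rewrite (linf_sum (telt_linr _)); apply: eq_bigr => x _.
have -> : gr_hom (dual_ext p) (lid FS a : M a a) a.-1 (eFI k x) =
    ract (lid FS r : M r r) (p a.-1 (eFI k x)).
  rewrite (gr_homE (dual_ext p) (lid FS a : M a a) (eFI k x)).
  rewrite (@lact1 _ FS UG) (dual_ext_kFI_gr p); exact: lid_kFB_kFS.
exact: telt_bal.
Qed.

Lemma koszul_to_dualK n s t : cancel (@koszul_to_dual n s t) (@dual_to_koszul n s t).
Proof.
apply: tens_eq => [|//|r c y].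
  exact: linear_compose (@koszul_to_dual_linear n s t) (@dual_to_koszul_linear n s t).
by rewrite koszul_to_dualE dual_to_koszul_lact dual_to_koszul_inclusion koszul_lactE lcomp1r.
Qed.

Lemma inclusion_ract n s s' t (y : I n s t) (g : FB s' s) :
  J (ract y g) = ract (J y) (kFB_kFS g).
Proof.
elim: n t y => [|n IH] t y.
  move: y; elim/rqd_ind0 => c.
  by rewrite ract_deg0 !inclusion_deg0 ract_deg0 kFB_kFS_comp.
move: y; apply: rqd_eqS => [||r p y].
- exact: linear_compose (ract_linl g) (@inclusion_linear _ char0 s' n.+1 t).
- exact: linear_compose (@inclusion_linear _ char0 s n.+1 t) (ract_linl _).
by rewrite wmul_ract !inclusion_wmul wmul_ract IH.
Qed.

Lemma inclusion_mul m n a b c (x : I m b c) (y : I n a b) :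
  J (rqd_mul x y) = rqd_mul (J x) (J y).
Proof.
elim: m c x => [|m IH] c x.
  move: x; elim/rqd_ind0 => g.
  by rewrite rqd_mul_deg0 inclusion_lact inclusion_deg0 rqd_mul_deg0.
move: x; apply: rqd_eqS => [||r p x].
- exact: linear_compose (@rqd_mul_linl _ _ _ _ _ m.+1 n a b c y)
    (@inclusion_linear _ char0 a (m.+1 + n) c).
- exact: linear_compose (@inclusion_linear _ char0 b m.+1 c)
    (@rqd_mul_linl _ _ _ _ _ m.+1 n a b c (J y)).
by rewrite rqd_mul_wmul !inclusion_wmul rqd_mul_wmul IH.
Qed.

Lemma koszul_to_dual_ract n s s' t (g : FB s' s) (u : E n s t) :
  koszul_to_dual (ract u g) = ract (koszul_to_dual u) (kFB_kFS g).
Proof.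
move: u; apply: tens_eq => [||r c y].
- exact: linear_compose (@ract_linl _ _ (E n) _ _ _ g) (@koszul_to_dual_linear n s' t).
- exact: linear_compose (@koszul_to_dual_linear n s t) (ract_linl _).
have -> : ract (telt c y : E n s t) g = telt c (ract y g) by exact: tens_ractE.
by rewrite !koszul_to_dualE inclusion_ract lractA.
Qed.

Lemma koszul_to_dual_lact n s t t' (g : FB t t') (u : E n s t) :
  koszul_to_dual (lact g u) = lact (kFB_kFS g) (koszul_to_dual u).
Proof.
move: u; apply: tens_eq => [||r c y].
- exact: linear_compose (@lact_linr _ _ (E n) _ _ _ g) (@koszul_to_dual_linear n s t').
- exact: linear_compose (@koszul_to_dual_linear n s t) (lact_linr _).
have -> : lact g (telt c y : E n s t) = telt (lact g c) y by exact: tens_lactE.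
by rewrite !koszul_to_dualE (kFS_FB_lact g c) lactA.
Qed.

(** The products [c J(y)] span because [koszul_to_dual] is surjective; identities for d are tested
    on them. *)
Lemma dual_eq n s t (V : lmodType k) (f g : D n s t -> V) :
  linear f -> linear g ->
  (forall r (c : FS r t) (y : I n s r), f (lact c (J y)) = g (lact c (J y))) ->
  f =1 g.
Proof.
move=> fL gL fg v; rewrite -(dual_to_koszulK v).
move: (dual_to_koszul v); apply: tens_eq => [||r c y].
- exact: linear_compose (@koszul_to_dual_linear n s t) fL.
- exact: linear_compose (@koszul_to_dual_linear n s t) gL.
by rewrite koszul_to_dualE fg.
Qed.

End Iso.

(** * The differential *)

Section Differential.
Variables (k : fieldType).
Local Notation FB := (kFB k).
Local Notation FS := (kFS k).
Local Notation UI := (kFI_deg k 1).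
Local Notation UG := (gr_kFA k 1).
Local Notation WG := (right_dual UG).
Local Notation I := (kFI_dual k).
Local Notation M := (kFS_FB k).
Local Notation E n := (tens M (I n)).

Lemma kFI_deg_kFI_linear a b : linear (@kFI_deg_kFI k 1 a b).
Proof. exact: kchange_linear. Qed.

Lemma kFI_deg_kFI_E a b (f : {ffun 'I_a -> 'I_b}) : injm_deg 1 f ->
  kFI_deg_kFI (kbasis k (injm_deg 1) f) = kbasis k injm f.
Proof. exact: kchangeE. Qed.

Lemma kFI_deg_kFI_ract a b c (u : UI b c) (g : FB a b) :
  kFI_deg_kFI (ract u g) = lcomp (kFI_deg_kFI u) (kFB_kFI g) :> kFI k a c.
Proof.
move: u; apply: kmap_eq => [||f Pf].
- exact: linear_compose (ract_linl g) (@kFI_deg_kFI_linear a c).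
- exact: linear_compose (@kFI_deg_kFI_linear b c) (@lcomp_linl _ (kFI k) _ _ _ _).
move: g; apply: kmap_eq => [||g Pg].
- exact: linear_compose (@ract_linr _ _ UI a b c _) (@kFI_deg_kFI_linear a c).
- exact: linear_compose (@kchange_linear k bijm injm a b)
    (@lcomp_linr _ (kFI k) _ _ _ _).
have -> : ract (kbasis k (injm_deg 1) f : UI b c) (kbasis k bijm g : FB a b) =
    kbasis k (injm_deg 1) (fcomp f g) by exact: kcompE.
rewrite (kFI_deg_kFI_E Pf) kFI_deg_kFI_E; last exact: injm_deg_bij.
have /andP[If _] := Pf; have /andP[Ig _] := Pg.
by rewrite /kFB_kFI (kchangeE k injm Pg); apply/esym/(kcompE k injm If Ig).
Qed.

Lemma kFI_deg_kFI_lact a b c (g : FB b c) (u : UI a b) :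
  kFI_deg_kFI (lact g u) = lcomp (kFB_kFI g) (kFI_deg_kFI u) :> kFI k a c.
Proof.
move: u; apply: kmap_eq => [||f Pf].
- exact: linear_compose (@lact_linr _ _ UI a b c g) (@kFI_deg_kFI_linear a c).
- exact: linear_compose (@kFI_deg_kFI_linear a b) (@lcomp_linr _ (kFI k) _ _ _ _).
move: g; apply: kmap_eq => [||g Pg].
- exact: linear_compose (@lact_linl _ _ UI a b c _) (@kFI_deg_kFI_linear a c).
- exact: linear_compose (@kchange_linear k bijm injm b c)
    (@lcomp_linl _ (kFI k) _ _ _ _).
have -> : lact (kbasis k bijm g : FB b c) (kbasis k (injm_deg 1) f : UI a b) =
    kbasis k (injm_deg 1) (fcomp g f) by exact: kcompE.
rewrite (kFI_deg_kFI_E Pf) kFI_deg_kFI_E; last exact: bij_injm_deg.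
have /andP[If _] := Pf; have /andP[Ig _] := Pg.
by rewrite /kFB_kFI (kchangeE k injm Pg); apply/esym/(kcompE k injm Ig If).
Qed.

Definition fi_hom_fun r t (c : M r t) a (u : UI a r) : M a t :=
  kFS_fi_act (c : FS r t) (kFI_deg_kFI u).

Lemma fi_hom_linear r t (c : M r t) a : linear (@fi_hom_fun r t c a).
Proof.
exact: linear_compose (@kFI_deg_kFI_linear a r) (@kFS_fi_act_linr k a r t c).
Qed.

Lemma fi_hom_fun_ract r t (c : M r t) a b (u : UI b r) (g : FB a b) :
  fi_hom_fun c (ract u g) = ract (fi_hom_fun c u) g.
Proof.
rewrite /fi_hom_fun kFI_deg_kFI_ract -kFS_fi_actA; exact: kFS_fi_act_kFB.
Qed.

Definition fi_hom r t (c : M r t) : rhom_bimod UI M r t :=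
  @RHom _ FB UI M r t (@fi_hom_fun r t c) (@fi_hom_linear r t c)
    (@fi_hom_fun_ract r t c).

Lemma fi_homE r t (c : M r t) a (u : UI a r) :
  fi_hom c a u = kFS_fi_act (c : FS r t) (kFI_deg_kFI u).
Proof. by []. Qed.

Lemma fi_hom_linl r t : linear (@fi_hom r t).
Proof.
by move=> x c c'; apply: rhomP => a u; exact: (@kFS_fi_act_linl k a r t _ x c c').
Qed.

Lemma fi_hom_ract r r' t (c : M r t) (g : FB r' r) :
  fi_hom (ract c g) = ract (fi_hom c) g.
Proof.
apply: rhomP => a u; rewrite (rhom_ractE (fi_hom c)) !fi_homE.
rewrite (kFI_deg_kFI_lact g u) -kFS_fi_actA.
exact: (congr1 (fun m : FS r' t => kFS_fi_act m (kFI_deg_kFI u))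
  (esym (kFS_fi_act_kFB c g))).
Qed.

Lemma fi_hom_basis r t a (c : {ffun 'I_r -> 'I_t}) (f : {ffun 'I_a -> 'I_r}) :
  surjm c -> injm_deg 1 f ->
  fi_hom (kbasis k surjm c : M r t) a (kbasis k (injm_deg 1) f) =
  kbasis k surjm (fcomp c f).
Proof.
move=> Pc Pf; rewrite fi_homE kFI_deg_kFI_E // kFS_fi_actE.
by apply: kcompE => //; case/andP: Pf.
Qed.

Definition koszul_d_fun n s t (v : E n s t) : E n.+1 s t :=
  tlift (fun r (c : M r t) (y : I n s r) => koszul_map (fi_hom c) y) v.

Lemma koszul_d_hyps n s t :
  [/\ forall r (y : I n s r),
        linear (fun c : M r t => koszul_map (fi_hom c) y : E n.+1 s t),
      forall r (c : M r t),
        linear (fun y : I n s r => koszul_map (fi_hom c) y : E n.+1 s t) &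
      forall r r' (c : M r' t) (f : FB r r') (y : I n s r),
        koszul_map (fi_hom (ract c f)) y = koszul_map (fi_hom c) (lact f y)].
Proof.
split=> [r y|r c|r r' c f y]; last by rewrite fi_hom_ract koszul_map_bal.
- exact: linear_compose (@fi_hom_linl r t) (koszul_map_linl y).
- exact: koszul_map_linr.
Qed.

Lemma koszul_d_telt n s t r (c : M r t) (y : I n s r) :
  koszul_d_fun (telt c y : E n s t) = koszul_map (fi_hom c) y.
Proof. by have [fl fr fb] := @koszul_d_hyps n s t; exact: (tliftE fl fr fb). Qed.

Lemma koszul_d_linear n s t : linear (@koszul_d_fun n s t).
Proof. by have [fl fr fb] := @koszul_d_hyps n s t; exact: (tlift_linear fl fr fb). Qed.

(* The element i |-> c . i of Hom_{kFB^op}(kFI^[1], kFS), seen in U^*. *)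
Definition delta s t (c : FS s t) : WG s t :=
  \sum_(x < s) lact (fi_hom (c : M s t) s.-1 (eFI k x) : FS s.-1 t) (xiGr k x).

Lemma deltaE s t (c : FS s t) : delta c =
  \sum_(x < s) lact (fi_hom (c : M s t) s.-1 (eFI k x) : FS s.-1 t) (xiGr k x).
Proof. by []. Qed.

Lemma delta_kFI_gr s t (c : FS s t) a (u : UI a s) :
  delta c a (kFI_gr u) = fi_hom (c : M s t) a u.
Proof.
rewrite rhom_sumE {2}(eFI_K u) (linf_sum (rfun_linear (fi_hom (c : M s t)) (a := a))).
apply: eq_bigr => x _; rewrite rfun_ract.
rewrite (kFS_FB_ract (fi_hom (c : M s t) s.-1 (eFI k x))) -xiGr_kFI_gr.
exact: (right_dual_lactE _ (xiGr k x)).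
Qed.

Lemma delta_linear s t : linear (@delta s t).
Proof.
move=> x c c'; apply: gr_rhomP => a u; rewrite (delta_kFI_gr (x *: c + c')).
apply: etrans (congr1 (fun h : rhom_bimod UI M s t => h a u) (@fi_hom_linl s t x c c')) _.
apply: etrans (rhomLE _ _ _ _) _.
by rewrite -(delta_kFI_gr c) -(delta_kFI_gr c').
Qed.

Opaque delta fi_hom xiGr kFI_gr kFB_kFS.

(** With the convention that a non-surjective map has class 0, [delta] measures the failure of the
    augmentation to be multiplicative. For surjective [f] both sides vanish; for corank 1 the
    subtracted product does, and [f] is reduced to a coface by right linearity. *)
Lemma delta_basis s t a (g : {ffun 'I_s -> 'I_t}) (f : {ffun 'I_a -> 'I_s}) :
  surjm g -> corank_le 1 f ->
  delta (kbasis k surjm g) a (gr_pi (kbasis k (corank_le 1) f)) =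
  kbasis k surjm (fcomp g f) -
  lcomp (kbasis k surjm g : FS s t) (kbasis k surjm f : FS a s).
Proof.
move=> Pg; rewrite /corank_le leq_eqVlt => /orP[/eqP f1|f0]; last first.
  have Pf : surjm f by rewrite surjm_corank; case: (corank f) f0.
  rewrite gr_pi_lower // (linf0 (rfun_linear (delta (kbasis k surjm g)) (a := a))).
  by rewrite [lcomp _ _](kcompE k surjm Pg Pf) subrr.
have nPf : ~~ surjm f by rewrite surjm_corank f1.
rewrite (kbasis_out _ nPf) (linf0 (@lcomp_linr _ FS _ _ _ _)) subr0.
have [x [p [fE _]]] := corank1_factor f1.
have Px := injm_deg_cof x.
have Pp : surjm p by apply: (@surj_cof_factor _ _ x); rewrite -fE /corank_le f1.
have -> : gr_pi (kbasis k (corank_le 1) f) =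
    ract (kFI_gr (kbasis k (injm_deg 1) (cof x))) (kbasis k surjm p : FS a s.-1).
  rewrite kFI_grE // fE; apply/esym/gr_ractE => //; exact: injm_deg_corank_le.
rewrite rfun_ract delta_kFI_gr fi_hom_basis // fE fcompA.
have [Pgx|nPgx] := boolP (surjm (fcomp g (cof x))); first exact: (kcompE k surjm Pgx Pp).
rewrite (kbasis_out _ nPgx) [LHS](linf0 (@ract_linl _ _ (regular FS) _ _ _ _)).
by rewrite kbasis_out //; apply: contra nPgx; exact: surjm_fcompl.
Qed.

(** By [delta_basis] the right side telescopes on [f]: [([g c f] - [g][c f]) + [g][c f] =
    [g c f]]. *)
Lemma delta_comp r s t (g : FS s t) (c : FS r s) :
  delta (lcomp g c) = ract (delta g) c + lact g (delta c).
Proof.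
apply: gr_rhomP => a u; rewrite (delta_kFI_gr (lcomp g c)).
rewrite (right_dual_addE (ract (delta g) c)) (right_dual_ractE (delta g)).
rewrite (right_dual_lactE g (delta c)) (delta_kFI_gr c).
have fl r' t' b (v : UI b r') : linear (fun m : FS r' t' => fi_hom (m : M r' t') b v : FS b t').
  exact: (linear_compose (@fi_hom_linl r' t') (rhom_eval_linear v)).
move: g; apply: kmap_eq => [||g Pg].
- exact: linear_compose (@lcomp_linl _ FS r s t c) (fl _ _ _ u).
- apply: linear_fadd (@lcomp_linl _ FS _ _ _ _).
  exact: linear_compose (@delta_linear s t) (rhom_eval_linear _).
move: c; apply: kmap_eq => [||c Pc].
- exact: linear_compose (@lcomp_linr _ FS r s t _) (fl _ _ _ u).
- apply: linear_fadd.
    exact: linear_compose (@lact_linl _ FS UG _ _ _ _)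
      (rfun_linear (delta (kbasis k surjm g)) (a := a)).
  exact: linear_compose (fl _ _ _ u) (@lcomp_linr _ FS a s t _).
move: u; apply: kmap_eq => [||f Pf].
- exact: (rfun_linear (fi_hom _) (a := a)).
- apply: linear_fadd.
    exact: linear_compose (linear_compose (@kFI_gr_linear k a r)
      (@lact_linr _ FS UG _ _ _ _)) (rfun_linear (delta (kbasis k surjm g)) (a := a)).
  exact: linear_compose (rfun_linear (fi_hom _) (a := a)) (@lcomp_linr _ FS a s t _).
have -> : lcomp (kbasis k surjm g : FS s t) (kbasis k surjm c : FS r s) =
  kbasis k surjm (fcomp g c) by exact: kcompE.
have Pf' := injm_deg_corank_le Pf.
rewrite (fi_hom_basis (surjm_closed Pg Pc) Pf) (fi_hom_basis Pc Pf) (kFI_grE k Pf).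
rewrite (gr_lactE k Pc Pf') (delta_basis Pg (surj_corank_le Pc Pf')) fcompA.
exact: (esym (subrK _ _)).
Qed.

End Differential.

(** * The transported differential and its values on generators *)

Section DualDifferential.
Variables (k : fieldType) (char0 : [pchar k] =i pred0).
Local Notation FB := (kFB k).
Local Notation FS := (kFS k).
Local Notation UI := (kFI_deg k 1).
Local Notation UG := (gr_kFA k 1).
Local Notation I := (kFI_dual k).
Local Notation D := (gr_kFA_dual k).
Local Notation M := (kFS_FB k).
Local Notation E n := (tens M (I n)).
Local Notation J := (inclusion char0).

Opaque delta fi_hom xiGr kFI_gr kFB_kFS dual_ext.

(* The coefficient of [i_q]^* [i_x]^* in d(xi c) + xi d(c), where xi = [i_z]^*. *)
Definition xi_coboundary r s (z : 'I_s) (c : M r s) (x : 'I_r) (q : 'I_r.-1) :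
    FS r.-1.-1 s.-1 :=
  fi_hom (xiGr k z r.-1 (lact (c : FS r s) (eGr k x)) : M r.-1 s.-1) r.-1.-1 (eFI k q) +
  xiGr k z r.-1.-1 (lact (fi_hom c r.-1 (eFI k x) : FS r.-1 s) (eGr k q)).

Lemma fi_hom_eval_linear r t a (u : UI a r) :
  linear (fun c : FS r t => fi_hom (c : M r t) a u : FS a t).
Proof. exact: (linear_compose (@fi_hom_linl k r t) (rhom_eval_linear u)). Qed.

Lemma xi_coboundary_linear r s (z : 'I_s) (x : 'I_r) (q : 'I_r.-1) :
  linear (fun c : M r s => xi_coboundary z c x q).
Proof.
apply: linear_fadd.
  exact: linear_compose (linear_compose (@lact_linl _ FS UG _ _ _ (eGr k x))
    (rfun_linear (xiGr k z) (a := r.-1))) (fi_hom_eval_linear (eFI k q)).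
exact: linear_compose (linear_compose (fi_hom_eval_linear (eFI k x))
  (@lact_linl _ FS UG _ _ _ (eGr k q))) (rfun_linear (xiGr k z) (a := r.-1.-1)).
Qed.

(* If c i_x is surjective only the second term survives, otherwise only the
   first one; both depend only on the composite c i_x i_q. *)
Lemma xi_coboundary_basis r s (z : 'I_s) (c : {ffun 'I_r -> 'I_s}) (x : 'I_r)
    (q : 'I_r.-1) : surjm c ->
  xi_coboundary z (kbasis k surjm c : M r s) x q =
  \sum_(p | fcomp (cof z) p == fcomp c (fcomp (cof x) (cof q))) kbasis k surjm p.
Proof.
move=> Pc; rewrite /xi_coboundary.
have Px := injm_deg_cof x; have Pq := injm_deg_cof q.
have Px' := injm_deg_corank_le Px; have Pq' := injm_deg_corank_le Pq.
rewrite (gr_lactE k Pc Px') (fi_hom_basis k Pc Px) fcompA.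
set cx := fcomp c (cof x).
have Pcx : corank_le 1 cx by exact: surj_corank_le.
have [scx|ncx] := boolP (surjm cx).
  have cx0 : (corank cx < 1)%N by move: scx; rewrite surjm_corank => /eqP ->.
  rewrite (gr_pi_lower k cx0) (linf0 (rfun_linear (xiGr k z) (a := r.-1))).
  rewrite (linf0 (fi_hom_eval_linear (eFI k q))) add0r.
  rewrite (gr_lactE k scx Pq'); apply: gr_dualE; exact: surj_corank_le.
rewrite (kbasis_out _ ncx) (linf0 (@lact_linl _ FS UG _ _ _ (eGr k q))).
rewrite (linf0 (rfun_linear (xiGr k z) (a := r.-1.-1))) addr0.
have -> : xiGr k z r.-1 (gr_pi (kbasis k (corank_le 1) cx)) =
  \sum_(p | fcomp (cof z) p == cx) kbasis k surjm p by exact: gr_dualE.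
rewrite (linf_sum (fi_hom_eval_linear (eFI k q))).
have cx1 : corank cx = 1%N.
  apply/eqP; rewrite eqn_leq; apply/andP; split=> //.
  by rewrite lt0n -surjm_corank.
have [w [p [cxE wP]]] := corank1_factor cx1.
have [zw|nzw] := eqVneq z w.
  rewrite cxE zw big_factor; last exact: cof_inj.
  rewrite -fcompA big_factor; last exact: cof_inj.
  apply: fi_hom_basis => //; apply: (@surj_cof_factor _ _ w); rewrite -cxE.
  by rewrite /corank_le cx1.
rewrite big_nofactor => [|p' p'E]; last by move: nzw; rewrite (wP _ _ p'E) eqxx.
(* Here [cx] misses [w], which differs from [z]. So [p'] misses the point [w'] lying over [w], is
   not surjective, and its class is 0. *)
rewrite big1 // => p' /eqP p'E; apply: kbasis_out.
have [w' wE _] := unlift_some nzw.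
apply/negP => /surjmP/(_ w')[j jE].
have /ffunP/(_ j) := p'E; rewrite cxE !ffunE jE -wE => /eqP.
by apply/negP; exact: neq_lift.
Qed.

Lemma xi_coboundary_swap r s (z : 'I_s) (c : M r s) (x : 'I_r) (q : 'I_r.-1) :
  xi_coboundary z c x q = xi_coboundary z c (lift x q) (swap_snd x q).
Proof.
move: c; apply: kmap_eq => [||c Pc].
- exact: (xi_coboundary_linear z x q).
- exact: (xi_coboundary_linear z (lift x q) (swap_snd x q)).
by rewrite (xi_coboundary_basis z x q Pc) (xi_coboundary_basis z _ _ Pc) cof_swap.
Qed.

(** By associativity of the right [kFI]-action both sides are [c] acted on by the same two-point
    coface; this symmetry yields [d^2 = 0]. *)
Lemma fi_hom_swap r t (c : M r t) (x : 'I_r) (q : 'I_r.-1) :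
  fi_hom (fi_hom c r.-1 (eFI k x)) r.-1.-1 (eFI k q) =
  fi_hom (fi_hom c r.-1 (eFI k (lift x q))) r.-1.-1 (eFI k (swap_snd x q)).
Proof.
have E (x' : 'I_r) (q' : 'I_r.-1) :
    fi_hom (fi_hom c r.-1 (eFI k x')) r.-1.-1 (eFI k q') =
    kFS_fi_act (c : FS r t) (kbasis k injm (fcomp (cof x') (cof q'))).
  have Px := injm_deg_cof x'; have Pq := injm_deg_cof q'.
  have /andP[Ix _] := Px; have /andP[Iq _] := Pq.
  rewrite (fi_homE (fi_hom c r.-1 (eFI k x'))) (fi_homE c).
  rewrite (kFI_deg_kFI_E k Px) (kFI_deg_kFI_E k Pq) kFS_fi_actA.
  congr (kFS_fi_act _ _); exact: (kcompE k injm Ix Iq).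
apply: etrans (E x q) (etrans _ (esym (E _ _))).
by rewrite cof_swap.
Qed.

Definition dual_d n s t (v : D n s t) : D n.+1 s t :=
  koszul_to_dual char0 (koszul_d_fun (dual_to_koszul char0 v)).

Lemma dual_d_linear n s t : linear (@dual_d n s t).
Proof.
exact: linear_compose (linear_compose (@dual_to_koszul_linear k char0 n s t)
  (@koszul_d_linear k n s t)) (@koszul_to_dual_linear k char0 n.+1 s t).
Qed.

Lemma dual_d_koszul_to_dual n s t (u : E n s t) :
  dual_d (koszul_to_dual char0 u) = koszul_to_dual char0 (koszul_d_fun u).
Proof. by rewrite /dual_d koszul_to_dualK. Qed.

(** Both sides are [sum_x (c . i_x) xi_x J(y)]. From here on d is computed inside the dual by this
    formula. *)
Lemma dual_d_J n s r t (c : FS r t) (y : I n s r) :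
  dual_d (lact c (J y)) = wmul (delta c) (J y).
Proof.
rewrite -(koszul_to_dualE char0 (c : M r t)) dual_d_koszul_to_dual koszul_d_telt.
rewrite koszul_to_dual_koszul_map.
rewrite deltaE (linf_sum (wmul_linl (J y))); apply: eq_bigr => x _.
by rewrite wmul_lact.
Qed.

Lemma dual_d_deg0 s t (c : FS s t) :
  dual_d (rqd_deg0 (@gr_mul k 1 1) c) = rqd_deg1 (@gr_mul k 1 1) (delta c).
Proof. by rewrite -lact_one_D -(inclusion_one char0) dual_d_J inclusion_one -rqd_deg1E. Qed.

(** A coface is never surjective, so the augmented action sends the identity to 0. This is why d
    vanishes on the image of J. *)
Lemma delta_id s : delta (lid FS s) = 0.
Proof.
apply: gr_rhomP => a u; rewrite (delta_kFI_gr (lid FS s)).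
move: u; apply: kmap_eq => [||f Pf].
- exact: (rfun_linear (fi_hom _) (a := a)).
- by move=> x u v; rewrite scaler0 addr0.
rewrite (fi_hom_basis k (surjm_id s) Pf) fcomp1l; apply: kbasis_out.
by rewrite surjm_corank (injm_deg_corank Pf).
Qed.

Lemma dual_d_inclusion n s r (y : I n s r) : dual_d (J y) = 0.
Proof.
rewrite -[J y](@lact1 _ FS (D n)) dual_d_J delta_id.
exact: (linf0 (wmul_linl _)).
Qed.

Lemma dual_d_lact n s r t (g : FS r t) (v : D n s r) :
  dual_d (lact g v) = wmul (delta g) v + lact g (dual_d v).
Proof.
move: v; apply: (@dual_eq k char0) => [||a c y].
- exact: linear_compose (@lact_linr _ FS (D n) _ _ _ g) (@dual_d_linear n s t).
- apply: linear_fadd (wmul_linr _) _.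
  exact: linear_compose (@dual_d_linear n s r) (@lact_linr _ FS (D n.+1) _ _ _ g).
rewrite lactA !dual_d_J delta_comp (linfD (wmul_linl (J y))) wmul_lact.
by rewrite -wmul_bal.
Qed.

Lemma dual_d_xi n r s (z : 'I_s) (v : D n r s) :
  dual_d (wmul (xiGr k z) v) + wmul (xiGr k z) (dual_d v) = 0.
Proof.
move: v; apply: (@dual_eq k char0) => [||a c y].
- apply: linear_fadd.
    exact: linear_compose (wmul_linr (xiGr k z)) (@dual_d_linear n.+1 r s.-1).
  exact: linear_compose (@dual_d_linear n r s) (wmul_linr (xiGr k z)).
- by move=> x u v; rewrite scaler0 addr0.
rewrite dual_d_J -wmul_bal (wmul_expand (@eGr_K k)).
rewrite (linf_sum (@dual_d_linear _ _ _)).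
rewrite deltaE (linf_sum (wmul_linl (J y))) (linf_sum (wmul_linr (xiGr k z))).
rewrite -big_split.
apply: etrans (sum_swap_lact char0 (@gr_rel k) (J y)
  (fun x q => xi_coboundary_swap z (c : M a s) x q)).
apply: eq_bigr => x _.
(* Writing [xi_x J(y)] as [J(xi_x y)] makes [dual_d_J] applicable to each term. *)
rewrite -(dual_ext_xiFI k x) -inclusion_wmul dual_d_J inclusion_wmul.
rewrite (dual_ext_xiFI k x).
rewrite deltaE (linf_sum (wmul_linl _)) (wmul_lact _ (xiGr k x)) -wmul_bal.
rewrite (wmul_expand (@eGr_K k)
  (ract (xiGr k z) (fi_hom (c : M a s) a.-1 (eFI k x) : FS a.-1 s))).
rewrite -big_split; apply: eq_bigr => q _; rewrite wmul_lact.
exact: (esym (linfD (@lact_linl _ FS (D n.+2) _ _ _ _) _ _)).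
Qed.

End DualDifferential.

Definition to_linear (k : fieldType) (V W : lmodType k) (f : V -> W)
    (fL : linear f) : {linear V -> W} :=
  HB.pack f (GRing.isLinear.Build k V W *:%R f fL).

Lemma to_linearE (k : fieldType) (V W : lmodType k) (f : V -> W) (fL : linear f) v :
  to_linear fL v = f v.
Proof. by []. Qed.

(** * The Leibniz rule, uniqueness and the Koszul differential *)

Section Derivation.
Variables (k : fieldType) (char0 : [pchar k] =i pred0).
Local Notation FB := (kFB k).
Local Notation FS := (kFS k).
Local Notation UI := (kFI_deg k 1).
Local Notation UG := (gr_kFA k 1).
Local Notation WG := (right_dual UG).
Local Notation I := (kFI_dual k).
Local Notation D := (gr_kFA_dual k).
Local Notation M := (kFS_FB k).
Local Notation J := (inclusion char0).
Local Notation one_D s := (rqd_deg0 (@gr_mul k 1 1) (lid FS s)).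
Local Notation gen0 := (@rqd_deg0 _ _ _ _ (@gr_mul k 1 1) _ _).
Local Notation gen1 := (@rqd_deg1 _ _ _ _ (@gr_mul k 1 1) _ _).
Local Notation d := (dual_d char0).

Opaque delta fi_hom xiGr kFI_gr kFB_kFS dual_ext dual_d inclusion.

Lemma dual_d_sum_xi n r s t (w : WG s t) (v : D n r s) :
  d (wmul w v) =
  \sum_(x < s) wmul (delta (w s.-1 (eGr k x) : FS s.-1 t)) (wmul (xiGr k x) v)
  - wmul w (d v).
Proof.
rewrite (wmul_expand (@eGr_K k) w v) (wmul_expand (@eGr_K k) w (d v)).
rewrite (linf_sum (@dual_d_linear _ _ _ _ _)) -sumrB; apply: eq_bigr => x _.
rewrite dual_d_lact; congr (_ + _).
rewrite -(linfN (lact_linr _)); congr (lact _ _).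
by apply/eqP; rewrite -addr_eq0; apply/eqP; exact: dual_d_xi.
Qed.

Lemma dual_d_deg1 s t (w : WG s t) :
  d (gen1 w) = \sum_(x < s) wmul (delta (w s.-1 (eGr k x) : FS s.-1 t))
    (wmul (xiGr k x) (one_D s)).
Proof.
rewrite rqd_deg1E dual_d_sum_xi -[in X in _ - X](inclusion_one char0) dual_d_inclusion.
by rewrite (linf0 (wmul_linr w)) subr0.
Qed.

(** The sum in [dual_d_sum_xi] multiplies [v] by an element independent of [v]; taking an identity
    for [v], whose differential is 0, identifies that element as [d(w)]. *)
Lemma dual_d_wmul n r s t (w : WG s t) (v : D n r s) :
  d (wmul w v) = rqd_mul (d (gen1 w)) v - wmul w (d v).
Proof.
rewrite dual_d_sum_xi dual_d_deg1; congr (_ - _).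
rewrite (linf_sum (@rqd_mul_linl _ _ _ _ _ 2 n r s t v)); apply: eq_bigr => x _.
by rewrite !rqd_mul_wmul rqd_mul_deg0 lact1.
Qed.

Lemma wmul_ecast i j (e : i = j) (e' : i.+1 = j.+1) a b c (w : WG b c) (v : D i a b) :
  ecast i (D i a c) e' (wmul w v : D i.+1 a c) = wmul w (ecast i (D i a b) e v).
Proof. by case: _ / e in e' *; rewrite eq_axiomK. Qed.

Lemma ecast_linear i j (e : i = j) a b :
  linear (fun v : D i a b => ecast i (D i a b) e v).
Proof. by case: _ / e. Qed.

(** Peeling a generator [w] off [x] gives [d(w x y) = d(w) x y - w d(x y)]; each generator passed
    contributes one sign. *)
Lemma dual_d_mul m n a b c (x : D m b c) (y : D n a b) :
  d (dual_mul x y) = (dual_mul (d x) y : D (m + n).+1 a c) +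
    (-1) ^+ m *: ecast i (D i a c) (addnS m n) (dual_mul x (d y)).
Proof.
rewrite /dual_mul; elim: m c x => [|m IH] c x.
  move: x; elim/rqd_ind0 => g.
  rewrite eq_axiomK expr0 scale1r !rqd_mul_deg0 dual_d_lact dual_d_deg0.
  by [].
move: x; apply: rqd_eqS => [||r w x].
- exact: linear_compose (@rqd_mul_linl _ _ _ _ _ m.+1 n a b c y)
    (@dual_d_linear k char0 (m.+1 + n) a c).
- apply: linear_fadd.
    exact: linear_compose (@dual_d_linear k char0 m.+1 b c)
      (@rqd_mul_linl _ _ _ _ _ m.+2 n a b c y).
  move=> t u v; rewrite (@rqd_mul_linl _ _ _ _ _ m.+1 n.+1 a b c (d y) t u v).
  by rewrite ecast_linear scalerDr !scalerA mulrC.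
rewrite !rqd_mul_wmul (dual_d_wmul w (rqd_mul x y)) (dual_d_wmul w x) IH.
have -> : rqd_mul (rqd_mul (d (gen1 w)) x - wmul w (d x) : D m.+2 b c) y =
    rqd_mul (d (gen1 w)) (rqd_mul x y) - wmul w (rqd_mul (d x) y) :> D (m + n).+2 a c.
  apply: etrans (linfB (@rqd_mul_linl _ _ _ _ _ m.+2 n a b c y) _ _) _.
  by rewrite (rqd_mul_wmul w (d x) y) (rqd_mulA2 (d (gen1 w)) x y).
have -> := wmul_ecast (addnS m n) (addnS m.+1 n) w (rqd_mul x (d y)).
set A := rqd_mul (d (gen1 w)) _; set B := rqd_mul (d x) y; set z := ecast _ _ _ _.
have -> : wmul w (B + (-1) ^+ m *: z) = wmul w B + (-1) ^+ m *: wmul w z.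
  by apply: etrans (linfD (wmul_linr w) _ _) _; congr (_ + _); exact: (linfZ (wmul_linr w)).
by rewrite exprS mulN1r scaleNr opprD addrA.
Qed.

Lemma dual_dK n s t (v : D n s t) : d (d v) = 0.
Proof.
move: v; apply: (@dual_eq k char0) => [||r c y].
- exact: linear_compose (@dual_d_linear k char0 n s t) (@dual_d_linear k char0 n.+1 s t).
- by move=> x u v; rewrite scaler0 addr0.
rewrite dual_d_J deltaE (linf_sum (wmul_linl (J y))).
rewrite (linf_sum (@dual_d_linear k char0 n.+1 s t)).
apply: etrans (sum_swap_lact char0 (@gr_rel k) (J y)
  (fun x q => fi_hom_swap (c : M r t) x q)).
apply: eq_bigr => x _; rewrite wmul_lact.
rewrite -(dual_ext_xiFI k x) -inclusion_wmul dual_d_J inclusion_wmul.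
rewrite deltaE (linf_sum (wmul_linl _)); apply: eq_bigr => q _.
exact: wmul_lact.
Qed.

Definition dual_differential n s t : {linear D n s t -> D n.+1 s t} :=
  to_linear (@dual_d_linear k char0 n s t).

Lemma dual_differentialP : is_dual_differential dual_differential.
Proof.
split=> [m n a b c x y|s t p|s t c].
- exact: dual_d_mul.
- exists (dual_ext p) => [a u|]; first exact: dual_ext_kFI_gr.
  rewrite to_linearE rqd_deg1E -(inclusion_one char0) -inclusion_wmul.
  exact: dual_d_inclusion.
- exists (delta c) => [a u|]; first exact: delta_kFI_gr.
  exact: dual_d_deg0.
Qed.

(** The axioms fix d on [kFS] and on the [xi_x]. Writing [w = sum_x w(e_x) xi_x], the Leibniz rule
    fixes it on [U^*], and induction on products does the rest. *)
Lemma dual_differential_unique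
    (d1 d2 : forall n s t, {linear D n s t -> D n.+1 s t}) :
  is_dual_differential d1 -> is_dual_differential d2 ->
  forall n s t (v : D n s t), d1 n s t v = d2 n s t v.
Proof.
case=> mul1 in1 c1 [mul2 in2 c2].
have E0 s t (c : FS s t) : d1 0 s t (gen0 c) = d2 0 s t (gen0 c).
  have [p1 p1E ->] := c1 s t c; have [p2 p2E ->] := c2 s t c.
  by congr gen1; apply: gr_rhomP => a u; rewrite p1E p2E.
have E1 s (x : 'I_s) : d1 1 s s.-1 (gen1 (xiGr k x)) = d2 1 s s.-1 (gen1 (xiGr k x)).
  (* Each axiom provides only some element of [U^*] with the prescribed restriction; [gr_rhomP]
     identifies both with [xiGr x]. *)
  have [p1 p1E d1E] := in1 _ _ (xiFI k x); have [p2 p2E d2E] := in2 _ _ (xiFI k x).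
  have -> : xiGr k x = p1 by apply: gr_rhomP => a u; rewrite p1E xiGr_kFI_gr.
  have {2}-> : p1 = p2 by apply: gr_rhomP => a u; rewrite p1E p2E.
  by rewrite d1E d2E.
have Ew s t (w : WG s t) : d1 1 s t (gen1 w) = d2 1 s t (gen1 w).
  rewrite rqd_deg1E (wmul_expand (@eGr_K k)) !linear_sum; apply: eq_bigr => x _.
  rewrite -rqd_deg1E -(rqd_mul_deg0 _ (gen1 (xiGr k x))).
  by apply: etrans (mul1 0 1 _ _ _ _ _) (etrans _ (esym (mul2 0 1 _ _ _ _ _))); rewrite E0 E1.
elim=> [|n IH] s t v; first by move: v; elim/rqd_ind0.
move: v; apply: rqd_eqS => [||r w v]; [exact: linearP|exact: linearP|].
by apply: etrans (mul1 1 n _ _ _ _ _) (etrans _ (esym (mul2 1 n _ _ _ _ _))); rewrite Ew IH.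
Qed.

Lemma koszul_dP : is_koszul_differential (kFS_right_FI k)
  (fun n s t => to_linear (@koszul_d_linear k n s t)).
Proof.
split=> [n s t m y|n s t a m y].
  by rewrite to_linearE koszul_d_telt /koszul_map big_ord0.
(* For source [a.+1], [cof x] and [xiFI x] are convertible to [coface x] and [coface_dual x], so the
   sums agree term by term. *)
rewrite to_linearE koszul_d_telt; apply: eq_bigr => x _.
rewrite fi_homE kFI_deg_kFI_E //; exact: injm_deg_cof.
Qed.

Lemma inclusionP :
  is_dual_inclusion (fun n s t => to_linear (@inclusion_linear k char0 s n t)).
Proof.
split=> [m n a b c x y|s t g|s t p].
- exact: inclusion_mul.
- exact: inclusion_deg0.
exists (dual_ext p) => [a u|]; first exact: dual_ext_kFI_gr.
by rewrite to_linearE rqd_deg1E inclusion_wmul inclusion_one -rqd_deg1E.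
Qed.

End Derivation.

Theorem proposition4 (k : fieldType) (char0 : [pchar k] =i pred0) :
  exists d : forall n s t,
      {linear gr_kFA_dual k n s t -> gr_kFA_dual k n.+1 s t},
  [/\ is_dual_differential d,
      forall d' : forall n s t,
          {linear gr_kFA_dual k n s t -> gr_kFA_dual k n.+1 s t},
        is_dual_differential d' ->
        forall n s t (x : gr_kFA_dual k n s t), d' n s t x = d n s t x,
      forall n s t (x : gr_kFA_dual k n s t), d n.+1 s t (d n s t x) = 0 &
      exists (J : forall n s t,
                {linear kFI_dual k n s t -> gr_kFA_dual k n s t})
             (Phi : forall n s t,
                {linear tens (kFS_FB k) (kFI_dual k n) s t ->
                        gr_kFA_dual k n s t})
             (dK : forall n s t,
                {linear tens (kFS_FB k) (kFI_dual k n) s t ->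
                        tens (kFS_FB k) (kFI_dual k n.+1) s t}),
        [/\ is_dual_inclusion J,
            forall n s t a (c : kFS_FB k a t) (y : kFI_dual k n s a),
              Phi n s t (telt c y) = lact (c : kFS k a t) (J n s a y),
            forall n s t, bijective (Phi n s t),
            (forall n s t t' (g : kFB k t t')
                (u : tens (kFS_FB k) (kFI_dual k n) s t),
              Phi n s t' (lact g u) = lact (kFB_kFS g) (Phi n s t u)) /\
            (forall n s s' t (g : kFB k s' s)
                (u : tens (kFS_FB k) (kFI_dual k n) s t),
              Phi n s' t (ract u g) = ract (Phi n s t u) (kFB_kFS g)) &
            is_koszul_differential (kFS_right_FI k) dK /\
            forall n s t (u : tens (kFS_FB k) (kFI_dual k n) s t),
              Phi n.+1 s t (dK n s t u) = d n s t (Phi n s t u)]].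
Proof.
exists (dual_differential char0); split.
- exact: dual_differentialP.
- by move=> d' d'P; exact: dual_differential_unique (dual_differentialP char0).
- exact: dual_dK.
exists (fun n s t => to_linear (@inclusion_linear k char0 s n t)).
exists (fun n s t => to_linear (@koszul_to_dual_linear k char0 n s t)).
exists (fun n s t => to_linear (@koszul_d_linear k n s t)).
split.
- exact: inclusionP.
- by move=> n s t a c y; exact: koszul_to_dualE.
- move=> n s t; exists (@dual_to_koszul k char0 n s t).
    exact: koszul_to_dualK.
  exact: dual_to_koszulK.
- by split=> *; [exact: koszul_to_dual_lact|exact: koszul_to_dual_ract].
- split; first exact: koszul_dP.
  by move=> n s t u; exact: (esym (dual_d_koszul_to_dual char0 u)).
Qed.
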